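(* Let $\gamma>0$ and $\alpha$ be real parameters and let $I=[0,\infty)$. Let $u_0\in C_b^2(\mathbf{R}^+)$ with $u_0'\in L^1(\mathbf{R}^+)$. Let $g\in C(I)$ with $g(0)=0$ and $f\in C(I,L^1(\mathbf{R}^+))$. Assume $g$ and $f$ are periodic of period $T_0>0$ in $t$, namely, for all $t\ge 0$, $$ g(t+T_0)=g(t)\quad\text{and}\quad f(x,t+T_0)=f(x,t). $$ Then, for any fixed $x>0$, the solution $u$ of the initial- and boundary-value problem $$ \begin{cases} u_t+\alpha u_x-\gamma u_{xxt}=f(x,t), & x\ge 0,\ t\ge 0,\\ u(x,0)=u_0(x), & x\ge 0,\\ u(0,t)=g(t), & t\ge 0, \end{cases} $$ satisfies $$ \lim_{t\to\infty}\bigl(u(x,t+T_0)-u(x,t)\bigr)=0. $$ That is, $u$ is eventually periodic of period $T_0$.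
   Context: $\mathbf{R}^+=[0,\infty)$. $C_b^k(\mathbf{R}^+)$ is the space of $C^k$ functions on $\mathbf{R}^+$ which are bounded together with their first $k$ derivatives. Subscripts on $u$ denote partial derivatives. The solution $u$ is understood to be the one that is continuous in $t$ with values in the bounded continuous functions of $x\in\mathbf{R}^+$.
   Formalization: The formal theorem assumes α ≠ 0; for α = 0 the claim fails, e.g. u0 = 0, g = 0, f = 2√γ e^{−x/√γ} gives u = t x e^{−x/√γ}, whose increment over T0 is the nonzero constant T0 x e^{−x/√γ}. *)

(* Defs.v *)
From mathcomp Require Import all_boot all_order all_algebra.
From mathcomp Require Import all_classical all_reals all_analysis.

Set Implicit Arguments.
Unset Strict Implicit.
Unset Printing Implicit Defensive.

Import Order.TTheory GRing.Theory Num.Theory.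
Import numFieldNormedType.Exports.

Local Open Scope classical_set_scope.
Local Open Scope ring_scope.

Definition halfline (R : realType) : set R := `[0, +oo[%classic.

(* Functions on R^+ are represented by functions on R of which only the
   restriction to [halfline R] matters; hence derivatives are taken within
   the half-line, i.e., they are one-sided at 0. *)
Definition hl_quotient (R : realType) (h : R -> R) (x y : R) : R :=
  (h y - h x) / (y - x).

Definition hl_derivable (R : realType) (h : R -> R) (x : R) : Prop :=
  cvg (hl_quotient h x y @[y --> within (@halfline R) x^']).

Definition hl_derive (R : realType) (h : R -> R) (x : R) : R :=
  lim (hl_quotient h x y @[y --> within (@halfline R) x^']).

(* The space C_b^k(R^+). *)
Fixpoint Cb (R : realType) (k : nat) (h : R -> R) : Prop :=
  [/\ {within @halfline R, continuous h},
      [bounded h x | x in @halfline R] &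
      if k is k'.+1 then
        (forall x : R, 0 <= x -> hl_derivable h x) /\ Cb k' (hl_derive h)
      else True].

Definition L1 (R : realType) (h : R -> R) : Prop :=
  (@lebesgue_measure R).-integrable (@halfline R) (EFin \o h).

(* A function of (x, t) is read as the curve t |-> v (., t). *)
Definition C_Cb (R : realType) (v : R -> R -> R) : Prop :=
  (forall t : R, 0 <= t -> Cb 0 (v ^~ t)) /\
  (forall t : R, 0 <= t ->
     {uniform @halfline R,
       (fun s => v ^~ s) @ within (@halfline R) (nbhs t) --> v ^~ t}).

Definition C_L1 (R : realType) (v : R -> R -> R) : Prop :=
  (forall t : R, 0 <= t -> L1 (v ^~ t)) /\
  (forall t : R, 0 <= t ->
     (\int[@lebesgue_measure R]_(x in @halfline R) `|v x s - v x t|%:E)%E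
       @[s --> within (@halfline R) (nbhs t)] --> 0%E).

Definition d_x (R : realType) (phi : R -> R -> R) : R -> R -> R :=
  fun x t => derive1 (phi ^~ t) x.

Definition d_t (R : realType) (phi : R -> R -> R) : R -> R -> R :=
  fun x t => derive1 (phi x) t.

Fixpoint Ck2 (R : realType) (k : nat) (phi : R -> R -> R) : Prop :=
  continuous (fun p : R * R => phi p.1 p.2) /\
  (if k is k'.+1 then
     [/\ (forall x t : R, derivable (phi ^~ t) x 1),
         (forall x t : R, derivable (phi x) t 1),
         Ck2 k' (d_x phi) & Ck2 k' (d_t phi)]
   else True).

Definition support2 (R : realType) (phi : R -> R -> R) : set (R * R) :=
  closure [set p | phi p.1 p.2 != 0].

(* Test functions: C_c^oo of the open quadrant x > 0, t > 0. *)
Definition test_function (R : realType) (phi : R -> R -> R) : Prop :=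
  [/\ (forall k, Ck2 k phi),
      compact (support2 phi) &
      support2 phi `<=` [set p | 0 < p.1 /\ 0 < p.2]].

(* u_t + alpha u_x - gamma u_xxt = f in the sense of distributions on the open
   quadrant: since g is only continuous in t and f only L^1 in x, u_t and u_xxt
   need not exist as functions.  The integrals are iterated because
   f (., t) is merely a choice of an element of L^1 for each t, so f need not
   be jointly measurable; the inner integral is continuous in t. *)
Definition pde_weak (R : realType) (alpha gamma : R)
    (f u : R -> R -> R) : Prop :=
  forall phi : R -> R -> R, test_function phi ->
    \int[@lebesgue_measure R]_(t in @halfline R)
      \int[@lebesgue_measure R]_(x in @halfline R)
        (u x t * (- d_t phi x t - alpha * d_x phi x t
                  + gamma * d_t (d_x (d_x phi)) x t))
    = \int[@lebesgue_measure R]_(t in @halfline R)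
        \int[@lebesgue_measure R]_(x in @halfline R) (f x t * phi x t).

(* Pitfall: for alpha = 0 solutions may drift.  With u0 = 0, g = 0 and
   f (x, t) = 2 sqrt(gamma) e^(-x/sqrt(gamma)), the (smooth) solution is
   u (x, t) = t x e^(-x/sqrt(gamma)), so u (x, t + T0) - u (x, t) is a nonzero
   constant in t; eventual periodicity requires alpha != 0. *)
Definition is_solution (R : realType) (alpha gamma : R)
    (f : R -> R -> R) (u0 g : R -> R) (u : R -> R -> R) : Prop :=
  [/\ C_Cb u, pde_weak alpha gamma f u,
      (forall x : R, 0 <= x -> u x 0 = u0 x) &
      (forall t : R, 0 <= t -> u 0 t = g t)].

(* Main.v *)
(** Put [k = gamma^(-1/2)].  Testing the weak form with cut-offs in [t] and with
    twice integrated bumps in [x] gives an integrated equation, whose only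
    bounded solution is [u(x, t) = u0(x) + g(t) e^(-k x) + K[M(t)](x)], where
    [M(t)] is the integral over [[0, t]] of [alpha u] minus the primitive of [f]
    in [x], and [V = K[m]] is the bounded solution of [gamma V'' = V + m'],
    [V(0) = 0].  Hence [w(x, t) = u(x, t + T0) - u(x, t)] satisfies
    [w_t = alpha K[w]], and [w(., 0)] has finite energy
    [int (w^2 + gamma w_x^2)], by an energy estimate for [u] on [[0, T0]].

    The energy of [w] does not increase, so that [w] is bounded and
    equicontinuous in [x].  Moreover [int w_x^2], which is bounded, has time
    derivative [c (int e^(-k x) w)^2] for a constant [c != 0]; by Barbalat's
    lemma [W_1 = int e^(-k x) w] tends to [0].  The Laplace transforms
    [W_j = int e^(-j k x) w] with [j > 1] satisfy
    [W_j' = alpha k (j W_j - W_1) / (j^2 - 1)] and are bounded, hence they tend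
    to [0] as well.  Polynomials in [e^(-k x)] concentrating at a given point
    turn this into pointwise convergence. *)

Require Import Defs.
From mathcomp Require Import all_boot all_order all_algebra.
From mathcomp Require Import all_classical all_reals all_analysis.
From mathcomp Require Import measurable_realfun lebesgue_integral_under.
From mathcomp Require Import ring lra.

Set Implicit Arguments.
Unset Strict Implicit.
Unset Printing Implicit Defensive.

Import Order.TTheory GRing.Theory Num.Theory.
Import numFieldNormedType.Exports.

Local Open Scope classical_set_scope.
Local Open Scope ring_scope.

(** * Derivatives and primitives *)

Section calculus.
Context {R : realType}.
Notation mu := (@lebesgue_measure R).
Implicit Types (f g F G : R -> R) (a b c x y : R).

(** Square integrability in [x] is not given: [u0] is merely bounded with [u0'] in [L^1], and [f]
    enters through its primitive, which need not decay. Finite energy comes from the shape of the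
    source of [K[M]]: it is [alpha K[M]], plus a multiple of [e^(-k x)], plus the primitive of an
    [L^1] function. Against the [x]-derivative of [K[M]] the first is exact, the second is
    integrable and the third can be integrated by parts, so that all bounds are uniform in the
    cut-off [L]. A further constant [alpha u(0, 0)] disappears because [g(0) = 0].

    All energies are truncated to [[0, L]]. The terms left at [x = L] tend to zero for each fixed
    [t], but with no rate; dominated convergence in [t] removes them.

    What drives the decay is a boundary term at [x = 0]: the gradient part of the energy changes at
    the rate [- alpha k^2 W_1^2]. Being confined between two constants, it forces [W_1] to be square
    integrable in time whether it decreases ([alpha > 0]) or increases ([alpha < 0]). Likewise the
    equation for [W_j] has a growing mode when [alpha > 0], and boundedness excludes it. *)

Lemma der_cst c x : is_derive x 1 (fun=> c) (0 : R).
Proof. exact: is_derive_cst. Qed.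

Lemma der_id x : is_derive x 1 (fun y : R => y) (1 : R).
Proof. exact: is_derive_id. Qed.

Lemma derD f g x a b : is_derive x 1 f a -> is_derive x 1 g b ->
  is_derive x 1 (fun y => f y + g y) (a + b).
Proof. move=> fa gb; exact: (is_deriveD fa gb). Qed.

Lemma derB f g x a b : is_derive x 1 f a -> is_derive x 1 g b ->
  is_derive x 1 (fun y => f y - g y) (a - b).
Proof. move=> fa gb; exact: (is_deriveB fa gb). Qed.

Lemma derN f x a : is_derive x 1 f a -> is_derive x 1 (fun y => - f y) (- a).
Proof. move=> fa; exact: (is_deriveN fa). Qed.

Lemma derM f g x a b : is_derive x 1 f a -> is_derive x 1 g b ->
  is_derive x 1 (fun y => f y * g y) (a * g x + f x * b).
Proof.
move=> fa gb; apply: (is_derive_eq (is_deriveM fa gb)).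
by rewrite /GRing.scale/= addrC mulrC.
Qed.

Lemma derZ c f x a : is_derive x 1 f a -> is_derive x 1 (fun y => c * f y) (c * a).
Proof. by move=> fa; apply: is_derive_eq (derM (der_cst c x) fa) _; rewrite mul0r add0r. Qed.

Lemma der_sqr f x a : is_derive x 1 f a ->
  is_derive x 1 (fun y => f y ^+ 2) (2 * (f x * a)).
Proof.
by move=> fa; apply: is_derive_eq (derM fa fa) _; rewrite mulrC mulr2n mulrDl mul1r.
Qed.

Lemma der_exp c x : is_derive x 1 (fun y => expR (c * y)) (c * expR (c * x)).
Proof.
have h := is_derive1_comp (is_derive_expR (c * x)) (derZ c (der_id x)).
by apply: (is_derive_eq h); rewrite mulr1 mulrC.
Qed.

Lemma der_continuous f g : (forall x, is_derive x 1 f (g x)) -> continuous f.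
Proof.
move=> df x; apply: differentiable_continuous; apply/derivable1_diffP.
by have [] := df x.
Qed.

Lemma der_derive1 f x a : is_derive x 1 f a -> derive1 f x = a.
Proof. by move=> fa; rewrite derive1E; exact: derive_val. Qed.

Lemma near_der f g x a : (\near x, f x = g x) -> is_derive x 1 f a ->
  is_derive x 1 g a.
Proof.
move=> fg [df <-]; split.
  by apply: near_eq_derivable df; rewrite ?oner_neq0.
by apply/esym/near_eq_derive; rewrite ?oner_neq0.
Qed.

(** Both [G + F] and [G - F] have a nonnegative derivative. With an explicit antiderivative [G] of
    the bound, this replaces the estimation of integrals in most of what follows. *)
Lemma mvt_le F G f g a b : a <= b ->
  (forall x, a <= x <= b -> is_derive x 1 F (f x)) ->
  (forall x, a <= x <= b -> is_derive x 1 G (g x)) ->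
  (forall x, a <= x <= b -> `|f x| <= g x) -> `|F b - F a| <= G b - G a.
Proof.
move=> ab dF dG fg.
have mono (H h : R -> R) : (forall x, a <= x <= b -> is_derive x 1 H (h x)) ->
    (forall x, a <= x <= b -> 0 <= h x) -> 0 <= H b - H a.
  move=> dH h0.
  have [||c] := @MVT_segment R H h a b ab.
  - by move=> x /[!in_itv]/= /andP[ax xb]; apply: dH; rewrite !ltW.
  - apply: derivable_within_continuous => x /[!in_itv]/= xab.
    by have [] := dH _ xab.
  - by rewrite in_itv/= => cab ->; rewrite mulr_ge0 ?h0// subr_ge0.
rewrite ler_norml; apply/andP; split.
  rewrite -subr_ge0 opprK.
  have := mono (fun x => F x + G x) (fun x => f x + g x).
  have -> : F b + G b - (F a + G a) = F b - F a + (G b - G a) by ring.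
  apply=> x xab; first exact: derD (dF _ xab) (dG _ xab).
  by have := fg _ xab; rewrite ler_norml => /andP[+ _]; rewrite -subr_ge0 opprK.
rewrite -subr_ge0.
have := mono (fun x => G x - F x) (fun x => g x - f x).
have -> : G b - F b - (G a - F a) = G b - G a - (F b - F a) by ring.
apply=> x xab; first exact: derB (dG _ xab) (dF _ xab).
by have := fg _ xab; rewrite ler_norml => /andP[_]; rewrite -subr_ge0.
Qed.

Lemma lip_der F f C a b : a <= b ->
  (forall x, a <= x <= b -> is_derive x 1 F (f x)) ->
  (forall x, a <= x <= b -> `|f x| <= C) -> `|F b - F a| <= C * (b - a).
Proof.
move=> ab dF fC; rewrite mulrBr.
apply: (@mvt_le F (fun x => C * x) f (fun=> C)) => // x _.
by apply: is_derive_eq (derZ C (der_id x)) _; rewrite mulr1.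
Qed.

Lemma integrable_seg f a b : continuous f -> mu.-integrable `[a, b] (EFin \o f).
Proof.
move=> cf; apply: continuous_compact_integrable; first exact: segment_compact.
exact: continuous_subspaceT.
Qed.

(** The signed integral from [0] to [x]; at least one of the two terms is zero. Negative [x] are
    included so that [prim f] is an antiderivative on all of [R], with a two-sided derivative at
    [0]. *)
Definition prim f x : R :=
  \int[mu]_(t in `[0, x]) f t - \int[mu]_(t in `[x, 0]) f t.

Lemma Rint_segU f a b c : continuous f -> a <= b -> b <= c ->
  \int[mu]_(t in `[a, c]) f t =
  \int[mu]_(t in `[a, b]) f t + \int[mu]_(t in `[b, c]) f t.
Proof.
move=> cf ab bc.
have := @Rintegral_itvB R f (BLeft a) (BRight c) b (integrable_seg a c cf).
rewrite !bnd_simp => /(_ ab bc).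
rewrite Rintegral_itv_obnd_cbnd; first by move=> <-; ring.
by apply: integrableS (integrable_seg b c cf) => //; apply: subset_itvr; rewrite bnd_simp.
Qed.

Lemma Rint_seg11 f a : \int[mu]_(t in `[a, a]) f t = 0.
Proof. by rewrite set_itv1 Rintegral_set1. Qed.

Lemma Rint_seg_ge f a b : b <= a -> \int[mu]_(t in `[a, b]) f t = 0.
Proof.
rewrite le_eqVlt => /predU1P[->|ba]; first exact: Rint_seg11.
by rewrite set_itv_ge ?bnd_simp -?ltNge// Rintegral_set0.
Qed.

Lemma primE f a x : continuous f -> a <= 0 -> a <= x ->
  prim f x = \int[mu]_(t in `[a, x]) f t - \int[mu]_(t in `[a, 0]) f t.
Proof.
move=> cf a0 ax; rewrite /prim; have [x0|x0] := leP 0 x.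
  by rewrite (Rint_segU cf a0 x0) (@Rint_seg_ge _ x)//; ring.
by rewrite (Rint_segU cf ax (ltW x0)) (@Rint_seg_ge _ 0) ?ltW//; ring.
Qed.

Lemma der_prim f x : continuous f -> is_derive x 1 (prim f) (f x).
Proof.
(* [a] lies to the left of both [0] and [x]; near [x], [prim f] then differs by a constant from the
   integral with fixed lower end [a]. *)
move=> cf; pose a := - `|x| - 1; pose u := `|x| + 1.
have a0 : a <= 0 by rewrite /a; have := normr_ge0 x; lra.
have ax : a < x.
  by rewrite /a; have := ler_norm (- x); rewrite normrN; lra.
have xu : x < u by rewrite /u; have := ler_norm x; lra.
have h : is_derive x 1 (fun y => \int[mu]_(t in `[a, y]) f t) (f x).
  have [||| d1 d2] := @continuous_FTC1_closed R f a x u xu.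
  - exact: integrable_seg.
  - exact: ax.
  - exact: cf.
  - by apply: DeriveDef; [exact: d1|rewrite -derive1E d2].
apply: near_der (is_derive_eq (derB h (der_cst (\int[mu]_(t in `[a, 0]) f t) x)) _); last first.
  by rewrite subr0.
near=> y; rewrite (@primE f a)//; apply/ltW.
by near: y; exact: lt_nbhsr.
Unshelve. all: by end_near. Qed.

Lemma prim0 f : prim f 0 = 0.
Proof. by rewrite /prim !Rint_seg11 subr0. Qed.

Lemma der0_cst F : (forall x, is_derive x 1 F (0 : R)) -> forall x, F x = F 0.
Proof. move=> dF x; exact: is_derive_0_is_cst. Qed.

Lemma prim_der F f : continuous f -> (forall x, is_derive x 1 F (f x)) ->
  forall x, prim f x = F x - F 0.
Proof.
move=> cf dF x.
suff /(_ x) : forall x, F x - prim f x = F 0 - prim f 0 by rewrite prim0; lra.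
apply: der0_cst => y.
by apply: is_derive_eq (derB (dF y) (der_prim y cf)) _; rewrite subrr.
Qed.

Lemma prim_ge0 f x : 0 <= x -> prim f x = \int[mu]_(t in `[0, x]) f t.
Proof. by move=> x0; rewrite /prim (@Rint_seg_ge _ x)// subr0. Qed.

Lemma Rint_prim f a b : continuous f -> a <= b ->
  \int[mu]_(t in `[a, b]) f t = prim f b - prim f a.
Proof.
move=> cf ab.
have m0 : Num.min a 0 <= 0 by rewrite ge_min lexx orbT.
have ma : Num.min a 0 <= a by rewrite ge_min lexx.
rewrite (primE cf m0 ma) (primE cf m0 (le_trans ma ab)).
by rewrite (Rint_segU cf ma ab); ring.
Qed.

Lemma continuous_prim f : continuous f -> continuous (prim f).
Proof. by move=> cf; apply: der_continuous => x; exact: der_prim. Qed.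

Lemma prim_ext f g x : 0 <= x -> (forall y, 0 <= y <= x -> f y = g y) ->
  prim f x = prim g x.
Proof.
move=> x0 fg; rewrite !prim_ge0//; apply: eq_Rintegral => y.
by rewrite inE/= in_itv/= => /fg.
Qed.

Lemma cst_continuous c : continuous (fun _ : R => c).
Proof. by move=> ?; exact: cvg_cst. Qed.

Lemma contD f g : continuous f -> continuous g -> continuous (fun y => f y + g y).
Proof. by move=> cf cg y; apply: cvgD; [exact: cf|exact: cg]. Qed.

Lemma contM f g : continuous f -> continuous g -> continuous (fun y => f y * g y).
Proof. by move=> cf cg y; apply: cvgM; [exact: cf|exact: cg]. Qed.

Lemma contZ c f : continuous f -> continuous (fun y => c * f y).
Proof. by move=> cf; apply: contM => //; exact: cst_continuous. Qed.

Lemma contN f : continuous f -> continuous (fun y => - f y).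
Proof. by move=> cf y; apply: cvgN; exact: cf. Qed.

Lemma contB f g : continuous f -> continuous g -> continuous (fun y => f y - g y).
Proof. by move=> cf cg y; apply: cvgB; [exact: cf|exact: cg]. Qed.

Lemma cont_exp c : continuous (fun y : R => expR (c * y)).
Proof. by apply: der_continuous => x; exact: der_exp. Qed.

Lemma primD f g x : continuous f -> continuous g ->
  prim (fun y => f y + g y) x = prim f x + prim g x.
Proof.
move=> cf cg.
have d y : is_derive y 1 (fun y => prim f y + prim g y) (f y + g y).
  by apply: derD; exact: der_prim.
by have := prim_der (contD cf cg) d x; rewrite !prim0 addr0 subr0.
Qed.

Lemma primZ c f x : continuous f -> prim (fun y => c * f y) x = c * prim f x.
Proof.
move=> cf.
have d y : is_derive y 1 (fun y => c * prim f y) (c * f y).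
  by apply: derZ; exact: der_prim.
by have := prim_der (contZ (c := c) cf) d x; rewrite !prim0 mulr0 subr0.
Qed.

Lemma primN f x : continuous f -> prim (fun y => - f y) x = - prim f x.
Proof.
by move=> cf; rewrite -mulN1r -primZ//; congr prim; apply/funext => y; rewrite mulN1r.
Qed.

Lemma primB f g x : continuous f -> continuous g ->
  prim (fun y => f y - g y) x = prim f x - prim g x.
Proof.
by move=> cf cg; rewrite primD ?primN//; exact: contN.
Qed.

End calculus.

(** * Integrals with a parameter and improper integrals *)

Section integrals.
Context {R : realType}.
Notation mu := (@lebesgue_measure R).
Implicit Types (f g F G m : R -> R) (a b c k s t x y : R).

Lemma ball_itv t s : `]t - 1, t + 1[%classic s <-> `|s - t| < 1.
Proof.
rewrite /= in_itv/= ltr_norml; split => /andP[h1 h2]; apply/andP; split; lra.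
Qed.

(** Domination is asked only for [s] within distance [1] of [t], because the bounds on the sources
    are local in time. *)
Lemma der_int (B : set R) (f f' : R -> R -> R) G t : measurable B ->
  (forall s, `|s - t| < 1 -> mu.-integrable B (EFin \o f s)) ->
  (forall s y, `|s - t| < 1 -> B y -> is_derive s 1 (f ^~ y) (f' s y)) ->
  mu.-integrable B (EFin \o G) ->
  (forall s y, `|s - t| < 1 -> B y -> `|f' s y| <= G y) ->
  is_derive t 1 (fun s => \int[mu]_(y in B) f s y) (\int[mu]_(y in B) f' t y).
Proof.
move=> mB fi fd Gi fG.
have tI : `]t - 1, t + 1[%classic t by apply/ball_itv; rewrite subrr normr0.
have fi' s : `]t - 1, t + 1[%classic s -> mu.-integrable B (EFin \o f s).
  by move=> /ball_itv; exact: fi.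
have fd' s y : `]t - 1, t + 1[%classic s -> B y -> derivable (f ^~ y) s 1.
  by move=> /ball_itv sI By; have [] := fd s y sI By.
have Gi' : mu.-integrable B (EFin \o (fun y => `|G y|)).
  exact: integrable_norm.
have fG' s y : `]t - 1, t + 1[%classic s -> B y ->
    `|partial1of2 f s y| <= `|G y|.
  move=> /ball_itv sI By; rewrite /partial1of2.
  have := @der_derive1 R (f ^~ y) s (f' s y) (fd s y sI By).
  by move=> ->; apply: le_trans (fG _ _ sI By) (ler_norm _).
have G0 y : 0 <= `|G y| by [].
have d := @derivable_under_integral R _ _ mu f B mB _ _ _ tI fi' fd' _ G0 Gi' fG'.
refine (DeriveDef d _).
rewrite -derive1E (@differentiation_under_integral R _ _ mu f B mB _ _ _ tI fi' fd' _ G0 Gi' fG').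
apply: eq_Rintegral => y; rewrite inE => By.
rewrite /partial1of2.
apply: (@der_derive1 R (f ^~ y)); apply: fd => //.
by rewrite subrr normr0.
Qed.

Lemma cont_int (B : set R) (f : R -> R -> R) G t : measurable B ->
  (forall s, `|s - t| < 1 -> mu.-integrable B (EFin \o f s)) ->
  (forall y, B y -> continuous (f ^~ y)) ->
  mu.-integrable B (EFin \o G) ->
  (forall s y, `|s - t| < 1 -> B y -> `|f s y| <= G y) ->
  {for t, continuous (fun s => \int[mu]_(y in B) f s y)}.
Proof.
move=> mB fi fc Gi fG.
apply: (@continuity_under_integral R _ _ mu f B mB (t - 1) (t + 1) _ _ G Gi).
- by move=> s /ball_itv; exact: fi.
- by apply: aeW => y By s _; exact: fc.
- by move=> s /ball_itv sI; apply: aeW => y By; exact: fG.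
- by rewrite inE; apply/ball_itv; rewrite subrr normr0.
Qed.

Lemma integrable_cst_seg c a b : mu.-integrable `[a, b] (EFin \o (fun=> c)).
Proof. by apply: integrable_seg; exact: cst_continuous. Qed.

Lemma der_prim_param (f f' : R -> R -> R) C t x : 0 <= x ->
  (forall s, continuous (f s)) ->
  (forall s y, 0 <= y -> is_derive s 1 (f ^~ y) (f' s y)) ->
  (forall s y, `|s - t| < 1 -> 0 <= y <= x -> `|f' s y| <= C) ->
  is_derive t 1 (fun s => prim (f s) x) (prim (f' t) x).
Proof.
move=> x0 fc fd fC.
have := @der_int `[0, x]%classic f f' (fun=> C) t (measurable_itv _).
rewrite (_ : (fun s => prim (f s) x) =
             (fun s => \int[mu]_(y in `[0, x]) f s y)); last first.
  by apply/funext => s; rewrite prim_ge0.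
rewrite prim_ge0//; apply.
- by move=> s _; exact: integrable_seg.
- by move=> s y _ /=; rewrite in_itv/= => /andP[y0 _]; exact: fd.
- exact: integrable_cst_seg.
- by move=> s y st /=; rewrite in_itv/=; exact: fC.
Qed.

Lemma cont_prim_param (f : R -> R -> R) C t x : 0 <= x ->
  (forall s, continuous (f s)) ->
  (forall y, 0 <= y -> continuous (f ^~ y)) ->
  (forall s y, `|s - t| < 1 -> 0 <= y <= x -> `|f s y| <= C) ->
  {for t, continuous (fun s => prim (f s) x)}.
Proof.
move=> x0 fc fd fC.
have := @cont_int `[0, x]%classic f (fun=> C) t (measurable_itv _).
rewrite (_ : (fun s => prim (f s) x) =
             (fun s => \int[mu]_(y in `[0, x]) f s y)); last first.
  by apply/funext => s; rewrite prim_ge0.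
apply.
- by move=> s _; exact: integrable_seg.
- by move=> y /=; rewrite in_itv/= => /andP[y0 _]; exact: fd.
- exact: integrable_cst_seg.
- by move=> s y st /=; rewrite in_itv/=; exact: fC.
Qed.

Lemma measurable_hl : measurable (@halfline R).
Proof. exact: measurable_itv. Qed.

Lemma halflineE y : halfline y <-> 0 <= y.
Proof. by rewrite /halfline/= in_itv/= andbT. Qed.

Lemma integrable_exp k : 0 < k ->
  mu.-integrable (@halfline R) (EFin \o (fun y => expR (- k * y))).
Proof.
move=> k0.
have h : mu.-integrable (@halfline R) (EFin \o exponential_pdf k).
  apply: integrableS (integrable_exponential_pdf k0) => //.
  exact: measurable_hl.
have := @integrableZl _ _ _ mu _ measurable_hl k^-1 _ h; apply: eq_integrable.
  exact: measurable_hl.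
move=> y; rewrite inE => /halflineE y0 /=.
by rewrite exponential_pdfE// -EFinM mulrA mulVf ?mul1r// gt_eqF.
Qed.

Lemma integrable_expM k C m : 0 < k -> continuous m ->
  (forall y, 0 <= y -> `|m y| <= C) ->
  mu.-integrable (@halfline R) (EFin \o (fun y => expR (- k * y) * m y)).
Proof.
move=> k0 cm mC.
apply: (@le_integrable _ _ _ mu _ measurable_hl _
  (fun y => C%:E * (expR (- k * y))%:E)%E).
- apply/measurable_EFinP.
  apply: measurable_funS measurableT (@subsetT _ _) _.
  by apply: continuous_measurable_fun; apply: contM cm; exact: cont_exp.
- move=> y /halflineE y0 /=; rewrite lee_fin !normrM mulrC.
  apply: ler_wpM2r; first exact: normr_ge0.
  exact: le_trans (mC _ y0) (ler_norm _).
- exact: (@integrableZl _ _ _ mu _ measurable_hl C _ (integrable_exp k0)).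
Qed.

(** Along any sequence tending to infinity the truncated integrands are dominated by [|f|], so the
    improper integral agrees with the Lebesgue integral. *)
Lemma prim_cvg_hl f : continuous f ->
  mu.-integrable (@halfline R) (EFin \o f) ->
  prim f L @[L --> +oo] --> \int[mu]_(y in @halfline R) f y.
Proof.
move=> cf fi; apply/cvg_pinftyP => u uoo.
have mf : measurable_fun (@halfline R) (EFin \o f).
  by have /integrableP[] := fi.
have h : (\int[mu]_(y in @halfline R) ((EFin \o f) \_ `[0%R, u n]) y)%E @[n --> \oo] -->
    (\int[mu]_(y in @halfline R) (EFin \o f) y)%E.
  apply: (@dominated_cvg _ _ _ mu _ measurable_hl _ _ (fun y => `|(EFin \o f) y|)%E).
  - move=> n; apply/measurable_restrict => //; first exact: measurable_hl.
    by apply: measurable_funS mf => //; exact: measurable_hl.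
  - move=> y /halflineE y0; apply: cvg_near_cst.
    have /cvgryPge/(_ y) := uoo; apply: filterS => n yu.
    by rewrite patchE mem_set//= in_itv/= y0.
  - by move=> y _.
  - exact: integrable_abse.
  - move=> n y _; rewrite patchE; case: ifP => // _.
    by rewrite abse0.
have hfin : (\int[mu]_(y in @halfline R) (EFin \o f) y)%E \is a fin_num.
  by apply: integrable_fin_num => //; exact: measurable_hl.
rewrite /Rintegral.
have : (fun n => fine (\int[mu]_(y in @halfline R) ((EFin \o f) \_ `[0%R, u n]) y)%E)
  @ \oo --> fine (\int[mu]_(y in @halfline R) (EFin \o f) y)%E.
  by apply: fine_cvg; rewrite fineK.
apply: cvg_trans; apply: near_eq_cvg.
have /cvgryPge/(_ 0) := uoo; apply: filterS => n un0.
rewrite prim_ge0// /Rintegral -integral_mkcondr; congr fine; congr (integral _ _ _).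
apply/seteqP; split => y /=; rewrite /halfline/= !in_itv/= ?andbT.
  by case=> _.
by move=> /[dup] /andP[-> _] ->.
Qed.

Lemma hl_unique f l : continuous f -> mu.-integrable (@halfline R) (EFin \o f) ->
  prim f L @[L --> +oo] --> l -> \int[mu]_(y in @halfline R) f y = l.
Proof. by move=> cf fi fl; exact: (cvg_unique _ (prim_cvg_hl cf fi) fl). Qed.

End integrals.

(** * Decay as [t] tends to infinity *)

Section asymptotics.
Context {R : realType}.
Notation mu := (@lebesgue_measure R).
Implicit Types (f g y phi : R -> R) (a b c t T e C lam : R).

Definition vanishes f := forall e, 0 < e -> exists T, forall t, T <= t -> `|f t| <= e.

Lemma vanishes_cvg f : vanishes f <-> f t @[t --> +oo] --> (0 : R).
Proof.
split=> [f0|/cvgrPdist_le f0 e e0].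
  apply/cvgrPdist_le => /= e e0; have [T fT] := f0 _ e0.
  near=> t; rewrite sub0r normrN; apply: fT.
  by near: t; apply: nbhs_pinfty_ge; rewrite num_real.
have [T [_ hT]] := f0 _ e0.
exists (T + 1) => t Tt.
by have := hT t; rewrite sub0r normrN; apply; lra.
Unshelve. all: by end_near. Qed.

Lemma vanishesD f g : vanishes f -> vanishes g -> vanishes (fun t => f t + g t).
Proof.
move=> f0 g0 e e0.
have e2 : 0 < e / 2 by lra.
have [T1 h1] := f0 _ e2; have [T2 h2] := g0 _ e2.
exists (Num.max T1 T2) => t; rewrite ge_max => /andP[t1 t2].
apply: le_trans (ler_normD _ _) _.
by have := h1 _ t1; have := h2 _ t2; lra.
Qed.

Lemma vanishesM f g C T0 : (forall t, T0 <= t -> `|f t| <= C) -> vanishes g ->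
  vanishes (fun t => f t * g t).
Proof.
move=> fC g0 e e0.
have C0 : 0 <= C by apply: le_trans (fC T0 (lexx _)).
have [|T gT] := g0 (e / (C + 1)); first by apply: divr_gt0 => //; lra.
exists (Num.max T0 T) => t; rewrite ge_max => /andP[t0 t1].
rewrite normrM.
apply: le_trans (ler_pM (normr_ge0 _) (normr_ge0 _) (fC _ t0) (gT _ t1)) _.
rewrite mulrA ler_pdivrMr; last by lra.
by rewrite mulrC ler_pM2l//; lra.
Qed.

Lemma vanishesZ c f : vanishes f -> vanishes (fun t => c * f t).
Proof. by apply: (@vanishesM (fun=> c) f `|c| 0). Qed.

Lemma vanishes_le f g T0 : (forall t, T0 <= t -> `|f t| <= `|g t|) ->
  vanishes g -> vanishes f.
Proof.
move=> fg g0 e e0; have [T h] := g0 _ e0.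
exists (Num.max T0 T) => t; rewrite ge_max => /andP[t0 t1].
exact: le_trans (fg _ t0) (h _ t1).
Qed.

Lemma exp_small C e : 0 <= C -> 0 < e -> exists2 x, 0 <= x & expR (- x) * C <= e.
Proof.
move=> C0 e0; exists (C / e); first by rewrite divr_ge0// ltW.
rewrite expRN mulrC ler_pdivrMr ?expR_gt0//.
rewrite -ler_pdivrMl// mulrC.
by apply: le_trans (expR_ge1Dx _); lra.
Qed.

(* Both signs of [lam] are allowed: if [lam > 0] then a bounded solution is
   determined by its behaviour at infinity. *)
Lemma ode_vanishes lam y phi C : lam != 0 ->
  (forall t, 0 <= t -> is_derive t 1 y (lam * y t + phi t)) ->
  (forall t, 0 <= t -> `|y t| <= C) -> vanishes phi -> vanishes y.
Proof.
move=> lam0 dy yC phi0 e e0.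
have C0 : 0 <= C by apply: le_trans (yC 0 (lexx _)).
have nl : 0 < `|lam| by rewrite normr_gt0.
have e2 : 0 < e / 2 by lra.
have [|T1 hT1] := phi0 (e / 2 * `|lam|); first exact: mulr_gt0.
pose T := Num.max T1 0.
have hT t : T <= t -> `|phi t| <= e / 2 * `|lam|.
  by rewrite ge_max => /andP[+ _]; exact: hT1.
have T0 : 0 <= T by rewrite le_max lexx orbT.
(* With the integrating factor, [z' = e^(-lam t) phi]. In the antiderivative of the bound
   [(e / 2) |lam| e^(-lam t)], the quotient [|lam| / lam] is the sign of [lam]; this treats both
   signs in one formula. *)
pose z t := expR (- lam * t) * y t.
have zE a b : T <= a -> a <= b -> `|z b - z a| <=
    - (`|lam| / lam) * (e / 2) * expR (- lam * b) +
      (`|lam| / lam) * (e / 2) * expR (- lam * a).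
  move=> Ta ab.
  have := @mvt_le R z (fun t => - (`|lam| / lam) * (e / 2) * expR (- lam * t))
    (fun t => expR (- lam * t) * phi t)
    (fun t => (e / 2 * `|lam|) * expR (- lam * t)) a b ab.
  rewrite !mulNr !opprK; apply => t /andP[aT _].
  - have t0 : 0 <= t by rewrite (le_trans T0)// (le_trans Ta).
    apply: is_derive_eq (derM (der_exp _ _) (dy _ t0)) _; ring.
  - apply: is_derive_eq (derZ _ (der_exp _ _)) _.
    by field.
  - rewrite normrM mulrC (@ger0_norm _ (expR _)) ?expR_ge0//.
    apply: ler_wpM2r; first exact: expR_ge0.
    by apply: hT; exact: le_trans aT.
have yz t : y t = expR (lam * t) * z t.
  by rewrite /z mulrA -expRD mulNr subrr expR0 mul1r.
have [x x0 hx] := exp_small C0 e2.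
have [lp|ln] := ltP 0 lam.
(* For [lam > 0], [z t] is compared with a later value [z s]. The delay [x / lam] is chosen so that
   the bound [C] on [y s] is damped by [e^(-x)]. *)
- exists T => t Tt; pose s := t + x / lam.
  have ts : t <= s by rewrite lerDl divr_ge0// ltW.
  have := zE _ _ Tt ts.
  have -> : `|lam| / lam = 1 by rewrite (gtr0_norm lp) divff.
  rewrite !mulN1r mul1r => h.
  rewrite yz normrM ger0_norm ?expR_ge0//.
  have h1 : `|z t| <= expR (- lam * s) * C + e / 2 * expR (- lam * t).
    have zs : `|z s| <= expR (- lam * s) * C.
      rewrite normrM ger0_norm ?expR_ge0// ler_pM2l ?expR_gt0//.
      by apply: yC; rewrite (le_trans T0)// (le_trans Tt).
    have := ler_distD (z s) (z t) 0; rewrite !subr0 distrC.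
    have : 0 <= e / 2 * expR (- lam * s) by rewrite mulr_ge0 ?expR_ge0 ?ltW.
    move: h zs; lra.
  apply: le_trans (ler_wpM2l (expR_ge0 _) h1) _.
  rewrite mulrDr mulrA -expRD mulrCA -expRD.
  have -> : lam * t + - lam * s = - x by rewrite /s; field.
  by rewrite mulNr subrr expR0 mulr1; move: hx; lra.
(* For [lam < 0], [z t] is compared with the fixed earlier value [z T]; after a waiting time
   [x / - lam] its contribution is damped by [e^(-x)]. *)
- have {}ln : lam < 0 by rewrite lt_neqAle lam0.
  exists (T + x / - lam) => t Tt; pose s := t.
  have Tt' : T <= t.
    by apply: le_trans Tt; rewrite lerDl divr_ge0// oppr_ge0 ltW.
  have := zE _ _ (lexx _) Tt'.
  have -> : `|lam| / lam = -1 by rewrite (ltr0_norm ln) mulNr divff.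
  rewrite opprK mul1r mulN1r => h.
  rewrite yz normrM ger0_norm ?expR_ge0//.
  have h1 : `|z t| <= expR (- lam * T) * C + e / 2 * expR (- lam * t).
    have zs : `|z T| <= expR (- lam * T) * C.
      rewrite normrM ger0_norm ?expR_ge0// ler_pM2l ?expR_gt0//.
      exact: yC.
    have := ler_distD (z T) (z t) 0; rewrite !subr0.
    have : 0 <= e / 2 * expR (- lam * T) by rewrite mulr_ge0 ?expR_ge0 ?ltW.
    move: h zs; lra.
  apply: le_trans (ler_wpM2l (expR_ge0 _) h1) _.
  rewrite mulrDr mulrA -expRD mulrCA -expRD.
  have -> : lam * t + - lam * t = 0 by ring.
  rewrite expR0 mulr1.
  suff : expR (lam * t + - lam * T) * C <= expR (- x) * C by move: hx; lra.
  apply: ler_wpM2r => //; rewrite ler_expR.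
  move: Tt; rewrite -lerBrDl ler_pdivrMr ?oppr_gt0//; lra.
Qed.

(** A time [t] with [|y t| > e] is followed by a whole interval of length [d] on which
    [|y| >= e / 2], by the Lipschitz bound. Each such interval adds [eta] to the integral of [y^2],
    so arbitrarily late ones would push it beyond [C]. *)
Lemma barbalat y L C : continuous y -> 0 <= L ->
  (forall a b, 0 <= a -> a <= b -> `|y b - y a| <= L * (b - a)) ->
  (forall T, 0 <= T -> prim (fun t => y t ^+ 2) T <= C) -> vanishes y.
Proof.
move=> cy L0 yL yC e e0; apply: contrapT => /forallNP ne.
have cy2 : continuous (fun t => y t ^+ 2) by move=> t; apply: cvgM; exact: cy.
(* [L * d <= e / 2], where [L + 1] avoids a division by zero, and [eta] is [(e / 2)^2] times the
   length [d]. *)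
pose d := e / (2 * (L + 1)).
have d0 : 0 < d by apply: divr_gt0 => //; lra.
pose eta := e ^+ 2 / 4 * d.
have eta0 : 0 < eta by apply: mulr_gt0 => //; apply: divr_gt0 => //; apply: exprn_gt0.
have mono a b : 0 <= a -> a <= b ->
    prim (fun t => y t ^+ 2) a <= prim (fun t => y t ^+ 2) b.
  move=> a0 ab; rewrite -subr_ge0 -Rint_prim//.
  by apply: Rintegral_ge0 => t _; exact: sqr_ge0.
have step T : 0 <= T -> exists2 T', 0 <= T' &
    prim (fun t => y t ^+ 2) T + eta <= prim (fun t => y t ^+ 2) T'.
  move=> T0.
  have /existsNP[t /not_implyP[Tt /negP]] := ne T; rewrite -ltNge => yt.
  have t0 : 0 <= t by exact: le_trans Tt.
  exists (t + d); first by rewrite addr_ge0// ltW.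
  rewrite (le_trans (lerD (mono _ _ T0 Tt) (lexx eta)))//.
  rewrite addrC -lerBrDr.
  have td : t <= t + d by rewrite lerDl ltW.
  have := @mvt_le R (fun s => e ^+ 2 / 4 * s) (prim (fun t => y t ^+ 2))
     (fun=> e ^+ 2 / 4) (fun t => y t ^+ 2) t (t + d) td.
  have -> : e ^+ 2 / 4 * (t + d) - e ^+ 2 / 4 * t = eta by rewrite /eta; ring.
  rewrite (ger0_norm (ltW eta0)); apply.
  - by move=> x _; apply: is_derive_eq (derZ _ (der_id _)) _; rewrite mulr1.
  - by move=> x _; exact: der_prim.
  - move=> x /andP[tx xd]; rewrite ger0_norm ?divr_ge0 ?sqr_ge0//.
    have h := yL _ _ t0 tx.
    have xt : L * (x - t) <= e / 2.
      apply: (@le_trans _ _ ((L + 1) * d)).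
        apply: ler_pM; rewrite ?subr_ge0//; last by move: xd; lra.
        by lra.
      by rewrite /d le_eqVlt; apply/orP; left; apply/eqP; field; lra.
    have yx : e / 2 <= `|y x|.
      have := ler_distD (y x) (y t) 0; rewrite !subr0 distrC.
      by move: h xt yt; lra.
    rewrite -[leRHS]real_normK ?num_real//.
    have -> : e ^+ 2 / 4 = (e / 2) ^+ 2 by field.
    by rewrite lerXn2r// nnegrE; lra.
have [N hN] : exists N : nat, C < N%:R * eta.
  exists (Num.bound `|C / eta|).
  by rewrite -ltr_pdivrMr//; exact: le_lt_trans (ler_norm _) (archi_boundP (normr_ge0 _)).
have /(_ N)[T T0 hT] n : exists2 T, 0 <= T & n%:R * eta <= prim (fun t => y t ^+ 2) T.
  elim: n => [|n [T T0 hT]]; first by exists 0; rewrite // mul0r prim0.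
  have [T' T'0 h] := step T T0; exists T' => //.
  by move: h hT; rewrite -natr1 mulrDl mul1r; lra.
by have := yC T T0; move: hT hN; lra.
Qed.

(** In the applications [n] is the spatial cut-off and [phi n] the boundary terms at [x = n]. They
    vanish pointwise in time under a common bound, and no uniform rate is available. *)
Lemma dominated_increment (E phi : nat -> R -> R) a b C : a <= b ->
  (forall n t, is_derive t 1 (E n) (phi n t)) -> (forall n, continuous (phi n)) ->
  (forall n t, a <= t <= b -> `|phi n t| <= C) ->
  (forall t, a <= t <= b -> phi n t @[n --> \oo] --> (0 : R)) ->
  (E n b - E n a) @[n --> \oo] --> (0 : R).
Proof.
move=> ab dE cphi phiC phi0.
have EE n : E n b - E n a = \int[mu]_(t in `[a, b]) phi n t.
  by rewrite Rint_prim// !(prim_der (cphi n) (dE n)); ring.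
have : (\int[mu]_(t in `[a, b]) (phi n t)%:E)%E @[n --> \oo] -->
    (\int[mu]_(t in `[a, b]) (EFin \o (fun _ : R => 0%R)) t)%E.
  apply: (@dominated_cvg _ _ _ mu _ (measurable_itv _) _ _ (EFin \o (fun=> C))).
  - move=> n; apply/measurable_EFinP.
    apply: measurable_funS measurableT (@subsetT _ _) _.
    exact: continuous_measurable_fun.
  - move=> t /=; rewrite in_itv/= => tab.
    by apply: cvg_EFin; [exact: nearW|exact: phi0].
  - by [].
  - exact: integrable_cst_seg.
  - by move=> n t /=; rewrite in_itv/= lee_fin; exact: phiC.
rewrite integral0_eq//.
move=> /fine_cvg; rewrite /= => h.
by apply: cvg_trans h; apply: near_eq_cvg; apply: nearW => n /=; rewrite EE.
Qed.

End asymptotics.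

(** * The operators [K] and [R] *)

Section kernel.
Context {R : realType}.
Notation mu := (@lebesgue_measure R).
Implicit Types (f g m : R -> R) (a b c t s x y C : R).

Definition bdd m := exists C, forall y, 0 <= y -> `|m y| <= C.

Definition Lap c m : R := \int[mu]_(y in @halfline R) (expR (- c * y) * m y).

Lemma Lap_int c m : 0 < c -> continuous m -> bdd m ->
  mu.-integrable (@halfline R) (EFin \o (fun y => expR (- c * y) * m y)).
Proof. by move=> c0 cm [C mC]; exact: integrable_expM c0 cm mC. Qed.

Lemma cont_expM c m : continuous m -> continuous (fun y => expR (c * y) * m y).
Proof. by move=> cm; apply: contM => //; exact: cont_exp. Qed.

Lemma LapB c f g : 0 < c -> continuous f -> continuous g -> bdd f -> bdd g ->
  Lap c (fun y => f y - g y) = Lap c f - Lap c g.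
Proof.
move=> c0 cf cg bf bg; rewrite /Lap -RintegralB; [|exact: measurable_hl|exact: Lap_int..].
by apply: eq_Rintegral => y _; rewrite mulrBr.
Qed.

Lemma LapZ c a f : 0 < c -> continuous f -> bdd f ->
  Lap c (fun y => a * f y) = a * Lap c f.
Proof.
move=> c0 cf bf; rewrite /Lap -RintegralZl; [|exact: measurable_hl|exact: Lap_int].
by apply: eq_Rintegral => y _; rewrite mulrCA.
Qed.

Lemma eq_Lap c f g : (forall y, 0 <= y -> f y = g y) -> Lap c f = Lap c g.
Proof.
by move=> fg; apply: eq_Rintegral => y; rewrite inE => /halflineE /fg ->.
Qed.

(** The difference is the tail of the integral over [[x, +oo)], dominated by [C e^(-c y)]. The
    factor [e^(-c x)] is what keeps [Qk] bounded. *)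
Lemma Lap_prim_le c m C x : 0 < c -> continuous m -> 0 <= x ->
  (forall y, x <= y -> `|m y| <= C) ->
  bdd m ->
  `|Lap c m - prim (fun y => expR (- c * y) * m y) x| <= C / c * expR (- c * x).
Proof.
move=> c0 cm x0 mC bm.
have C0 : 0 <= C by exact: le_trans (mC x (lexx _)).
have ce := cont_expM (c := - c) cm.
have h := prim_cvg_hl ce (Lap_int c0 cm bm).
have h' : `|prim (fun y => expR (- c * y) * m y) L -
     prim (fun y => expR (- c * y) * m y) x| @[L --> +oo] -->
   `|Lap c m - prim (fun y => expR (- c * y) * m y) x|.
  apply: cvg_norm; apply: cvgB; first exact: h.
  exact: cvg_cst.
apply: (cvgr_to_le h'); near=> L.
have xL : x <= L by near: L; apply: nbhs_pinfty_ge; rewrite num_real.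
have := @mvt_le R (prim (fun y => expR (- c * y) * m y))
  (fun y => - (C / c) * expR (- c * y)) (fun y => expR (- c * y) * m y)
  (fun y => C * expR (- c * y)) x L xL.
move=> H; apply: le_trans (H _ _ _) _.
- by move=> y _; exact: der_prim.
- by move=> y _; apply: is_derive_eq (derZ _ (der_exp _ _)) _; field; rewrite gt_eqF.
- move=> y /andP[xy _]; rewrite normrM ger0_norm ?expR_ge0// mulrC.
  by apply: ler_wpM2r; [exact: expR_ge0|exact: mC].
- have : 0 <= C / c * expR (- c * L) by rewrite mulr_ge0 ?expR_ge0// divr_ge0// ltW.
  by lra.
Unshelve. all: by end_near. Qed.

Lemma Lap_le c m C : 0 < c -> continuous m -> (forall y, 0 <= y -> `|m y| <= C) ->
  `|Lap c m| <= C / c.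
Proof.
move=> c0 cm mC.
have := Lap_prim_le c0 cm (lexx 0) mC (ex_intro _ C mC).
by rewrite prim0 subr0 mulr0 expR0 mulr1.
Qed.

Lemma der_Lap c (M m : R -> R -> R) C t : 0 < c ->
  (forall s, continuous (M s)) -> (forall s, bdd (M s)) ->
  (forall s y, 0 <= y -> is_derive s 1 (M ^~ y) (m s y)) ->
  (forall s y, `|s - t| < 1 -> 0 <= y -> `|m s y| <= C) ->
  is_derive t 1 (fun s => Lap c (M s)) (Lap c (m t)).
Proof.
move=> c0 cM bM dM mC.
apply: (@der_int R _ (fun s y => expR (- c * y) * M s y)
  (fun s y => expR (- c * y) * m s y) (fun y => expR (- c * y) * C)).
- exact: measurable_hl.
- by move=> s _; exact: Lap_int.
- by move=> s y _ /halflineE y0; apply: derZ; exact: dM.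
- apply: Lap_int => //; first exact: cst_continuous.
  by exists `|C|.
- move=> s y st /halflineE y0; rewrite normrM ger0_norm ?expR_ge0//.
  by apply: ler_wpM2l; [exact: expR_ge0|exact: mC].
Qed.

Lemma cont_Lap c (m : R -> R -> R) C t : 0 < c ->
  (forall s, continuous (m s)) ->
  (forall y, 0 <= y -> continuous (m ^~ y)) ->
  (forall s y, `|s - t| < 1 -> 0 <= y -> `|m s y| <= C) ->
  {for t, continuous (fun s => Lap c (m s))}.
Proof.
move=> c0 cm cm' mC.
apply: (@cont_int R _ (fun s y => expR (- c * y) * m s y) (fun y => expR (- c * y) * C)).
- exact: measurable_hl.
- by move=> s st; apply: Lap_int => //; exists C => y; exact: mC.
- by move=> y /halflineE y0; apply: contZ; exact: cm'.
- apply: Lap_int => //; first exact: cst_continuous.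
  by exists `|C|.
- move=> s y st /halflineE y0; rewrite normrM ger0_norm ?expR_ge0//.
  by apply: ler_wpM2l; [exact: expR_ge0|exact: mC].
Qed.

Variable k : R.
Hypothesis k0 : 0 < k.

(** [Pk m] is the integral of [e^(-k (x - y)) m(y)] over [[0, x]], the solution of [P' = - k P + m]
    with [P(0) = 0]. [Qk m] is the integral of [e^(-k (y - x)) m(y)] over [[x, +oo)], the bounded
    solution of [Q' = k Q - m]. *)
Definition Pk m x : R := expR (- k * x) * prim (fun y => expR (k * y) * m y) x.

Definition Qk m x : R :=
  expR (k * x) * (Lap k m - prim (fun y => expR (- k * y) * m y) x).

(* [V := Kk m] is the bounded solution of [V'' / k^2 = V + m'] that vanishes at
   [0], and [Rk m = V' / k^2 - m]. *)
Definition Kk m x : R := k ^+ 2 / 2 * (Pk m x - Qk m x + expR (- k * x) * Lap k m).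

Definition Rk m x : R := - (k / 2) * (Pk m x + Qk m x + expR (- k * x) * Lap k m).

Lemma expNK a : expR (- a) * expR a = 1 :> R.
Proof. by rewrite -expRD addNr expR0. Qed.

Lemma der_Pk m x : continuous m -> is_derive x 1 (Pk m) (- k * Pk m x + m x).
Proof.
move=> cm; have := derM (der_exp (- k) x) (der_prim x (cont_expM (c := k) cm)).
move/is_derive_eq; apply.
congr (_ + _); first by rewrite /Pk; ring.
by rewrite mulrA mulNr expNK mul1r.
Qed.

Lemma der_Qk m x : continuous m -> is_derive x 1 (Qk m) (k * Qk m x - m x).
Proof.
move=> cm.
have d2 := der_prim x (cont_expM (c := - k) cm).
have := derM (der_exp k x) (derB (der_cst (Lap k m) x) d2).
move/is_derive_eq; apply.
rewrite sub0r mulrN; congr (_ - _); first by rewrite /Qk mulrA.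
by rewrite mulrA mulNr [expR (k * x) * _]mulrC expNK mul1r.
Qed.

Lemma der_Kk m x : continuous m -> is_derive x 1 (Kk m) (k ^+ 2 * (Rk m x + m x)).
Proof.
move=> cm.
have := derZ (k ^+ 2 / 2) (derD (derB (der_Pk x cm) (der_Qk x cm))
  (derM (der_exp (- k) x) (der_cst (Lap k m) x))).
by move/is_derive_eq; apply; rewrite /Rk; field.
Qed.

Lemma der_Rk m x : continuous m -> is_derive x 1 (Rk m) (Kk m x).
Proof.
move=> cm.
have := derZ (- (k / 2)) (derD (derD (der_Pk x cm) (der_Qk x cm))
  (derM (der_exp (- k) x) (der_cst (Lap k m) x))).
by move/is_derive_eq; apply; rewrite /Kk; field.
Qed.

Lemma cont_Kk m : continuous m -> continuous (Kk m).
Proof.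
move=> cm; apply: (@der_continuous R _ (fun x => k ^+ 2 * (Rk m x + m x))) => x.
exact: der_Kk.
Qed.

Lemma cont_Rk m : continuous m -> continuous (Rk m).
Proof. by move=> cm; apply: (@der_continuous R _ (Kk m)) => x; exact: der_Rk. Qed.

Lemma Kk0 m : Kk m 0 = 0.
Proof. by rewrite /Kk /Pk /Qk !prim0 !mulr0 !expR0 subr0 sub0r mul1r addNr mulr0. Qed.

(** Since [Kk m] vanishes at [0], this is the only boundary value that survives at [0] in the
    gradient identity; through it the Laplace transform at [k] enters. *)
Lemma Rk0 m : Rk m 0 = - k * Lap k m.
Proof. by rewrite /Rk /Pk /Qk !prim0 !mulr0 !expR0 subr0 add0r mul1r; field. Qed.

Lemma Pk_le m C x : continuous m -> (forall y, 0 <= y -> `|m y| <= C) -> 0 <= x ->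
  `|Pk m x| <= C / k.
Proof.
move=> cm mC x0.
have C0 : 0 <= C by exact: le_trans (mC 0 (lexx _)).
rewrite normrM ger0_norm ?expR_ge0//.
have := @mvt_le R (prim (fun y => expR (k * y) * m y))
  (fun y => C / k * expR (k * y)) (fun y => expR (k * y) * m y)
  (fun y => C * expR (k * y)) 0 x x0.
rewrite prim0 subr0 mulr0 expR0 mulr1 => H.
apply: (@le_trans _ _ (expR (- k * x) * (C / k * expR (k * x)))).
  apply: ler_wpM2l; first exact: expR_ge0.
  apply: le_trans (H _ _ _) _.
  - by move=> y _; apply: der_prim; exact: cont_expM.
  - by move=> y _; apply: is_derive_eq (derZ _ (der_exp _ _)) _; field; rewrite gt_eqF.
  - move=> y /andP[xy _]; rewrite normrM ger0_norm ?expR_ge0// mulrC.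
    by apply: ler_wpM2r; [exact: expR_ge0|exact: mC].
  - by rewrite lerBlDr lerDl divr_ge0// ltW.
by rewrite mulrCA mulNr expNK mulr1.
Qed.

Lemma Qk_le m C x : continuous m -> (forall y, 0 <= y -> `|m y| <= C) -> 0 <= x ->
  `|Qk m x| <= C / k.
Proof.
move=> cm mC x0; rewrite normrM ger0_norm ?expR_ge0//.
have := @Lap_prim_le k m C x k0 cm x0 (fun y xy => mC y (le_trans x0 xy)) (ex_intro _ C mC).
move=> h; apply: le_trans (ler_wpM2l (expR_ge0 _) h) _.
by rewrite mulrCA mulNr [expR (k * x) * _]mulrC expNK mulr1.
Qed.

(** Each of the three terms in [Kk] and [Rk] is at most [C / k]; hence the factor [3 / 2]. *)
Lemma kernel_le m C x : continuous m -> (forall y, 0 <= y -> `|m y| <= C) -> 0 <= x ->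
  `|Kk m x| <= 3 / 2 * k * C /\ `|Rk m x| <= 3 / 2 * C.
Proof.
move=> cm mC x0.
have C0 : 0 <= C by exact: le_trans (mC 0 (lexx _)).
have p := Pk_le cm mC x0; have q := Qk_le cm mC x0.
have l : `|expR (- k * x) * Lap k m| <= C / k.
  rewrite normrM ger0_norm ?expR_ge0//.
  apply: le_trans (ler_wpM2l (expR_ge0 _) (Lap_le k0 cm mC)) _.
  apply: ler_piMl; first by rewrite divr_ge0// ltW.
  by rewrite mulNr expR_le1 oppr_le0 mulr_ge0// ltW.
have k1 : 0 <= k ^+ 2 / 2 by rewrite divr_ge0// sqr_ge0.
have k2 : 0 <= k / 2 by rewrite divr_ge0// ltW.
split.
  rewrite normrM (ger0_norm k1).
  have -> : 3 / 2 * k * C = k ^+ 2 / 2 * (C / k + C / k + C / k).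
    by field; rewrite gt_eqF.
  apply: ler_wpM2l => //; apply: le_trans (ler_normD _ _) _.
  apply: lerD => //; apply: le_trans (ler_normB _ _) _.
  exact: lerD.
rewrite normrM normrN (ger0_norm k2).
have -> : 3 / 2 * C = k / 2 * (C / k + C / k + C / k) by field; rewrite gt_eqF.
apply: ler_wpM2l => //; apply: le_trans (ler_normD _ _) _.
apply: lerD => //; apply: le_trans (ler_normD _ _) _.
exact: lerD.
Qed.

Lemma kernelB f g x : continuous f -> continuous g -> bdd f -> bdd g ->
  Kk (fun y => f y - g y) x = Kk f x - Kk g x.
Proof.
move=> cf cg bf bg; rewrite /Kk /Pk /Qk LapB//.
have E c : prim (fun y => expR (c * y) * (f y - g y)) x =
    prim (fun y => expR (c * y) * f y) x - prim (fun y => expR (c * y) * g y) x.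
  rewrite -primB; [|exact: cont_expM..].
  by congr prim; apply/funext => y; rewrite mulrBr.
rewrite !E.
move: (prim _ x) (prim _ x) (prim _ x) (prim _ x) => a1 a2 a3 a4.
move: (Lap k f) (Lap k g) (expR (- k * x)) (expR (k * x)) => l1 l2 e1 e2.
ring.
Qed.

(** Here [x] plays the part of time in [ode_vanishes]: the three terms solve first-order equations
    with rates [- k], [k] and [- k]. For [Qk] the rate is unstable, and its boundedness is
    essential. *)
Lemma kernel_vanishes m : continuous m -> bdd m -> vanishes m ->
  vanishes (Kk m) /\ vanishes (Rk m).
Proof.
move=> cm [C mC] m0.
have k1 : - k != 0 by rewrite oppr_eq0 gt_eqF.
have k2 : k != 0 by rewrite gt_eqF.
have p : vanishes (Pk m).
  have d t : 0 <= t -> is_derive t 1 (Pk m) (- k * Pk m t + m t).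
    by move=> _; exact: der_Pk.
  exact: (ode_vanishes k1 d (fun t => @Pk_le m C t cm mC) m0).
have q : vanishes (Qk m).
  have d t : 0 <= t -> is_derive t 1 (Qk m) (k * Qk m t + - m t).
    by move=> _; exact: der_Qk.
  have nm0 : vanishes (fun t => - m t).
    by move=> e /m0[T mT]; exists T => t /mT; rewrite normrN.
  exact: (ode_vanishes k2 d (fun t => @Qk_le m C t cm mC) nm0).
have l : vanishes (fun x => expR (- k * x) * Lap k m).
  have d t : 0 <= t -> is_derive t 1 (fun x => expR (- k * x) * Lap k m)
      (- k * (expR (- k * t) * Lap k m) + 0).
    move=> _; apply: is_derive_eq (derM (der_exp _ _) (der_cst _ _)) _.
    by rewrite mulr0 mulrA.
  apply: (ode_vanishes k1 d (C := `|Lap k m|)).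
    move=> t t0; rewrite normrM ger0_norm ?expR_ge0//; apply: ler_piMl => //.
    by rewrite mulNr expR_le1 oppr_le0 mulr_ge0// ltW.
  by move=> e e0; exists 0 => t _; rewrite normr0 ltW.
split; apply: vanishesZ; apply: vanishesD => //; apply: vanishesD => //.
by move=> e /q[T qT]; exists T => t /qT; rewrite normrN.
Qed.

End kernel.

(** * Time-dependent sources under the kernel operators *)

Section evolution.
Context {R : realType}.
Notation mu := (@lebesgue_measure R).
Implicit Types (f g : R -> R) (m M : R -> R -> R) (a b c t s x y C : R).

Lemma cont_comp f g : continuous f -> continuous g -> continuous (fun y => g (f y)).
Proof. by move=> cf cg y; apply: continuous_comp; [exact: cf|exact: cg]. Qed.

Lemma cont_opp : continuous (fun y : R => - y).
Proof. by move=> y; apply: cvgN; exact: cvg_id. Qed.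

Lemma prim_opp f x : continuous f -> prim f (- x) = - prim (fun y => f (- y)) x.
Proof.
move=> cf.
have cfo := cont_comp cont_opp cf.
have d y : is_derive y 1 (fun y => - prim f (- y)) (f (- y)).
  have h := is_derive1_comp (der_prim (- y) cf) (derN (der_id y)).
  by apply: is_derive_eq (derN h) _; rewrite mulrN1 opprK.
by rewrite (prim_der cfo d) oppr0 prim0 oppr0 subr0 opprK.
Qed.

Lemma prim_bound f C x : continuous f -> (forall y, `|y| <= `|x| -> `|f y| <= C) ->
  `|prim f x| <= C * `|x|.
Proof.
move=> cf fC.
have main g z : continuous g -> 0 <= z -> (forall y, `|y| <= z -> `|g y| <= C) ->
    `|prim g z| <= C * z.
  move=> cg z0 gC.
  have := @lip_der R (prim g) g C 0 z z0; rewrite prim0 !subr0; apply.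
  - by move=> y _; exact: der_prim.
  - by move=> y /andP[y0 yz]; apply: gC; rewrite ger0_norm.
have [x0|x0] := leP 0 x.
  by rewrite (ger0_norm x0); apply: main => // y yx; apply: fC; rewrite (ger0_norm x0).
rewrite (ltr0_norm x0) -[x in prim f x]opprK prim_opp// normrN.
apply: main.
- exact: cont_comp cont_opp cf.
- by rewrite oppr_ge0 ltW.
- by move=> y yx; apply: fC; rewrite normrN (ltr0_norm x0).
Qed.

(** Separate continuity, with a bound local in time and global in space, is what dominated
    convergence uses to pass limits and time derivatives through the integrals in [x]. *)
Record nice m : Prop := Nice {
  nice_x : forall t, continuous (m t) ;
  nice_t : forall y, continuous (m ^~ y) ;
  nice_b : forall T, exists C, forall t y, `|t| <= T -> `|m t y| <= C }.

Lemma nice_loc m t : nice m ->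
  exists C, forall s y, `|s - t| < 1 -> `|m s y| <= C.
Proof.
move=> nm; have [C mC] := nice_b nm (`|t| + 1); exists C => s y st.
apply: mC; have := ler_distD t s 0; rewrite !subr0.
by move: st; lra.
Qed.

Lemma nice_bdd m t : nice m -> bdd (m t).
Proof. by move=> nm; have [C mC] := nice_b nm `|t|; exists C => y _; exact: mC. Qed.

Definition tprim m : R -> R -> R := fun t y => prim (m ^~ y) t.

Lemma der_tprim m t y : nice m -> is_derive t 1 (tprim m ^~ y) (m t y).
Proof. by move=> nm; apply: der_prim; exact: (nice_t nm). Qed.

Lemma nice_tprim m : nice m -> nice (tprim m).
Proof.
move=> nm; split.
- move=> t y; have [C mC] := nice_b nm `|t|.
  have [t0|t0] := leP 0 t.
    apply: (@cont_prim_param R (fun y s => m s y) C y t t0).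
    + by move=> z; exact: (nice_t nm).
    + by move=> s s0; exact: (nice_x nm).
    + by move=> z s _ /andP[s0 st]; apply: mC; rewrite !ger0_norm.
  rewrite /tprim.
  rewrite (_ : (fun y => prim (m ^~ y) t) = (fun y => - prim (fun s => m (- s) y) (- t))).
    apply: cvgN; apply: (@cont_prim_param R (fun y s => m (- s) y) C y (- t)).
    + by rewrite oppr_ge0 ltW.
    + by move=> z; apply: (@cont_comp (fun y => - y) (m ^~ z)); [exact: cont_opp|exact: (nice_t nm)].
    + by move=> s s0; exact: (nice_x nm).
    + move=> z s _ /andP[s0 st]; apply: mC.
      by rewrite normrN (ltr0_norm t0) ger0_norm.
  apply/funext => z.
  by have := @prim_opp (m ^~ z) (- t) (@nice_t m nm z); rewrite opprK.
- move=> y; apply: (@der_continuous R _ (m ^~ y)) => t; exact: der_tprim.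
- move=> T; have [C mC] := nice_b nm T; exists (C * T) => t y tT.
  have C0 : 0 <= C by apply: le_trans (normr_ge0 _) (mC t y tT).
  apply: le_trans (@prim_bound (m ^~ y) C t (@nice_t m nm y) _) _.
    by move=> s st; apply: mC; exact: le_trans tT.
  exact: ler_wpM2l.
Qed.

Lemma niceB m M : nice m -> nice M -> nice (fun t y => m t y - M t y).
Proof.
move=> nm nM; split.
- by move=> t; apply: contB; [exact: (nice_x nm)|exact: (nice_x nM)].
- by move=> y; apply: contB; [exact: (nice_t nm)|exact: (nice_t nM)].
- move=> T; have [C1 h1] := nice_b nm T; have [C2 h2] := nice_b nM T.
  exists (C1 + C2) => t y tT; apply: le_trans (ler_normB _ _) _.
  by apply: lerD; [exact: h1|exact: h2].
Qed.

Lemma nice_shift m T0 : nice m -> nice (fun t y => m (t + T0) y).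
Proof.
move=> nm; split.
- by move=> t; exact: (nice_x nm).
- move=> y; apply: (@cont_comp (fun t => t + T0) (m ^~ y)); last exact: (nice_t nm).
  by move=> t; apply: cvgD; [exact: cvg_id|exact: cvg_cst].
- move=> T; have [C h] := nice_b nm (T + `|T0|); exists C => t y tT.
  by apply: h; apply: le_trans (ler_normD _ _) _; rewrite lerD2r.
Qed.

Lemma expM_le a C c y x : 0 <= y <= x -> `|a| <= C ->
  `|expR (c * y) * a| <= expR (`|c| * x) * C.
Proof.
move=> /andP[y0 yx] mC; rewrite normrM ger0_norm ?expR_ge0//.
apply: ler_pM => //.
rewrite ler_expR; apply: (@le_trans _ _ (`|c| * y)).
  by apply: ler_wpM2r => //; exact: ler_norm.
exact: ler_wpM2l.
Qed.

Lemma der_prim_exp M m c t x : 0 <= x -> nice M -> nice m ->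
  (forall s y, is_derive s 1 (M ^~ y) (m s y)) ->
  is_derive t 1 (fun s => prim (fun y => expR (c * y) * M s y) x)
    (prim (fun y => expR (c * y) * m t y) x).
Proof.
move=> x0 nM nm dM; have [C mC] := nice_loc t nm.
apply: (@der_prim_param R (fun s y => expR (c * y) * M s y)
  (fun s y => expR (c * y) * m s y) (expR (`|c| * x) * C)).
- exact: x0.
- by move=> s; apply: cont_expM; exact: (nice_x nM).
- by move=> s y st yx; apply: expM_le => //; exact: mC.
Qed.

Lemma cont_prim_exp m c t x : 0 <= x -> nice m ->
  {for t, continuous (fun s => prim (fun y => expR (c * y) * m s y) x)}.
Proof.
move=> x0 nm; have [C mC] := nice_loc t nm.
apply: (@cont_prim_param R (fun s y => expR (c * y) * m s y) (expR (`|c| * x) * C)).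
- exact: x0.
- by move=> s; apply: cont_expM; exact: (nice_x nm).
- by move=> y _; apply: contZ; exact: (nice_t nm).
- by move=> s y st yx; apply: expM_le => //; exact: mC.
Qed.

Lemma der_t_Lap M m c t : 0 < c -> nice M -> nice m ->
  (forall s y, is_derive s 1 (M ^~ y) (m s y)) ->
  is_derive t 1 (fun s => Lap c (M s)) (Lap c (m t)).
Proof.
move=> c0 nM nm dM; have [C mC] := nice_loc t nm.
apply: (@der_Lap R c M m C t) => //.
- exact: (nice_x nM).
- by move=> s; exact: nice_bdd.
- by move=> s y st _; exact: mC.
Qed.

Lemma cont_t_Lap m c : 0 < c -> nice m -> continuous (fun s => Lap c (m s)).
Proof.
move=> c0 nm t; have [C mC] := nice_loc t nm.
apply: (@cont_Lap R c m C t) => //.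
- exact: (nice_x nm).
- by move=> y _; exact: (nice_t nm).
- by move=> s y st _; exact: mC.
Qed.

Variable k : R.
Hypothesis k0 : 0 < k.

Lemma der_t_kernel M m t x : 0 <= x -> nice M -> nice m ->
  (forall s y, is_derive s 1 (M ^~ y) (m s y)) ->
  is_derive t 1 (fun s => Kk k (M s) x) (Kk k (m t) x) /\
  is_derive t 1 (fun s => Rk k (M s) x) (Rk k (m t) x).
Proof.
move=> x0 nM nm dM.
have dl := der_t_Lap t k0 nM nm dM.
have dP := derZ (expR (- k * x)) (der_prim_exp k t x0 nM nm dM).
have dQ := derZ (expR (k * x)) (derB dl (der_prim_exp (- k) t x0 nM nm dM)).
have dL := derZ (expR (- k * x)) dl.
split; first exact: derZ (derD (derB dP dQ) dL).
exact: derZ (derD (derD dP dQ) dL).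
Qed.

Lemma cont_t_kernel m x : 0 <= x -> nice m ->
  continuous (fun s => Kk k (m s) x) /\ continuous (fun s => Rk k (m s) x).
Proof.
move=> x0 nm.
have cl := cont_t_Lap k0 nm.
have cp c : continuous (fun s => prim (fun y => expR (c * y) * m s y) x).
  by move=> t; exact: cont_prim_exp.
have cP := contZ (c := expR (- k * x)) (cp k).
have cQ := contZ (c := expR (k * x)) (contB cl (cp (- k))).
have cL := contZ (c := expR (- k * x)) cl.
split; first exact: contZ (contD (contB cP cQ) cL).
exact: contZ (contD (contD cP cQ) cL).
Qed.

End evolution.

(** * Laplace transforms and pointwise decay *)

Section density.
Context {R : realType}.
Implicit Types (f g : R -> R) (a b c t s x y C : R).

Lemma Lap_mono c f g : 0 < c -> continuous f -> continuous g -> bdd f -> bdd g ->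
  (forall y, 0 <= y -> `|f y| <= g y) -> `|Lap c f| <= Lap c g.
Proof.
move=> c0 cf cg bf bg fg; rewrite /Lap.
have := @le_normr_Rintegral _ _ _ (@lebesgue_measure R) _ _ (@measurable_hl R)
  (Lap_int c0 cf bf).
move/le_trans; apply; apply: le_Rintegral.
- exact: measurable_hl.
- exact: (integrable_norm (Lap_int c0 cf bf)).
- exact: Lap_int.
- move=> y /halflineE y0; rewrite normrM ger0_norm ?expR_ge0//.
  by apply: ler_wpM2l; [exact: expR_ge0|exact: fg].
Qed.

Lemma LapD c f g : 0 < c -> continuous f -> continuous g -> bdd f -> bdd g ->
  Lap c (fun y => f y + g y) = Lap c f + Lap c g.
Proof.
move=> c0 cf cg bf bg; rewrite /Lap -RintegralD; [|exact: measurable_hl|exact: Lap_int..].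
by apply: eq_Rintegral => y _; rewrite mulrDr.
Qed.

Variable k : R.
Hypothesis k0 : 0 < k.

Let q y := expR (- k * y).

Let cq : continuous q.
Proof. exact: cont_exp. Qed.

Let q_ge0 y : 0 <= q y.
Proof. exact: expR_ge0. Qed.

Let q_le1 y : 0 <= y -> q y <= 1.
Proof. by move=> y0; rewrite /q mulNr expR_le1 oppr_le0 mulr_ge0// ltW. Qed.

Lemma cont_horner (p : {poly R}) : continuous (fun y => p.[q y]).
Proof.
elim/poly_ind: p => [|p c ih].
  by under eq_fun do rewrite horner0; exact: cst_continuous.
under eq_fun do rewrite hornerMXaddC.
by apply: contD; [apply: contM|exact: cst_continuous].
Qed.

Lemma bdd_horner (p : {poly R}) : bdd (fun y => p.[q y]).
Proof.
elim/poly_ind: p => [|p c [C pC]].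
  by exists 0 => y _; rewrite horner0 normr0.
exists (C + `|c|) => y y0; rewrite hornerMXaddC.
apply: le_trans (ler_normD _ _) _; rewrite lerD2r normrM (ger0_norm (q_ge0 y)).
by apply: le_trans (pC y y0); apply: ler_piMr => //; exact: q_le1.
Qed.

Lemma bddM f g : bdd f -> bdd g -> bdd (fun y => f y * g y).
Proof.
move=> [C1 h1] [C2 h2]; exists (C1 * C2) => y y0; rewrite normrM.
by apply: ler_pM; rewrite ?h1 ?h2.
Qed.

Variables (w : R -> R -> R) (C : R).
Hypothesis cw : forall t, 0 <= t -> continuous (w t).
Hypothesis wC : forall t y, 0 <= t -> 0 <= y -> `|w t y| <= C.
Hypothesis Lw : forall j : nat, vanishes (fun t => Lap (j.+1%:R * k) (w t)).

(** A factor [q = e^(-k y)] shifts the transform from [(j + 1) k] to [(j + 2) k]; therefore the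
    induction on [p] runs over all [j] at once. *)
Lemma Lap_poly_vanishes (p : {poly R}) (j : nat) :
  vanishes (fun t => Lap (j.+1%:R * k) (fun y => p.[q y] * w t y)).
Proof.
elim/poly_ind: p j => [|p c ih] j.
  move=> e e0; exists 0 => t t0.
  rewrite /Lap; under eq_Rintegral do rewrite horner0 mul0r mulr0.
  by rewrite Rintegral_cst ?mul0r ?normr0 ?ltW//; exact: measurable_hl.
have jk : 0 < j.+1%:R * k by rewrite mulr_gt0 ?ltr0n.
apply: (@vanishes_le R _ (fun t => Lap (j.+2%:R * k) (fun y => p.[q y] * w t y) +
   c * Lap (j.+1%:R * k) (w t)) 0); last first.
  by apply: vanishesD; [exact: ih|apply: vanishesZ; exact: Lw].
move=> t t0; rewrite le_eqVlt; apply/orP; left; apply/eqP; congr (`| _ |).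
have bw : bdd (w t) by exists C => y; exact: wC.
have cwt : continuous (w t) by exact: cw.
rewrite -LapZ//.
transitivity (Lap (j.+1%:R * k) (fun y => p.[q y] * q y * w t y) +
   Lap (j.+1%:R * k) (fun y => c * w t y)).
  rewrite -LapD//; first by apply: eq_Lap => y _; rewrite hornerMXaddC mulrDl.
  - by apply: contM; [apply: contM => //; exact: cont_horner|exact: cw].
  - by apply: contZ; exact: cw.
  - apply: bddM => //; apply: bddM; first exact: bdd_horner.
    by exists 1 => y y0; rewrite ger0_norm// q_le1.
  - by apply: (@bddM (fun=> c)) => //; exists `|c|.
congr (_ + _); apply: eq_Rintegral => y _.
have -> : - (j.+2%:R * k) * y = - (j.+1%:R * k) * y + - k * y.
  by rewrite -[j.+2%:R]natr1; ring.
by rewrite expRD -/(q y); ring.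
Qed.

(* The weights [q (1 - (q - q x0)^2)^N], where [q = e^(-k y)], concentrate at
   [y = x0] and are polynomials in [q] without constant term. *)
Lemma laplace_density x0 : 0 <= x0 ->
  (forall e, 0 < e -> exists2 d, 0 < d & forall t y, 0 <= t -> 0 <= y ->
     `|y - x0| <= d -> `|w t y - w t x0| <= e) ->
  vanishes (fun t => w t x0).
Proof.
move=> x00 weq e e0.
have [|d d0 wd] := weq (e / 3); first by lra.
have C0 : 0 <= C by apply: le_trans (wC (lexx 0) (lexx 0)).
(* [s] is the factor by which [q] shrinks over a distance [d / 2]. So [q] stays within [d1] of
   [q x0] on [[x0, x0 + d / 2]], and deviates by at least [d2 > d1] at distances beyond [d]. The
   values [r1 > r2] below are the bases of the weight at these deviations. *)
pose s := expR (- k * (d / 2)).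
have s0 : 0 < s by exact: expR_gt0.
have s1 : s < 1 by rewrite /s mulNr expR_lt1 oppr_lt0 mulr_gt0// divr_gt0.
have qp : 0 < q x0 by exact: expR_gt0.
have q1 : q x0 <= 1 by exact: q_le1.
pose d1 := q x0 * (1 - s); pose d2 := q x0 * (1 - s ^+ 2).
have d1p : 0 < d1 by rewrite mulr_gt0// subr_gt0.
have d12 : d1 < d2.
  rewrite ltr_pM2l// ltrD2l ltrN2 expr2 -[ltRHS]mul1r ltr_pM2r//.
have d21 : d2 < 1.
  apply: le_lt_trans (_ : 1 - s ^+ 2 < 1); last by rewrite gtrBl exprn_gt0.
  apply: ler_piMl => //; rewrite subr_ge0 exprn_ile1 ?ltW//.
pose r1 := 1 - d1 ^+ 2; pose r2 := 1 - d2 ^+ 2.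
have r21 : r2 < r1.
  rewrite -subr_gt0 /r1 /r2.
  have -> : 1 - d1 ^+ 2 - (1 - d2 ^+ 2) = (d2 - d1) * (d2 + d1) by ring.
  by rewrite mulr_gt0//; move: d12 d1p; lra.
have r2p : 0 < r2.
  by rewrite subr_gt0 expr_lt1// ltW// (lt_trans d1p).
have r1p : 0 < r1 by exact: lt_trans r21.
have hq y : 0 <= y -> d < `|y - x0| -> d2 <= `|q y - q x0|.
  move=> y0; rewrite ltr_normr => /orP[h|h].
  - rewrite distrC; apply: le_trans (ler_norm _).
    rewrite /d2 mulrBr mulr1 lerD2l lerN2 /q /s -expRM_natl -expRD ler_expR.
    have : k * d <= k * (y - x0) by rewrite ler_pM2l// ltW.
    by rewrite mulr_natl; lra.
  - apply: le_trans (ler_norm _).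
    rewrite lerBrDr /d2 -[X in _ + X]mulr1 -mulrDr.
    have s2 : s ^+ 2 = expR (- k * d).
      by rewrite /s -expRM_natl mulr_natl; congr expR; lra.
    rewrite s2.
    (* On the left of [x0] the deviation is at least that on the right, as
       [e^(k d) + e^(-k d) >= 2]. *)
    apply: (@le_trans _ _ (q x0 * expR (k * d))).
      rewrite ler_pM2l//.
      have -> : expR (- k * d) = (expR (k * d))^-1 by rewrite mulNr expRN.
      have ep := expR_gt0 (k * d); rewrite -subr_ge0.
      have -> : expR (k * d) - (1 - (expR (k * d))^-1 + 1) =
        (expR (k * d) - 1) ^+ 2 / expR (k * d) by field; rewrite gt_eqF.
      by rewrite divr_ge0 ?sqr_ge0// ltW.
    rewrite /q -expRD ler_expR.
    have : k * d <= k * (x0 - y) by rewrite ler_pM2l//; move: h; lra.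
    by lra.
(* The far part of the integral is at most [2 C r2^N / k], while the total mass is at least
   [d1 r1^N / k]; a large [N] makes the ratio small. *)
have [N hN] : exists N : nat, 2 * C * (r2 / r1) ^+ N <= e / 3 * d1.
  have : (fun n => 2 * C * (r2 / r1) ^+ n) @ \oo --> 2 * C * 0.
    apply: cvgM; first exact: cvg_cst.
    apply: cvg_expr; rewrite ger0_norm ?divr_ge0 ?ltW//.
    by rewrite ltr_pdivrMr// mul1r.
  rewrite mulr0 => /cvgrPdist_le /(_ (e / 3 * d1)) [|N _ h].
    by rewrite mulr_gt0// divr_gt0.
  exists N; have := h N (leqnn N); rewrite /= sub0r normrN.
  by apply: le_trans; exact: ler_norm.
pose p : {poly R} := (1 - ('X - (q x0)%:P) ^+ 2) ^+ N.
have pE y : p.[q y] = (1 - (q y - q x0) ^+ 2) ^+ N.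
  by rewrite /p horner_exp !hornerE.
have qsq y : 0 <= y -> (q y - q x0) ^+ 2 <= 1.
  move=> y0; rewrite -[leLHS]real_normK ?num_real// expr_le1//.
  have := q_ge0 y; have := q_le1 y0; rewrite ler_norml; lra.
have p0 y : 0 <= y -> 0 <= p.[q y].
  by move=> y0; rewrite pE exprn_ge0// subr_ge0 qsq.
have bp := bdd_horner p; have cp := @cont_horner p.
pose I := Lap k (fun y => p.[q y]).
(* Only the piece [[x0, x0 + d / 2]] of the integral is kept, which also covers [x0 = 0]. There the
   weight is at least [r1^N], and the integral of [q] is [d1 / k]. *)
have I1 : d1 / k * r1 ^+ N <= I.
  have cpe := cont_expM (c := - k) cp.
  have h := prim_cvg_hl cpe (Lap_int k0 cp bp).
  apply: (cvgr_to_ge h); near=> L.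
  have xL : x0 + d / 2 <= L by near: L; apply: nbhs_pinfty_ge; rewrite num_real.
  have x0d : x0 <= x0 + d / 2 by rewrite lerDl divr_ge0// ltW.
  have pm a b : 0 <= a -> a <= b -> prim (fun y => expR (- k * y) * p.[q y]) a <=
      prim (fun y => expR (- k * y) * p.[q y]) b.
    move=> a0 ab; rewrite -subr_ge0 -Rint_prim//.
    apply: Rintegral_ge0 => y /=; rewrite in_itv/= => /andP[ay _].
    by rewrite mulr_ge0 ?expR_ge0// p0// (le_trans a0).
  apply: le_trans (pm _ _ (addr_ge0 x00 _) xL); last by rewrite divr_ge0// ltW.
  have z0 := pm _ _ (lexx 0) x00; rewrite prim0 in z0.
  have := @mvt_le R (fun y => - (r1 ^+ N / k) * q y)
    (prim (fun y => expR (- k * y) * p.[q y])) (fun y => r1 ^+ N * q y)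
    (fun y => expR (- k * y) * p.[q y]) x0 (x0 + d / 2) x0d.
  have -> : - (r1 ^+ N / k) * q (x0 + d / 2) - - (r1 ^+ N / k) * q x0 = d1 / k * r1 ^+ N.
    by rewrite /d1 /s /q mulrDr expRD; ring.
  have nn : 0 <= d1 / k * r1 ^+ N.
    by rewrite mulr_ge0 ?divr_ge0 ?exprn_ge0 ?ltW.
  rewrite (ger0_norm nn) => H; apply: le_trans (H _ _ _) _.
  - move=> y _; apply: is_derive_eq (derZ _ (der_exp _ _)) _.
    by rewrite /q; field; rewrite gt_eqF.
  - by move=> y _; exact: der_prim.
  - move=> y /andP[xy yd].
    have y0 : 0 <= y by exact: le_trans xy.
    rewrite normrM (ger0_norm (q_ge0 y)) mulrC (ger0_norm (exprn_ge0 N (ltW r1p))).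
    apply: ler_wpM2l => //; rewrite pE.
    have qq : 0 <= q x0 - q y by rewrite subr_ge0 /q ler_expR !mulNr lerN2 ler_pM2l.
    apply: lerXn2r; [exact: ltW|by rewrite nnegrE subr_ge0 qsq|].
    rewrite lerD2l lerN2 -[(q y - _) ^+ 2]sqrrN opprB.
    apply: lerXn2r; rewrite ?nnegrE ?(ltW d1p)//.
    rewrite /d1 mulrBr mulr1 lerD2l lerN2 /q /s -expRD ler_expR -mulrDr !mulNr lerN2.
    by rewrite ler_pM2l.
  - by rewrite lerBlDr lerDl.
have I0 : 0 < I.
  by apply: lt_le_trans I1; rewrite mulr_gt0 ?divr_gt0 ?exprn_gt0.
have tail : 2 * C * r2 ^+ N / k <= e / 3 * I.
  apply: (@le_trans _ _ (e / 3 * (d1 / k * r1 ^+ N))); last first.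
    by rewrite ler_pM2l// divr_gt0.
  have -> : e / 3 * (d1 / k * r1 ^+ N) = (e / 3 * d1) * (r1 ^+ N / k) by ring.
  have -> : 2 * C * r2 ^+ N / k = (2 * C * (r2 / r1) ^+ N) * (r1 ^+ N / k).
    by rewrite expr_div_n; field; rewrite !gt_eqF ?exprn_gt0.
  by apply: ler_wpM2r => //; rewrite divr_ge0 ?exprn_ge0 ?ltW.
have [|T hT] := @Lap_poly_vanishes p 0 (e / 3 * I).
  by rewrite mulr_gt0// divr_gt0.
rewrite mul1r in hT.
exists (Num.max T 0) => t; rewrite ge_max => /andP[Tt t0].
have bw : bdd (w t) by exists C => y; exact: wC.
have cst_b c : bdd (fun _ : R => c) by exists `|c|.
have h1 := hT t Tt.
have h2 : Lap k (fun y => p.[q y] * w t y) - Lap k (fun y => w t x0 * p.[q y]) =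
    Lap k (fun y => p.[q y] * (w t y - w t x0)).
  rewrite -LapB//.
  - by apply: eq_Lap => y _; ring.
  - by apply: contM => //; exact: cw.
  - exact: contZ.
  - exact: bddM.
  - exact: bddM.
have h3 : `|Lap k (fun y => p.[q y] * (w t y - w t x0))| <=
    Lap k (fun y => e / 3 * p.[q y] + 2 * C * r2 ^+ N).
  apply: Lap_mono => //.
  - by apply: contM => //; apply: contB; [exact: cw|exact: cst_continuous].
  - by apply: contD; [exact: contZ|exact: cst_continuous].
  - apply: bddM => //; exists (C + C) => y y0; apply: le_trans (ler_normB _ _) _.
    by apply: lerD; apply: wC.
  - have [C1 hC1] := bddM (cst_b (e / 3)) bp.
    exists (C1 + `|2 * C * r2 ^+ N|) => y y0; apply: le_trans (ler_normD _ _) _.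
    by rewrite lerD2r hC1.
  - move=> y y0; rewrite normrM (ger0_norm (p0 y y0)).
    have [yd|yd] := leP `|y - x0| d.
      apply: (@le_trans _ _ (e / 3 * p.[q y])).
        by rewrite mulrC; apply: ler_wpM2r; [exact: p0|exact: wd].
      by rewrite lerDl mulr_ge0 ?mulr_ge0 ?exprn_ge0// ltW.
    apply: (@le_trans _ _ (2 * C * r2 ^+ N)); last first.
      by rewrite lerDr mulr_ge0 ?p0// divr_ge0// ltW.
    rewrite mulrC; apply: ler_pM => //; first exact: p0.
      apply: le_trans (ler_normB _ _) _.
      by have := wC t0 y0; have := wC t0 x00; lra.
    rewrite pE; apply: lerXn2r; [by rewrite nnegrE subr_ge0 qsq|exact: ltW|].
    rewrite lerD2l lerN2 -[leRHS]real_normK ?num_real//.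
    by apply: lerXn2r; rewrite ?nnegrE ?(ltW (lt_trans d1p d12))//; exact: hq.
have h4 : Lap k (fun y => e / 3 * p.[q y] + 2 * C * r2 ^+ N) <= 2 * (e / 3 * I).
  rewrite LapD//; first last.
  - exact: bddM.
  - exact: cst_continuous.
  - exact: contZ.
  have -> : 2 * (e / 3 * I) = e / 3 * I + e / 3 * I by ring.
  apply: lerD; first by rewrite LapZ.
  apply: le_trans tail.
  apply: le_trans (ler_norm _) _; apply: Lap_le => //; first exact: cst_continuous.
  by move=> y _; rewrite ger0_norm// mulr_ge0 ?mulr_ge0 ?exprn_ge0// ltW.
rewrite LapZ// -/I in h2.
(* The three thirds of [e] pay for the weighted mean of [w t], for its oscillation near [x0] and for
   the part far from [x0]. *)
have h5 : `|w t x0| * I <= e * I.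
  rewrite -[X in _ * X]ger0_norm ?(ltW I0)// -normrM.
  have -> : w t x0 * I = Lap k (fun y => p.[q y] * w t y) -
     Lap k (fun y => p.[q y] * (w t y - w t x0)) by rewrite -h2; ring.
  apply: le_trans (ler_normB _ _) _.
  have -> : e * I = e / 3 * I + 2 * (e / 3 * I) by field.
  exact: lerD h1 (le_trans h3 h4).
by rewrite ler_pM2r in h5.
Unshelve. all: by end_near. Qed.

End density.

(** * Energy estimates *)

Section energy.
Context {R : realType}.
Implicit Types (f g : R -> R) (a b c t s x y C L : R).
Variable k : R.
Hypothesis k0 : 0 < k.

Variables M m : R -> R -> R.
Hypothesis nM : nice M.
Hypothesis nm : nice m.
Hypothesis dM : forall t y, is_derive t 1 (M ^~ y) (m t y).

Definition sol t x := Kk k (M t) x.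
Definition sol_x t x := k ^+ 2 * (Rk k (M t) x + M t x).

Lemma der_sol_x t x : is_derive x 1 (sol t) (sol_x t x).
Proof. by apply: der_Kk; exact: (nice_x nM). Qed.

Lemma der_sol_t t x : 0 <= x -> is_derive t 1 (sol ^~ x) (Kk k (m t) x).
Proof. by move=> x0; have [] := der_t_kernel k0 t x0 nM nm dM. Qed.

Lemma der_sol_x_t t x : 0 <= x -> is_derive t 1 (sol_x ^~ x) (k ^+ 2 * (Rk k (m t) x + m t x)).
Proof.
move=> x0; have [_ dR] := der_t_kernel k0 t x0 nM nm dM.
exact: derZ (derD dR (dM t x)).
Qed.

Lemma cont_sol t : continuous (sol t).
Proof. by apply: cont_Kk => //; exact: (nice_x nM). Qed.

Lemma cont_sol_x t : continuous (sol_x t).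
Proof.
by apply: contZ; apply: contD; [apply: cont_Rk|]; try exact: (nice_x nM).
Qed.

Lemma sol0 t : sol t 0 = 0.
Proof. exact: Kk0. Qed.

Lemma nice_kernel_le (m' : R -> R -> R) T : nice m' -> exists C, forall t x,
  `|t| <= T -> 0 <= x ->
  [/\ `|Kk k (m' t) x| <= C, `|Rk k (m' t) x| <= C & `|m' t x| <= C].
Proof.
move=> nm'; have [C mC] := nice_b nm' T.
exists (Num.max (3 / 2 * k * C) (Num.max (3 / 2 * C) C)) => t x tT x0.
have [h1 h2] := kernel_le k0 (@nice_x _ _ nm' t) (fun y _ => mC t y tT) x0.
by rewrite !le_max h1 h2 mC// !orbT.
Qed.

Lemma sol_le T : exists C, forall t x, `|t| <= T -> 0 <= x ->
  [/\ `|sol t x| <= C, `|sol_x t x| <= C, `|Kk k (m t) x| <= C,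
      `|Rk k (m t) x| <= C & `|m t x| <= C].
Proof.
have [C1 h1] := nice_kernel_le T nM; have [C2 h2] := nice_kernel_le T nm.
pose C := Num.max 0 (Num.max C1 C2).
exists (C + k ^+ 2 * (C + C)) => t x tT x0.
have C0 : 0 <= C by rewrite le_max lexx.
have C1C : C1 <= C by rewrite !le_max lexx !orbT.
have C2C : C2 <= C by rewrite !le_max lexx !orbT.
have [a1 a2 a3] := h1 t x tT x0; have [b1 b2 b3] := h2 t x tT x0.
have kC : 0 <= k ^+ 2 * (C + C) by rewrite mulr_ge0 ?sqr_ge0// addr_ge0.
have aux a C' : `|a| <= C' -> C' <= C -> `|a| <= C + k ^+ 2 * (C + C).
  by lra.
have aux2 a b C' : `|a| <= C' -> `|b| <= C' -> C' <= C ->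
    `|k ^+ 2 * (a + b)| <= C + k ^+ 2 * (C + C).
  move=> aC bC C'C; rewrite normrM (ger0_norm (sqr_ge0 _)).
  apply: ler_wpDl => //; apply: ler_wpM2l; first exact: sqr_ge0.
  by apply: le_trans (ler_normD _ _) _; lra.
split.
- exact: aux a1 _.
- exact: aux2 a2 a3 _.
- exact: aux b1 _.
- exact: aux b2 _.
- exact: aux b3 _.
Qed.

(** With [k^2 = 1 / gamma], the second term is [gamma sol_x^2]. The cut-off [L] stays explicit, as
    square integrability over the half-line has to be proved. *)
Definition energy t L := prim (fun x => sol t x ^+ 2 + (sol_x t x / k) ^+ 2) L.
Definition grad_energy t L := prim (fun x => (sol_x t x / k) ^+ 2) L.

Lemma cont_sqr f : continuous f -> continuous (fun x => f x ^+ 2).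
Proof. by move=> cf; exact: contM. Qed.

Lemma cont_grad_density t : continuous (fun x => (sol_x t x / k) ^+ 2).
Proof.
apply: cont_sqr; apply: contM; [exact: cont_sol_x|exact: cst_continuous].
Qed.

Lemma cont_energy_density t :
  continuous (fun x => sol t x ^+ 2 + (sol_x t x / k) ^+ 2).
Proof.
by apply: contD; [apply: cont_sqr; exact: cont_sol|exact: cont_grad_density].
Qed.

Lemma normM_le a b C : `|a| <= C -> `|b| <= C -> `|a * b| <= C * C.
Proof. by move=> aC bC; rewrite normrM ler_pM. Qed.

Lemma near_norm s t : `|s - t| < 1 -> `|s| <= `|t| + 1.
Proof. by move=> st; have := ler_distD t s 0; rewrite !subr0; lra. Qed.

Lemma der_grad_energy t L : 0 <= L ->
  is_derive t 1 (grad_energy ^~ L)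
    (prim (fun x => 2 * (sol_x t x * (Rk k (m t) x + m t x))) L).
Proof.
move=> L0; have [C hC] := sol_le (`|t| + 1).
apply: (@der_prim_param R (fun s x => (sol_x s x / k) ^+ 2)
  (fun s x => 2 * (sol_x s x * (Rk k (m s) x + m s x))) (2 * (C * (C + C)))).
- exact: L0.
- exact: cont_grad_density.
- move=> s x x0.
  have d := der_sqr (derM (der_sol_x_t s x0) (der_cst k^-1 s)).
  apply: (is_derive_eq d); rewrite mulr0 addr0.
  by field; rewrite gt_eqF.
- move=> s x st /andP[x0 _].
  have [_ h2 _ h5 h6] := hC s x (near_norm st) x0.
  rewrite normrM (@ger0_norm _ 2)// ler_pM2l// normrM; apply: ler_pM => //.
  by apply: le_trans (ler_normD _ _) _; exact: lerD.
Qed.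

(** In the differentiated density, [sol * Kk m + sol_x * Rk m] is the [x]-derivative of
    [sol * Rk m], which vanishes at [0]. What remains is a boundary term at [L] and the work of
    [m]. *)
Lemma der_energy t L : 0 <= L ->
  is_derive t 1 (energy ^~ L)
    (2 * (sol t L * Rk k (m t) L + prim (fun x => sol_x t x * m t x) L)).
Proof.
move=> L0; have [C hC] := sol_le (`|t| + 1).
have cm := @nice_x _ _ nm t.
have d : is_derive t 1 (energy ^~ L)
    (prim (fun x => 2 * (sol t x * Kk k (m t) x) +
                    2 * (sol_x t x * (Rk k (m t) x + m t x))) L).
  apply: (@der_prim_param R (fun s x => sol s x ^+ 2 + (sol_x s x / k) ^+ 2)
    (fun s x => 2 * (sol s x * Kk k (m s) x) +
                2 * (sol_x s x * (Rk k (m s) x + m s x)))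
    (2 * (C * C) + 2 * (C * (C + C)))).
  - exact: L0.
  - exact: cont_energy_density.
  - move=> s x x0.
    have d1 := der_sqr (der_sol_t s x0).
    have d2 := der_sqr (derM (der_sol_x_t s x0) (der_cst k^-1 s)).
    apply: (is_derive_eq (derD d1 d2)); rewrite mulr0 addr0.
    by congr (_ + _); field; rewrite gt_eqF.
  - move=> s x st /andP[x0 _].
    have [h1 h2 h3 h5 h6] := hC s x (near_norm st) x0.
    apply: le_trans (ler_normD _ _) _; apply: lerD.
      by rewrite normrM (@ger0_norm _ 2)// ler_pM2l//; exact: normM_le.
    rewrite normrM (@ger0_norm _ 2)// ler_pM2l// normrM; apply: ler_pM => //.
    by apply: le_trans (ler_normD _ _) _; exact: lerD.
apply: (is_derive_eq d).
have cR := @cont_Rk R k _ cm; have cV := @cont_Kk R k _ cm.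
have cs := @cont_sol t; have cx := @cont_sol_x t.
pose h x := sol t x * Kk k (m t) x + sol_x t x * Rk k (m t) x.
have ch : continuous h by apply: contD; exact: contM.
have dh x : is_derive x 1 (fun x => sol t x * Rk k (m t) x) (h x).
  apply: (is_derive_eq (derM (der_sol_x t x) (@der_Rk R k _ x cm))).
  by rewrite /h addrC.
have <- : prim h L = sol t L * Rk k (m t) L.
  by rewrite (prim_der ch dh) sol0 mul0r subr0.
rewrite -primD//; last exact: contM.
rewrite -primZ; last by apply: contD => //; exact: contM.
by congr prim; apply/funext => x; rewrite /h; ring.
Qed.

Lemma energy_mono t a b : 0 <= a -> a <= b -> energy t a <= energy t b.
Proof.
move=> a0 ab; rewrite -subr_ge0 -Rint_prim//; last exact: cont_energy_density.
by apply: Rintegral_ge0 => x _; rewrite addr_ge0// sqr_ge0.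
Qed.

Lemma grad_energy_ge0 t L : 0 <= L -> 0 <= grad_energy t L.
Proof.
move=> L0; rewrite /grad_energy prim_ge0//.
by apply: Rintegral_ge0 => x _; rewrite sqr_ge0.
Qed.

Lemma grad_energy_le t L : 0 <= L -> grad_energy t L <= energy t L.
Proof.
move=> L0; rewrite /energy primD; last first.
- exact: cont_grad_density.
- by apply: cont_sqr; exact: cont_sol.
rewrite lerDr prim_ge0//.
by apply: Rintegral_ge0 => x _; rewrite sqr_ge0.
Qed.

(** The inequality [2 |sol sol_x| <= k sol^2 + sol_x^2 / k], from the squares of [k sol - sol_x] and
    [k sol + sol_x], is integrated from [0], where [sol] vanishes. *)
Lemma sol_sqr_le t x : 0 <= x -> sol t x ^+ 2 <= k * energy t x.
Proof.
move=> x0.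
have := @mvt_le R (fun y => sol t y ^+ 2) (fun y => k * energy t y)
  (fun y => 2 * (sol t y * sol_x t y))
  (fun y => k * (sol t y ^+ 2 + (sol_x t y / k) ^+ 2)) 0 x x0.
rewrite sol0 /energy prim0 mulr0 !subr0 expr0n subr0 => H.
apply: le_trans (ler_norm _) _; apply: H.
- by move=> y _; apply: der_sqr; exact: der_sol_x.
- by move=> y _; apply: derZ; apply: der_prim; exact: cont_energy_density.
- move=> y _.
  have -> : k * (sol t y ^+ 2 + (sol_x t y / k) ^+ 2) =
     (k * sol t y ^+ 2 + sol_x t y ^+ 2 / k) by field; rewrite gt_eqF.
  have h1 : 0 <= (k * sol t y - sol_x t y) ^+ 2 / k by rewrite divr_ge0 ?sqr_ge0// ltW.
  have h2 : 0 <= (k * sol t y + sol_x t y) ^+ 2 / k by rewrite divr_ge0 ?sqr_ge0// ltW.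
  have e1 : (k * sol t y - sol_x t y) ^+ 2 / k = k * sol t y ^+ 2 + sol_x t y ^+ 2 / k -
     2 * (sol t y * sol_x t y) by field; rewrite gt_eqF.
  have e2 : (k * sol t y + sol_x t y) ^+ 2 / k = k * sol t y ^+ 2 + sol_x t y ^+ 2 / k +
     2 * (sol t y * sol_x t y) by field; rewrite gt_eqF.
  rewrite ler_norml; move: h1 h2; rewrite e1 e2; lra.
Qed.

(** Young's inequality [|p| <= eta (p / k)^2 + k^2 / (4 eta)] for [p = sol_x]. Keeping [eta] free
    gives equicontinuity without the square root of Cauchy-Schwarz. *)
Lemma sol_holder t x y eta B : 0 <= x -> x <= y -> 0 < eta -> energy t y <= B ->
  `|sol t y - sol t x| <= eta * B + k ^+ 2 / (4 * eta) * (y - x).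
Proof.
move=> x0 xy eta0 EB.
have := @mvt_le R (sol t) (fun y => eta * grad_energy t y + k ^+ 2 / (4 * eta) * y)
  (sol_x t)
  (fun y => eta * (sol_x t y / k) ^+ 2 + k ^+ 2 / (4 * eta)) x y xy.
move=> H; apply: le_trans (H _ _ _) _.
- by move=> z _; exact: der_sol_x.
- move=> z _; apply: derD.
    by apply: derZ; apply: der_prim; exact: cont_grad_density.
  by apply: (is_derive_eq (derZ _ (der_id z))); rewrite mulr1.
- move=> z _; set p := sol_x t z.
  have h1 : 0 <= eta * (p / k - k / (2 * eta)) ^+ 2.
    by rewrite mulr_ge0 ?sqr_ge0// ltW.
  have h2 : 0 <= eta * (p / k + k / (2 * eta)) ^+ 2.
    by rewrite mulr_ge0 ?sqr_ge0// ltW.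
  have e1 : eta * (p / k - k / (2 * eta)) ^+ 2 =
     eta * (p / k) ^+ 2 + k ^+ 2 / (4 * eta) - p by field; rewrite !gt_eqF.
  have e2 : eta * (p / k + k / (2 * eta)) ^+ 2 =
     eta * (p / k) ^+ 2 + k ^+ 2 / (4 * eta) + p by field; rewrite !gt_eqF.
  rewrite ler_norml; move: h1 h2; rewrite e1 e2; lra.
- have g1 : grad_energy t y <= B.
    by apply: le_trans EB; apply: grad_energy_le; exact: le_trans xy.
  have g0 : 0 <= grad_energy t x by exact: grad_energy_ge0.
  have : eta * (grad_energy t y - grad_energy t x) <= eta * B.
    by rewrite ler_pM2l//; lra.
  lra.
Qed.

End energy.

(** * The homogeneous evolution [w_t = alpha K[w]] *)

Section decay.
Context {R : realType}.
Implicit Types (f g : R -> R) (a b c t s x y C L : R).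
Variables k alpha : R.
Hypothesis k0 : 0 < k.
Hypothesis alpha0 : alpha != 0.
Variables M m : R -> R -> R.
Hypothesis nM : nice M.
Hypothesis nm : nice m.
Hypothesis dM : forall t y, is_derive t 1 (M ^~ y) (m t y).
Hypothesis mE : forall t x, 0 <= t -> 0 <= x -> m t x = alpha * sol k M t x.
Variable B : R.
Hypothesis EB : forall L, 0 <= L -> energy k M 0 L <= B.

Let w := sol k M.
Let w_x := sol_x k M.
Let cw t : continuous (w t). Proof. exact: cont_sol. Qed.
Let cw_x t : continuous (w_x t). Proof. exact: cont_sol_x. Qed.
Let cm t : continuous (m t). Proof. exact: (nice_x nm). Qed.

(** As [m = alpha w], the integrand is [alpha / 2] times the derivative of [w^2]: the truncated
    energy changes only through the boundary at [L]. *)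
Let prim_wxm t L : 0 <= t -> 0 <= L ->
  prim (fun x => w_x t x * m t x) L = alpha / 2 * w t L ^+ 2.
Proof.
move=> t0 L0.
have d x : is_derive x 1 (fun x => alpha / 2 * w t x ^+ 2) (alpha * (w t x * w_x t x)).
  apply: (is_derive_eq (derZ _ (der_sqr (der_sol_x k nM t x)))).
  by rewrite /w /w_x; field.
have := @prim_der R (fun x => alpha / 2 * w t x ^+ 2) _ _ d L.
rewrite /w sol0 expr0n mulr0 subr0 -/w => <-; last first.
  by apply: contZ; exact: contM.
by apply: prim_ext => // x /andP[x0 _]; rewrite mE// -/w; ring.
Qed.

Let flux t L : R := 2 * (w t L * Rk k (m t) L) + alpha * w t L ^+ 2.

Let der_energy_flux t L : 0 <= t -> 0 <= L ->
  is_derive t 1 (fun t => energy k M t L) (flux t L).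
Proof.
move=> t0 L0; apply: (is_derive_eq (der_energy k0 nM nm dM t L0)).
by rewrite prim_wxm// /flux -/w; field.
Qed.

Let w_bdd t : exists C, forall x, 0 <= x ->
  [/\ `|w t x| <= C, `|w_x t x| <= C & `|Rk k (m t) x| <= C].
Proof.
have [C hC] := sol_le k0 nM nm `|t|.
by exists C => x x0; have [? ? _ ? _] := hC t x (lexx _) x0.
Qed.

(** A crude bound, growing with [t] but uniform in [L]. It serves to obtain decay as [x] tends to
    infinity, which in turn yields the bound [B] for all times. *)
Let energy_bdd t : 0 <= t -> exists C, forall L, 0 <= L -> energy k M t L <= C.
Proof.
move=> t0; have [C hC] := sol_le k0 nM nm t.
exists (B + (2 * (C * C) + `|alpha| * (C * C)) * t) => L L0.
have := @lip_der R (fun t => energy k M t L) (flux ^~ L)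
  (2 * (C * C) + `|alpha| * (C * C)) 0 t t0.
rewrite subr0 => H.
have {}H : `|energy k M t L - energy k M 0 L| <= (2 * (C * C) + `|alpha| * (C * C)) * t.
  apply: H => s /andP[s0 st]; first exact: der_energy_flux.
  have [h1 _ _ h5 _] := hC s L (ltac:(by rewrite ger0_norm)) L0.
  apply: le_trans (ler_normD _ _) _; apply: lerD.
    by rewrite normrM ger0_norm// ler_pM2l//; exact: normM_le.
  by rewrite normrM; apply: ler_wpM2l => //; exact: normM_le.
have := ler_norm (energy k M t L - energy k M 0 L); have := EB L0; lra.
Qed.

(** Barbalat's lemma in the variable [x]: [w t] is Lipschitz and square integrable. *)
Let w_vanishes t : 0 <= t -> vanishes (w t).
Proof.
move=> t0; have [C hC] := energy_bdd t0; have [C1 h1] := w_bdd t.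
have C10 : 0 <= C1 by have [+ _ _] := h1 0 (lexx _); exact: le_trans.
apply: (barbalat (@cw t) C10 (C := C)).
- move=> a b a0 ab; refine (@lip_der R (w t) (w_x t) C1 a b ab _ _).
    by move=> x _; exact: der_sol_x.
  by move=> x /andP[ax _]; have [] := h1 x (le_trans a0 ax).
- move=> L L0; apply: le_trans (hC L L0).
  rewrite /energy -subr_ge0 -primB; last 2 first.
  + exact: cont_energy_density.
  + exact: contM.
  rewrite prim_ge0//; apply: Rintegral_ge0 => x _.
  by rewrite addrAC subrr add0r sqr_ge0.
Qed.

Let m_vanishes t : 0 <= t -> vanishes (m t).
Proof.
move=> t0; apply: (@vanishes_le R _ (fun x => alpha * w t x) 0).
  by move=> x x0; rewrite mE.
by apply: vanishesZ; exact: w_vanishes.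
Qed.

Let VR_vanishes t : 0 <= t -> vanishes (Kk k (m t)) /\ vanishes (Rk k (m t)).
Proof.
by move=> t0; apply: kernel_vanishes => //; [exact: nice_bdd|exact: m_vanishes].
Qed.

Let vanishes_nat f : vanishes f -> f n%:R @[n --> \oo] --> (0 : R).
Proof.
move=> /vanishes_cvg /cvg_pinftyP; apply.
exact: cvgr_idn.
Qed.

Let cont_t_w x : 0 <= x -> continuous (w ^~ x).
Proof.
move=> x0; apply: (@der_continuous R _ (fun t => Kk k (m t) x)) => t.
exact: der_sol_t.
Qed.

Let cont_t_w_x x : 0 <= x -> continuous (w_x ^~ x).
Proof.
move=> x0; apply: (@der_continuous R _ (fun t => k ^+ 2 * (Rk k (m t) x + m t x))) => t.
exact: der_sol_x_t.
Qed.

Let cont_t_R x : 0 <= x -> continuous (fun t => Rk k (m t) x).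
Proof. by move=> x0; have [] := cont_t_kernel k0 x0 nm. Qed.

(** The flux at [x = n] tends to zero for each time, by decay in [x], so that no energy enters from
    infinity. *)
Let energy_le t L : 0 <= t -> 0 <= L -> energy k M t L <= B.
Proof.
move=> t0 L0.
have [C hC] := sol_le k0 nM nm (t + 1).
have C0 : 0 <= C.
  have [+ _ _ _ _] := hC 0 0 (ltac:(by rewrite normr0; lra)) (lexx 0).
  by apply: le_trans.
(* [dominated_increment] differentiates at all real times, whereas [mE] holds at nonnegative ones.
   Hence [phi] is the general derivative of the energy, and [phiE] identifies it with the flux on
   the time interval that matters. *)
pose phi (n : nat) s := 2 * (w s n%:R * Rk k (m s) n%:R + prim (fun x => w_x s x * m s x) n%:R).
have cphi n : continuous (phi n).
  apply: contZ; apply: contD.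
    by apply: contM; [exact: cont_t_w|exact: cont_t_R].
  move=> s; have [C1 h1] := sol_le k0 nM nm (`|s| + 1).
  apply: (@cont_prim_param R (fun s x => w_x s x * m s x) (C1 * C1)) => //.
  - by move=> s'; exact: contM.
  - by move=> x x0; apply: contM; [exact: cont_t_w_x|exact: (nice_t nm)].
  - move=> s' x ss /andP[x0 _].
    by have [_ h2 _ _ h6] := h1 s' x (near_norm ss) x0; exact: normM_le.
have phiE n s : 0 <= s -> phi n s = flux s n%:R.
  by move=> s0; rewrite /phi prim_wxm// /flux; field.
have := @dominated_increment R (fun n t => energy k M t n%:R) phi 0 t
  (2 * (C * C) + `|alpha| * (C * C)) t0.
move=> H; apply/ler_addgt0Pr => e e0.
have {}H : (energy k M t n%:R - energy k M 0 n%:R) @[n --> \oo] --> (0 : R).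
  apply: H => //.
  - by move=> n s; exact: der_energy.
  - move=> n s /andP[s0 st]; rewrite phiE//.
    have [h1 _ _ h5 _] := hC s n%:R (ltac:(by rewrite ger0_norm//; lra)) (ler0n _ _).
    apply: le_trans (ler_normD _ _) _; apply: lerD.
      by rewrite normrM ger0_norm// ler_pM2l//; exact: normM_le.
    by rewrite normrM; apply: ler_wpM2l => //; exact: normM_le.
  - move=> s /andP[s0 st].
    under eq_fun do rewrite phiE//.
    apply: (vanishes_nat (f := flux s)).
    have [_ Rv] := VR_vanishes s0; have [C1 h1] := w_bdd s.
    apply: vanishesD.
      apply: vanishesZ; apply: (@vanishesM R _ _ C1 0) => // x x0.
      by have [] := h1 x x0.
    apply: vanishesZ; apply: (@vanishesM R _ _ C1 0).
      by move=> x x0; have [] := h1 x x0.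
    exact: w_vanishes.
have /cvgrPdist_le /(_ e e0) [N _ hN] := H.
(* The energy increases with the cut-off, so [L] may be replaced by an integer beyond it at which
   the increment is already at most [e]. *)
pose n := maxn N (Num.bound L).
have nL : L <= n%:R.
  apply: le_trans (ltW (archi_boundP L0)) _.
  by rewrite ler_nat leq_maxr.
apply: le_trans (energy_mono k nM t L0 nL) _.
have := hN n (leq_maxl _ _); rewrite /= sub0r normrN => h.
have := EB (ler0n R n); have := ler_norm (energy k M t n%:R - energy k M 0 n%:R).
lra.
Qed.

(** This is [gamma V_x^2 - V^2] with [V = Kk k (m t)] and [V_x = k^2 (R + m)]. Writing [alpha w] in
    place of [m] makes it differentiable in [x] on all of [R]. *)
Let gflux t x : R := k ^+ 2 * (Rk k (m t) x + alpha * w t x) ^+ 2 - Kk k (m t) x ^+ 2.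

(* Multiplying the equation [gamma V_xx - V = alpha w_x] by [V_x], where
   [V = w_t], gives an exact differential in [x]. *)
Let prim_grad t L : 0 <= t -> 0 <= L ->
  prim (fun x => 2 * (w_x t x * (Rk k (m t) x + m t x))) L =
  (alpha * k ^+ 2)^-1 * gflux t L - k ^+ 2 / alpha * Lap k (m t) ^+ 2.
Proof.
move=> t0 L0.
pose h x := (alpha * k ^+ 2)^-1 * (k ^+ 2 * (2 * ((Rk k (m t) x + alpha * w t x) *
    (Kk k (m t) x + alpha * w_x t x))) -
    2 * (Kk k (m t) x * (k ^+ 2 * (Rk k (m t) x + m t x)))).
have d x : is_derive x 1 (fun x => (alpha * k ^+ 2)^-1 * gflux t x) (h x).
  have dR := @der_Rk R k (m t) x (@cm t); have dK := @der_Kk R k (m t) x (@cm t).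
  have dw := der_sol_x k nM t x.
  exact: (derZ _ (derB (derZ _ (der_sqr (derD dR (derZ alpha dw)))) (der_sqr dK))).
have cR := @cont_Rk R k _ (@cm t); have cV := @cont_Kk R k _ (@cm t).
have ch : continuous h.
  apply: contZ; apply: contB.
    apply: contZ; apply: contZ; apply: contM; apply: contD => //; exact: contZ.
  by apply: contZ; apply: contM => //; apply: contZ; exact: contD.
have -> : prim (fun x => 2 * (w_x t x * (Rk k (m t) x + m t x))) L = prim h L.
  apply: prim_ext => // x /andP[x0 _]; rewrite /h mE// -/w.
  by field; rewrite alpha0 gt_eqF.
rewrite (prim_der ch d) /gflux Kk0 Rk0 /w sol0.
by field; rewrite alpha0 gt_eqF.
Qed.

(** By [prim_grad], the gradient energy plus [k^2 / alpha] times this integral is constant in time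
    once the cut-off is removed, and the gradient energy stays between [0] and [B]. The summand [1]
    covers the error of a finite cut-off. *)
Let Lap_sqr_int t : 0 <= t ->
  prim (fun s => Lap k (m s) ^+ 2) t <= `|alpha| / k ^+ 2 * (2 * B + 1).
Proof.
move=> t0; have cL := cont_t_Lap k0 nm.
have cL2 : continuous (fun s => Lap k (m s) ^+ 2) by exact: contM.
have [C hC] := sol_le k0 nM nm (t + 1).
pose f s x := 2 * (w_x s x * (Rk k (m s) x + m s x)).
pose phi (n : nat) s := prim (f s) n%:R + k ^+ 2 / alpha * Lap k (m s) ^+ 2.
pose E (n : nat) t := grad_energy k M t n%:R + k ^+ 2 / alpha * prim (fun s => Lap k (m s) ^+ 2) t.
have cphi n : continuous (phi n).
  apply: contD; last exact: contZ.
  move=> s; have [C1 h1] := sol_le k0 nM nm (`|s| + 1).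
  apply: (@cont_prim_param R f (2 * (C1 * (C1 + C1)))) => //.
  - move=> s'; apply: contZ; apply: contM => //; apply: contD => //; exact: cont_Rk.
  - move=> x x0; apply: contZ; apply: contM; first exact: cont_t_w_x.
    by apply: contD; [exact: cont_t_R|exact: (nice_t nm)].
  - move=> s' x ss /andP[x0 _].
    have [_ h2 _ h5 h6] := h1 s' x (near_norm ss) x0.
    rewrite normrM (@ger0_norm _ 2)// ler_pM2l// normrM; apply: ler_pM => //.
    by apply: le_trans (ler_normD _ _) _; exact: lerD.
have phiE n s : 0 <= s -> phi n s = (alpha * k ^+ 2)^-1 * gflux s n%:R.
  by move=> s0; rewrite /phi /f prim_grad// subrK.
have H : (E n t - E n 0) @[n --> \oo] --> (0 : R).
  apply: (@dominated_increment R E phi 0 t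
    (`|(alpha * k ^+ 2)^-1| * (k ^+ 2 * ((C + `|alpha| * C) * (C + `|alpha| * C)) + C * C)) t0) => //.
  - move=> n s; apply: derD; first exact: der_grad_energy.
    by apply: derZ; exact: der_prim.
  - move=> n s /andP[s0 st]; rewrite phiE// normrM; apply: ler_wpM2l => //.
    have [h1 _ h3 h5 _] := hC s n%:R (ltac:(by rewrite ger0_norm//; lra)) (ler0n _ _).
    apply: le_trans (ler_normB _ _) _; apply: lerD; last exact: normM_le.
    rewrite normrM (ger0_norm (sqr_ge0 _)); apply: ler_wpM2l; first exact: sqr_ge0.
    apply: normM_le; apply: le_trans (ler_normD _ _) _; apply: lerD => //;
      by rewrite normrM; exact: ler_wpM2l.
  - move=> s /andP[s0 st].
    under eq_fun do rewrite phiE//.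
    apply: (vanishes_nat (f := fun x => (alpha * k ^+ 2)^-1 * gflux s x)).
    have [Vv Rv] := VR_vanishes s0.
    have wv := w_vanishes s0.
    have sqv g : vanishes g -> vanishes (fun x => g x ^+ 2).
      move=> gv; have [T hT] := gv 1 ltr01.
      exact: (@vanishesM R _ _ 1 T).
    apply: vanishesZ; apply: vanishesD.
      by apply: vanishesZ; apply: sqv; apply: vanishesD => //; exact: vanishesZ.
    by move=> e /(sqv _ Vv)[T hT]; exists T => x /hT; rewrite normrN.
have /cvgrPdist_le /(_ 1 ltr01) [N _ hN] := H.
have := hN N (leqnn N); rewrite /= sub0r normrN /E prim0 mulr0 addr0.
have g1 := grad_energy_le k nM t (ler0n R N); have g2 := energy_le t0 (ler0n R N).
have g3 := grad_energy_le k nM 0 (ler0n R N); have g4 := EB (ler0n R N).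
have g5 := grad_energy_ge0 k M t (ler0n R N).
have g6 := grad_energy_ge0 k M 0 (ler0n R N).
set p := prim _ t => h.
have p0 : 0 <= p.
  by rewrite /p prim_ge0//; apply: Rintegral_ge0 => x _; exact: sqr_ge0.
have : `|k ^+ 2 / alpha * p| <= 2 * B + 1.
  rewrite ler_norml; move: h; rewrite ler_norml => /andP[h1 h2].
  apply/andP; split; lra.
rewrite normrM (ger0_norm p0) normrM normfV (ger0_norm (sqr_ge0 k)) => hp.
have -> : p = `|alpha| / k ^+ 2 * (k ^+ 2 / `|alpha| * p).
  by field; rewrite normr_eq0 alpha0 gt_eqF.
by apply: ler_wpM2l hp; rewrite divr_ge0 ?sqr_ge0.
Qed.

(** The square of [w] is at most [k B], and [k B + 1] exceeds the square root of [k B]. *)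
Let w_le t x : 0 <= t -> 0 <= x -> `|w t x| <= k * B + 1.
Proof.
move=> t0 x0; have h := sol_sqr_le k0 nM t x0.
have kE : k * energy k M t x <= k * B by rewrite ler_pM2l//; exact: energy_le.
have h1 := le_trans h kE; rewrite -/w in h1.
have kB : 0 <= k * B by apply: le_trans h1; exact: sqr_ge0.
rewrite -(@ler_pXn2r _ 2)// ?nnegrE//; last lra.
rewrite real_normK ?num_real//; apply: le_trans h1 _; nra.
Qed.

Let der_Lap_w c t : 0 < c -> 0 <= t ->
  is_derive t 1 (fun t => Lap c (w t)) (Lap c (Kk k (m t))).
Proof.
move=> c0 t0; have [C hC] := sol_le k0 nM nm (`|t| + 1).
apply: (@der_Lap R c w (fun t => Kk k (m t)) C t c0).
- exact: cw.
- by move=> s; have [C1 h1] := w_bdd s; exists C1 => x /h1[].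
- by move=> s x x0; exact: der_sol_t.
- by move=> s x st x0; have [_ _ ? _ _] := hC s x (near_norm st) x0.
Qed.

Let w_bdd' t : bdd (w t).
Proof. by have [C1 h1] := w_bdd t; exists C1 => x /h1[]. Qed.

Let V_bdd t : bdd (Kk k (m t)).
Proof.
have [C hC] := sol_le k0 nM nm `|t|.
by exists C => x x0; have [_ _ ? _ _] := hC t x (lexx _) x0.
Qed.

Let Lap_mE t c : 0 < c -> 0 <= t -> Lap c (m t) = alpha * Lap c (w t).
Proof. by move=> c0 t0; rewrite -LapZ//; apply: eq_Lap => y y0; rewrite mE. Qed.

(* Laplace transform of [gamma V_xx = V + m_x]. *)
Let Lap_V t (c : R) : 0 < c -> 0 <= t ->
  (1 - (c / k) ^+ 2) * Lap c (Kk k (m t)) + c * Lap c (m t) = k * Lap k (m t).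
Proof.
move=> c0 t0.
have cV := @cont_Kk R k _ (@cm t).
have bm := nice_bdd t nm.
have bV := V_bdd t.
have bc (a : R) : bdd (fun _ => a) by exists `|a|.
rewrite -(LapZ (1 - (c / k) ^+ 2) c0 cV bV) -(LapZ c c0 (@cm t) bm).
rewrite -LapD//; [|exact: contZ|exact: contZ|exact: bddM|exact: bddM].
pose h x := (1 - (c / k) ^+ 2) * Kk k (m t) x + c * m t x.
have ch : continuous h by apply: contD; exact: contZ.
have bh : bdd h.
  have [C1 h1] := bddM (bc (1 - (c / k) ^+ 2)) bV; have [C2 h2] := bddM (bc c) bm.
  exists (C1 + C2) => y y0; apply: le_trans (ler_normD _ _) _.
  by apply: lerD; [exact: h1|exact: h2].
(* An antiderivative obtained by parts from [V_x = k^2 (R + m)] and [R_x = V]. It vanishes at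
   infinity and equals [- k Lap k (m t)] at [0]. *)
pose G x := expR (- c * x) * (c / k ^+ 2 * Kk k (m t) x + Rk k (m t) x).
have dG x : is_derive x 1 G (expR (- c * x) * h x).
  have dR := @der_Rk R k (m t) x (@cm t); have dK := @der_Kk R k (m t) x (@cm t).
  apply: (is_derive_eq (derM (der_exp (- c) x) (derD (derZ (c / k ^+ 2) dK) dR))).
  by rewrite /h; field; rewrite gt_eqF.
apply: (hl_unique (cont_expM (c := - c) ch) (Lap_int c0 ch bh)).
have pE L : prim (fun y => expR (- c * y) * h y) L = G L + k * Lap k (m t).
  rewrite (prim_der (cont_expM (c := - c) ch) dG) /G Kk0 Rk0 !mulr0 expR0; ring.
have [Vv Rv] := VR_vanishes t0.
have G0 : vanishes G.
  apply: (@vanishesM R _ _ 1 0).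
    by move=> x x0; rewrite ger0_norm ?expR_ge0// mulNr expR_le1 oppr_le0 mulr_ge0// ltW.
  by apply: vanishesD => //; exact: vanishesZ.
have /vanishes_cvg G0' := G0.
have h1 : G L + k * Lap k (m t) @[L --> +oo] --> 0 + k * Lap k (m t).
  by apply: cvgD; [exact: G0'|exact: cvg_cst].
rewrite add0r in h1.
by under eq_fun do rewrite pE.
Qed.

Let Lap1_vanishes : vanishes (fun t => Lap k (m t)).
Proof.
(* This is the Lipschitz constant in time of [alpha Lap k (w t)]: [kernel_le] and [Lap_le] are
   applied to [|m| <= |alpha| (k B + 1)]. *)
have L0 : 0 <= `|alpha| * (3 / 2 * k * (`|alpha| * (k * B + 1)) / k).
  have := w_le (lexx 0) (lexx 0) => h.
  have kB : 0 <= k * B + 1 by apply: le_trans h.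
  have k0' := ltW k0.
  by rewrite mulr_ge0// divr_ge0// mulr_ge0// mulr_ge0.
apply: (barbalat (cont_t_Lap k0 nm) L0 _ Lap_sqr_int).
move=> a b a0 ab; rewrite !Lap_mE//; last exact: le_trans ab.
refine (@lip_der R (fun t => alpha * Lap k (w t))
  (fun t => alpha * Lap k (Kk k (m t))) _ a b ab _ _).
- by move=> t /andP[ta _]; apply: derZ; apply: der_Lap_w => //; exact: le_trans ta.
- move=> t /andP[ta _]; have t0 := le_trans a0 ta.
  rewrite normrM; apply: ler_wpM2l => //; apply: Lap_le => //.
    exact: cont_Kk.
  move=> x x0.
  have mC y : 0 <= y -> `|m t y| <= `|alpha| * (k * B + 1).
    by move=> y0; rewrite mE// normrM; apply: ler_wpM2l => //; exact: w_le.
  by have [] := kernel_le k0 (@cm t) mC x0.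
Qed.

Let Lap_vanishes (j : nat) : vanishes (fun t => Lap (j.+1%:R * k) (w t)).
Proof.
have q0 : vanishes (fun t => Lap k (w t)).
  apply: (@vanishes_le R _ (fun t => alpha^-1 * Lap k (m t)) 0).
    by move=> t t0; rewrite Lap_mE// mulKf.
  by apply: vanishesZ; exact: Lap1_vanishes.
(* At [j = 0] the factor [1 - (c / k)^2] of [Lap_V] is zero and gives no equation for the transform;
   this case rests on Barbalat's lemma. Otherwise the multiple of [k] is [c = j + 2], with the new
   [j], and [c^2 - 1] is nonzero. *)
case: j => [|j]; first by under eq_fun do rewrite mul1r.
set c := j.+2%:R : R.
have c2 : 2 <= c by rewrite /c ler_nat.
have ck : 0 < c * k by rewrite mulr_gt0//; lra.
have c1 : c ^+ 2 - 1 != 0.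
  rewrite gt_eqF// subr_gt0 -[ltLHS](expr1n _ 2) ltrXn2r//; lra.
pose lam := c * k * alpha / (c ^+ 2 - 1).
have lam0 : lam != 0.
  by rewrite /lam !mulf_neq0// ?invr_neq0// gt_eqF//; lra.
refine (@ode_vanishes R lam _ (fun t => - (k / (c ^+ 2 - 1)) * Lap k (m t))
  ((k * B + 1) / (c * k)) lam0 _ _ _).
- move=> t t0; apply: (is_derive_eq (der_Lap_w ck t0)).
  have := Lap_V ck t0; rewrite (Lap_mE ck t0).
  have -> : c * k / k = c by field; rewrite gt_eqF.
  set v := Lap (c * k) (Kk k (m t)) => h.
  apply: (mulfI c1); rewrite /lam.
  have -> : (c ^+ 2 - 1) * (c * k * alpha / (c ^+ 2 - 1) * Lap (c * k) (w t) +
    - (k / (c ^+ 2 - 1)) * Lap k (m t)) = c * k * alpha * Lap (c * k) (w t) - k * Lap k (m t).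
    by move: (c ^+ 2 - 1) c1 => D D0; field.
  by rewrite -h; ring.
- by move=> t t0; apply: Lap_le => // x x0; exact: w_le.
- by apply: vanishesZ; exact: Lap1_vanishes.
Qed.

Theorem sol_vanishes x : 0 <= x -> vanishes (fun t => sol k M t x).
Proof.
move=> x0; apply: (laplace_density k0 (C := k * B + 1)) => //.
move=> e e0.
  have B0 : 0 <= B.
    by have := EB (lexx 0); rewrite /energy prim0.
  (* [eta] makes the energy term of [sol_holder] at most [e / 2], then [d] does the same for the
     term proportional to the distance. As [B] does not depend on time, neither does [d]. *)
  pose eta := e / (2 * (B + 1)).
  have eta0 : 0 < eta by rewrite divr_gt0//; lra.
  pose d := e / 2 / (k ^+ 2 / (4 * eta)).
  have kp : 0 < k ^+ 2 / (4 * eta) by rewrite divr_gt0 ?exprn_gt0//; lra.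
  have d0 : 0 < d by rewrite divr_gt0// divr_gt0.
  exists d => // t y t0 y0 yx.
  have etaB : eta * B <= e / 2.
    rewrite /eta; have -> : e / (2 * (B + 1)) * B = e / 2 * (B / (B + 1)) by field; lra.
    apply: ler_piMr; first lra.
    by rewrite ler_pdivrMr; lra.
  have kd a : a <= d -> k ^+ 2 / (4 * eta) * a <= e / 2.
    move=> ad; apply: (@le_trans _ _ (k ^+ 2 / (4 * eta) * d)).
      by rewrite ler_pM2l.
    by rewrite /d mulrC divfK// gt_eqF.
  have [xy|xy] := leP x y.
    apply: le_trans (sol_holder k0 nM x0 xy eta0 (energy_le t0 y0)) _.
    have : k ^+ 2 / (4 * eta) * (y - x) <= e / 2.
      by apply: kd; apply: le_trans yx; exact: ler_norm.
    lra.
  rewrite distrC.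
  apply: le_trans (sol_holder k0 nM y0 (ltW xy) eta0 (energy_le t0 x0)) _.
  have : k ^+ 2 / (4 * eta) * (x - y) <= e / 2.
    by apply: kd; apply: le_trans yx; rewrite distrC; exact: ler_norm.
  lra.
Qed.

End decay.

(** * Primitives of integrable functions *)

Section primitive_L1.
Context {R : realType}.
Notation mu := (@lebesgue_measure R).
Implicit Types (f g h phi : R -> R) (a b c e t s x y C L : R).

Lemma seg_hl a b : 0 <= a -> `[a, b]%classic `<=` @halfline R.
Proof.
by move=> a0 y /=; rewrite in_itv/= => /andP[ay _]; apply/halflineE; exact: le_trans ay.
Qed.

Lemma L1_seg f L : L1 f -> mu.-integrable `[0, L] (EFin \o f).
Proof. by move=> fi; apply: integrableS fi => //; [exact: measurable_hl|exact: seg_hl]. Qed.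

Lemma le_Rint_seg f g a b : mu.-integrable `[a, b] (EFin \o f) ->
  mu.-integrable `[a, b] (EFin \o g) ->
  (forall y, a <= y <= b -> `|f y| <= g y) ->
  `|\int[mu]_(y in `[a, b]) f y| <= \int[mu]_(y in `[a, b]) g y.
Proof.
move=> fi gi fg.
apply: le_trans (le_normr_Rintegral (mu := mu) _ fi) _; first exact: measurable_itv.
apply: le_Rintegral => //; first exact: (integrable_norm fi).
Qed.

Lemma L1_mul_seg f h a L : 0 <= a -> L1 f -> continuous h ->
  mu.-integrable `[a, L] (EFin \o (fun y => f y * h y)).
Proof.
move=> a0 fi ch.
have fi' : mu.-integrable `[a, L] (EFin \o f).
  by apply: integrableS fi => //; [exact: measurable_hl|exact: seg_hl].
rewrite (_ : (EFin \o _) = (fun y => (h y)%:E * (f y)%:E)%E); last first.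
  by apply/funext => y; rewrite /= mulrC EFinM.
apply: (integrableMr _ _ _ fi') => //.
  by apply: measurable_funS measurableT (@subsetT _ _) _; exact: continuous_measurable_fun.
have /(@compact_bounded _ R^o) := @continuous_compact _ _ h `[a, L]%classic
  (continuous_subspaceT ch) (@segment_compact R a L).
move=> [M [Mr hM]]; exists M; split => // r Mr' y /= yaL.
by apply: (hM r Mr'); exists y.
Qed.

Lemma cont_bounded_seg h a b : continuous h -> exists C, forall y, a <= y <= b -> `|h y| <= C.
Proof.
move=> ch.
have /(@compact_bounded _ R^o) := @continuous_compact _ _ h `[a, b]%classic
  (continuous_subspaceT ch) (@segment_compact R a b).
move=> [M [Mr hM]]; exists (M + 1) => y yab.
by apply: (hM (M + 1)); [rewrite ltrDl|exists y => //=; rewrite in_itv].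
Qed.

Definition l1 f : R := \int[mu]_(y in @halfline R) `|f y|.

Lemma l1_ge0 f : 0 <= l1 f.
Proof. exact: Rintegral_ge0. Qed.

Lemma L1_norm f : L1 f -> mu.-integrable (@halfline R) (EFin \o (fun y => `|f y|)).
Proof. by move=> fi; exact: (integrable_norm fi). Qed.

Lemma seg_l1_le f L : L1 f -> \int[mu]_(y in `[0, L]) `|f y| <= l1 f.
Proof.
move=> fi; rewrite /l1 /Rintegral fine_le//.
- apply: integrable_fin_num => //.
  by apply: (integrable_norm (L1_seg L fi)).
- by apply: integrable_fin_num; [exact: measurable_hl|exact: L1_norm].
- apply: ge0_subset_integral => //.
  + exact: measurable_hl.
  + by have /integrableP[] := L1_norm fi.
  + exact: seg_hl.
Qed.

(** Unlike [prim], it is zero for negative [x], where the interval is empty. *)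
Definition pL1 f x : R := \int[mu]_(y in `[0, x]) f y.

Lemma pL1_le f x : L1 f -> `|pL1 f x| <= l1 f.
Proof.
move=> fi; apply: le_trans (seg_l1_le x fi); apply: le_Rint_seg.
- exact: L1_seg.
- exact: (integrable_norm (L1_seg x fi)).
- by [].
Qed.

Lemma L1B f g : L1 f -> L1 g -> L1 (fun y => f y - g y).
Proof.
move=> fi gi; rewrite /L1 (_ : EFin \o _ = (fun y => (f y)%:E - (g y)%:E)%E).
  by apply: integrableB => //; exact: measurable_hl.
by apply/funext => y; rewrite /= EFinB.
Qed.

Lemma L1Z c f : L1 f -> L1 (fun y => c * f y).
Proof.
move=> fi; rewrite /L1 (_ : EFin \o _ = (fun y => c%:E * (f y)%:E)%E).
  by apply: integrableZl => //; exact: measurable_hl.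
by apply/funext => y; rewrite /= EFinM.
Qed.

Lemma pL1B f g x : L1 f -> L1 g -> pL1 (fun y => f y - g y) x = pL1 f x - pL1 g x.
Proof.
by move=> fi gi; rewrite /pL1 RintegralB//; exact: L1_seg.
Qed.

Lemma L1_approx f L e : L1 f -> 0 < e -> exists2 h, continuous h &
  \int[mu]_(y in `[0, L]) `|f y - h y| <= e.
Proof.
move=> fi e0; have fiL := L1_seg L fi.
have [||g [cg gi gf]] := @approximation_continuous_integrable R `[0, L]%classic f _ _ fiL.
- exact: measurable_itv.
- exact: (compact_finite_measure (@segment_compact R 0 L)).
move/fine_cvg : gf => /cvgrPdist_le /(_ e e0) [N _ hN].
exists (g N) => //; have := hN N (leqnn N).
rewrite /= sub0r normrN; apply: le_trans; apply: ler_norm.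
Qed.

Lemma approx_mul f h phi x L e C : L1 f -> continuous h -> continuous phi ->
  \int[mu]_(y in `[0, L]) `|f y - h y| <= e -> x <= L -> 0 <= C ->
  (forall y, 0 <= y <= L -> `|phi y| <= C) ->
  `|\int[mu]_(y in `[0, x]) (f y * phi y) - \int[mu]_(y in `[0, x]) (h y * phi y)| <= C * e.
Proof.
move=> fi ch cphi fh xL C0 phiC.
have i1 : mu.-integrable `[0, x] (EFin \o (fun y => f y * phi y)) by exact: L1_mul_seg.
have i2 : mu.-integrable `[0, x] (EFin \o (fun y => h y * phi y)).
  by apply: integrable_seg; exact: contM.
have iS (g : R -> R) : mu.-integrable `[0, L] (EFin \o g) -> mu.-integrable `[0, x] (EFin \o g).
  by apply: integrableS => //; apply: subset_itvl; rewrite bnd_simp.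
have i3 : mu.-integrable `[0, L] (EFin \o (fun y => `|f y - h y|)).
  apply: integrable_norm; rewrite (_ : EFin \o _ = (fun y => (f y)%:E - (h y)%:E)%E).
    by apply: integrableB => //; [exact: L1_seg|exact: integrable_seg].
  by apply/funext => y; rewrite /= EFinB.
have i4 : mu.-integrable `[0, L] (EFin \o (fun y => C * `|f y - h y|)).
  rewrite (_ : EFin \o _ = (fun y => C%:E * `|f y - h y|%:E)%E).
    exact: (@integrableZl _ _ _ mu _ (measurable_itv _) C _ i3).
  by apply/funext => y; rewrite /= EFinM.
rewrite -RintegralB//.
apply: le_trans (le_Rint_seg _ (iS _ i4) _) _.
- rewrite (_ : EFin \o _ = (fun y => (f y * phi y)%:E - (h y * phi y)%:E)%E).
    exact: integrableB.
  by apply/funext => y; rewrite /= EFinB.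
- move=> y /andP[y0 yx]; rewrite -mulrBl normrM mulrC.
  by apply: ler_wpM2r => //; apply: phiC; rewrite y0 (le_trans yx).
- apply: (@le_trans _ _ (\int[mu]_(y in `[0, L]) (C * `|f y - h y|))).
    rewrite /Rintegral fine_le//.
    + by apply: integrable_fin_num => //; exact: (iS _ i4).
    + exact: integrable_fin_num.
    + apply: ge0_subset_integral => //.
      * by have /integrableP[] := i4.
      * by move=> y _; rewrite lee_fin mulr_ge0.
      * by apply: subset_itvl; rewrite bnd_simp.
  rewrite RintegralZl//.
  exact: ler_wpM2l.
Qed.

(** One continuous [h] close to [f] in [L^1] serves both the primitive and the tested integral. The
    maximum with [0] reproduces the value of [pL1 f] at negative [x]. *)
Lemma pL1_approx f L e : L1 f -> 0 < e -> exists2 h, continuous h &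
  (forall x, x <= L -> `|pL1 f x - prim h (Num.max x 0)| <= e) /\
  (forall phi C, continuous phi -> 0 <= C -> (forall y, 0 <= y <= L -> `|phi y| <= C) ->
    `|\int[mu]_(y in `[0, L]) (f y * phi y) - \int[mu]_(y in `[0, L]) (h y * phi y)| <= C * e).
Proof.
move=> fi e0; have [h ch fh] := L1_approx L fi e0.
exists h => //; split=> [x xL|phi C cphi C0 phiC]; last first.
  exact: (approx_mul fi ch cphi fh (lexx _) C0 phiC).
have := @approx_mul f h (fun=> 1) x L e 1 fi ch (@cst_continuous _ _) fh xL ler01.
rewrite mul1r => H.
have -> : prim h (Num.max x 0) = \int[mu]_(y in `[0, x]) h y.
  have [x0|x0] := leP x 0; last by rewrite prim_ge0// ltW.
  by rewrite prim0 Rint_seg_ge.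
have e1 (g : R -> R) : \int[mu]_(y in `[0, x]) (g y * 1) = \int[mu]_(y in `[0, x]) g y.
  by apply: eq_Rintegral => y _; rewrite mulr1.
by rewrite !e1 in H; apply: H => y _; rewrite normr1.
Qed.

Lemma cont_max0 : continuous (fun x : R => Num.max x 0).
Proof. by move=> x; apply: continuous_max; [exact: cvg_id|exact: cvg_cst]. Qed.

Lemma cont_approx (N : R -> R) x : (forall e, 0 < e -> exists2 h, continuous h &
  forall y, `|y - x| < 1 -> `|N y - h y| <= e) -> {for x, continuous N}.
Proof.
move=> H; apply/cvgrPdist_le => e e0.
have [|h ch hN] := H (e / 3); first by lra.
have /cvgrPdist_le /(_ (e / 3)) := ch x.
have e3 : 0 < e / 3 by lra.
move=> /(_ e3) h1; near=> y.
have yx : `|y - x| < 1.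
  by rewrite distrC; near: y; apply/nbhs_ballP; exists 1 => //= z; rewrite /ball/=.
have a1 : `|h x - h y| <= e / 3 by near: y.
have a2 := hN y yx; have := hN x; rewrite subrr normr0 => /(_ ltr01) a3.
have := ler_distD (h x) (N x) (N y); have := ler_distD (h y) (h x) (N y).
rewrite (distrC (h y) (N y)); lra.
Unshelve. all: by end_near. Qed.

Lemma cont_pL1 f : L1 f -> continuous (pL1 f).
Proof.
move=> fi x; apply: cont_approx => e e0.
have [h ch [hf _]] := pL1_approx (x + 1) fi e0.
exists (fun x => prim h (Num.max x 0)).
  by apply: (cont_comp cont_max0); exact: continuous_prim.
by move=> y yx; apply: hf; move: yx; rewrite ltr_norml; lra.
Qed.

(** For continuous [f] this is the product rule. The general case follows by density, every term
    being continuous in [f] for the [L^1] norm on [[0, L]]; this avoids differentiating [pL1 f]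
    almost everywhere. *)
Lemma pL1_by_parts f phi phi' L : 0 <= L -> L1 f ->
  (forall x, is_derive x 1 phi (phi' x)) -> continuous phi' ->
  \int[mu]_(y in `[0, L]) (f y * phi y) =
  phi L * pL1 f L - prim (fun x => phi' x * pL1 f x) L.
Proof.
move=> L0 fi dphi cphi'.
have cphi := der_continuous dphi.
have [C1' h1'] := @cont_bounded_seg phi 0 L cphi.
have [C2' h2'] := @cont_bounded_seg phi' 0 L cphi'.
pose C1 := Num.max C1' 0; pose C2 := Num.max C2' 0.
have C10 : 0 <= C1 by rewrite le_max lexx orbT.
have C20 : 0 <= C2 by rewrite le_max lexx orbT.
have h1 y : 0 <= y <= L -> `|phi y| <= C1 by move=> /h1' h; rewrite le_max h.
have h2 y : 0 <= y <= L -> `|phi' y| <= C2 by move=> /h2' h; rewrite le_max h.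
have cN := cont_pL1 fi.
apply/eqP; rewrite -subr_eq0 -normr_le0; apply/ler_addgt0Pr => e e0; rewrite add0r.
(* [K] collects the three approximation errors: [C1] for the tested integral, [C1] for the boundary
   term and [C2 * L] for the remaining integral. The [1] makes it positive. *)
pose K := 2 * C1 + C2 * L + 1.
have CL := mulr_ge0 C20 L0.
have K0 : 0 < K by rewrite /K; lra.
have eK : 0 < e / K by rewrite divr_gt0.
have [h ch [ha hb]] := pL1_approx L fi eK.
have cp := continuous_prim ch.
have b1 := hb phi C1 cphi C10 h1.
have b2 : `|phi L * pL1 f L - phi L * prim h L| <= C1 * (e / K).
  rewrite -mulrBr normrM; apply: ler_pM => //; first by apply: h1; rewrite L0 lexx.
  by have := ha L (lexx _); rewrite max_l.
have b3 : `|prim (fun x => phi' x * pL1 f x) L - prim (fun x => phi' x * prim h x) L|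
    <= C2 * (e / K) * L.
  rewrite -primB; [|exact: contM..].
  have := @lip_der R (prim (fun x => phi' x * pL1 f x - phi' x * prim h x))
    (fun x => phi' x * pL1 f x - phi' x * prim h x) (C2 * (e / K)) 0 L L0.
  rewrite prim0 !subr0; apply.
    by move=> y _; apply: der_prim; apply: contB; exact: contM.
  move=> y yL; rewrite -mulrBr normrM; apply: ler_pM => //; first exact: h2.
  by move: yL => /andP[y0 yL]; have := ha y yL; rewrite max_l.
have b4 : \int[mu]_(y in `[0, L]) (h y * phi y) =
    phi L * prim h L - prim (fun x => phi' x * prim h x) L.
  have c1 := contM cphi' cp; have c2 := contM ch cphi.
  have d x : is_derive x 1 (fun x => phi x * prim h x) (phi' x * prim h x + h x * phi x).
    by apply: (is_derive_eq (derM (dphi x) (der_prim x ch))); rewrite (mulrC (h x)).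
  rewrite -prim_ge0//; have := prim_der (contD c1 c2) d L.
  by rewrite prim0 mulr0 subr0 primD// => <-; ring.
have eE : C1 * (e / K) + C1 * (e / K) + C2 * (e / K) * L <= e.
  have -> : C1 * (e / K) + C1 * (e / K) + C2 * (e / K) * L = e * ((K - 1) / K).
    by rewrite /K; field; rewrite gt_eqF.
  by apply: ler_piMr; [exact: ltW|rewrite ler_pdivrMr// mul1r gerBl].
apply: le_trans eE; move: b1 b2 b3; rewrite b4 !ler_norml.
move=> /andP[? ?] /andP[? ?] /andP[? ?]; apply/andP; split; lra.
Qed.

End primitive_L1.

(** * Finite energy under forcing *)

Section forced_energy.
Context {R : realType}.
Notation mu := (@lebesgue_measure R).
Implicit Types (a b c t s x y C L : R).

Lemma Rint_mul_le (f h : R -> R) L C : L1 f -> continuous h -> 0 <= C ->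
  (forall y, 0 <= y <= L -> `|h y| <= C) ->
  `|\int[mu]_(y in `[0, L]) (f y * h y)| <= l1 f * C.
Proof.
move=> fi ch C0 hC.
have i1 := integrable_norm (L1_seg L fi).
have i2 : mu.-integrable `[0, L] (EFin \o (fun y => C * `|f y|)).
  rewrite (_ : EFin \o _ = (fun y => C%:E * `|f y|%:E)%E).
    exact: (@integrableZl _ _ _ mu _ (measurable_itv _) C _ i1).
  by apply/funext => y; rewrite /= EFinM.
apply: le_trans (le_Rint_seg (L1_mul_seg L (lexx 0) fi ch) i2 _) _.
  by move=> y yL; rewrite normrM mulrC; apply: ler_wpM2r => //; exact: hC.
rewrite RintegralZl// mulrC; apply: ler_wpM2r => //; exact: seg_l1_le.
Qed.

Variables k alpha : R.
Hypothesis k0 : 0 < k.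
Variables M m : R -> R -> R.
Hypothesis nM : nice M.
Hypothesis nm : nice m.
Hypothesis dM : forall t y, is_derive t 1 (M ^~ y) (m t y).
Hypothesis M0 : forall y, M 0 y = 0.
Variables (T D : R) (beta : R -> R) (F : R -> R -> R).
Hypothesis T0 : 0 <= T.
Hypothesis FL1 : forall t, 0 <= t <= T -> L1 (F t).
Hypothesis Fbdd : forall t, 0 <= t <= T -> l1 (F t) <= D.
Hypothesis betabdd : forall t, 0 <= t <= T -> `|beta t| <= D.
Hypothesis mE : forall t x, 0 <= t <= T -> 0 <= x ->
  m t x = alpha * sol k M t x + beta t * expR (- k * x) + pL1 (F t) x.

Lemma energy0 L : 0 <= L -> energy k M 0 L = 0.
Proof.
move=> L0; have M0E : M 0 = (fun=> 0) by apply/funext => y; rewrite M0.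
have Z c : prim (fun y => expR (c * y) * (0 : R)) = (fun=> 0).
  apply/funext => x; rewrite -[RHS](mul0r (prim (fun y => expR (c * y)) x)).
  rewrite -primZ; last exact: cont_exp.
  by congr prim; apply/funext => y; rewrite mulr0 mul0r.
have LZ : Lap k (fun=> 0 : R) = 0.
  have -> : (fun _ : R => 0 : R) = (fun y => 0 * 1) by apply/funext => y; rewrite mul0r.
  by rewrite LapZ ?mul0r//; [exact: cst_continuous|exists 1 => y _; rewrite normr1].
have KZ x : Kk k (fun=> 0) x = 0.
  by rewrite /Kk /Pk /Qk !Z LZ; ring.
have RZ x : Rk k (fun=> 0) x = 0.
  by rewrite /Rk /Pk /Qk !Z LZ; ring.
rewrite /energy (@prim_ext R _ (fun=> 0) L L0); last first.
  by move=> x _; rewrite /sol /sol_x M0E KZ RZ addr0 mulr0 mul0r expr0n addr0.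
by have := Z 0; under eq_fun do rewrite mulr0; move=> ->.
Qed.

(** The work of each part of [m] is bounded uniformly in [L]: [alpha sol sol_x] is exact, [e^(-k x)]
    is integrable against the bounded [sol_x], and for the primitive of [F t] an integration by
    parts leaves the [L^1] function [F t] against the bounded [sol]. The summands of [K] below
    follow this order, after the boundary term [C * C]. *)
Lemma forced_energy_bdd : exists B, forall L, 0 <= L -> energy k M T L <= B.
Proof.
have [C hC] := sol_le k0 nM nm T.
have C0 : 0 <= C.
  have [+ _ _ _ _] := hC 0 0 (ltac:(by rewrite normr0)) (lexx 0).
  by apply: le_trans.
have D0 : 0 <= D.
  by apply: le_trans (Fbdd (t := 0) _); [exact: l1_ge0|rewrite lexx].
pose K := 2 * (C * C + (`|alpha| / 2 * (C * C) + D * (C / k) + (C * D + D * C))).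
exists (K * T) => L L0.
have := @lip_der R (energy k M ^~ L)
  (fun t => 2 * (sol k M t L * Rk k (m t) L + prim (fun x => sol_x k M t x * m t x) L))
  K 0 T T0.
rewrite /= energy0// !subr0 => H; apply: le_trans (ler_norm _) _; apply: H.
  by move=> t _; exact: der_energy.
move=> t tT; have [t0 tT'] := andP tT.
have tT1 : `|t| <= T by rewrite ger0_norm.
have [u1 u2 _ u4 _] := hC t L tT1 L0.
rewrite normrM (@ger0_norm _ 2)// ler_pM2l//.
apply: le_trans (ler_normD _ _) _; apply: lerD; first exact: normM_le.
have cU := @cont_sol R k M nM t; have cUx := @cont_sol_x R k M nM t.
have cF := cont_pL1 (FL1 tT); have ce := @cont_exp R (- k).
have -> : prim (fun x => sol_x k M t x * m t x) L =
   alpha / 2 * sol k M t L ^+ 2 +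
   beta t * prim (fun x => sol_x k M t x * expR (- k * x)) L +
   prim (fun x => sol_x k M t x * pL1 (F t) x) L.
  have d x : is_derive x 1 (fun x => alpha / 2 * sol k M t x ^+ 2)
      (alpha * (sol k M t x * sol_x k M t x)).
    apply: (is_derive_eq (derZ _ (der_sqr (der_sol_x k nM t x)))).
    by field.
  have c1 : continuous (fun x => alpha * (sol k M t x * sol_x k M t x)).
    by apply: contZ; exact: contM.
  have c2 : continuous (fun x => sol_x k M t x * expR (- k * x)) by exact: contM.
  have c3 : continuous (fun x => sol_x k M t x * pL1 (F t) x) by exact: contM.
  have <- : prim (fun x => alpha * (sol k M t x * sol_x k M t x)) L =
      alpha / 2 * sol k M t L ^+ 2.
    by rewrite (prim_der c1 d) sol0 expr0n mulr0 subr0.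
  rewrite -primZ// -primD//; last exact: contZ.
  rewrite -primD//; last by apply: contD => //; exact: contZ.
  by apply: prim_ext => // x /andP[x0 _]; rewrite mE//; ring.
apply: le_trans (ler_normD _ _) _; apply: lerD.
  apply: le_trans (ler_normD _ _) _; apply: lerD.
    rewrite normrM normrM (@ger0_norm _ (2^-1)) ?invr_ge0//.
    by apply: ler_wpM2l; [rewrite divr_ge0|exact: normM_le].
  rewrite normrM; apply: ler_pM => //; first exact: betabdd.
  have := @mvt_le R (prim (fun x => sol_x k M t x * expR (- k * x)))
    (fun x => - (C / k) * expR (- k * x)) (fun x => sol_x k M t x * expR (- k * x))
    (fun x => C * expR (- k * x)) 0 L L0.
  rewrite prim0 subr0 mulr0 expR0 mulr1 => H1; apply: le_trans (H1 _ _ _) _.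
  - by move=> y _; apply: der_prim; exact: contM.
  - by move=> y _; apply: (is_derive_eq (derZ _ (der_exp _ _))); field; rewrite gt_eqF.
  - move=> y /andP[y0 _]; rewrite normrM (ger0_norm (expR_ge0 _)).
    apply: ler_wpM2r; first exact: expR_ge0.
    by have [_ ? _ _ _] := hC t y tT1 y0.
  - have : 0 <= C / k * expR (- k * L) by rewrite mulr_ge0 ?expR_ge0// divr_ge0// ltW.
    by rewrite mulNr opprK; lra.
have -> : prim (fun x => sol_x k M t x * pL1 (F t) x) L =
  sol k M t L * pL1 (F t) L - \int[mu]_(y in `[0, L]) (F t y * sol k M t y).
  have := pL1_by_parts L0 (FL1 tT) (der_sol_x k nM t) cUx; lra.
apply: le_trans (ler_normB _ _) _; apply: lerD.
  rewrite normrM; apply: ler_pM => //.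
  by apply: le_trans (pL1_le L (FL1 tT)) _; exact: Fbdd.
apply: le_trans (Rint_mul_le (FL1 tT) cU C0 _) _.
  by move=> y /andP[y0 _]; have [? _ _ _ _] := hC t y tT1 y0.
by apply: ler_wpM2r => //; exact: Fbdd.
Qed.

End forced_energy.

(** * Smooth cut-offs *)

Section smooth.
Context {R : realType}.
Implicit Types (f g h : R -> R) (a b c e t s x y C L : R).

Fixpoint Ck (n : nat) f : Prop :=
  continuous f /\
  (if n is n'.+1 then (forall x, derivable f x 1) /\ Ck n' (derive1 f) else True).

Definition smooth f := forall n, Ck n f.

Lemma Ck_cont n f : Ck n f -> continuous f.
Proof. by case: n => [|n] []. Qed.

Lemma Ck_der n f x : Ck n.+1 f -> is_derive x 1 f (derive1 f x).
Proof. by case=> _ [df _]; rewrite derive1E; apply: DeriveDef. Qed.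

Lemma CkS n f f' : (forall x, is_derive x 1 f (f' x)) -> Ck n f' -> Ck n.+1 f.
Proof.
move=> df cf'; split; first exact: der_continuous df.
split=> [x|]; first by have [] := df x.
by rewrite (_ : derive1 f = f')//; apply/funext => x; exact: der_derive1.
Qed.

Lemma CkW n f : Ck n.+1 f -> Ck n f.
Proof.
elim: n f => [|n ih] f; first by move=> /Ck_cont.
by move=> [cf [df /ih cf']].
Qed.

Lemma Ck_cst n c : Ck n (fun=> c).
Proof.
elim: n c => [|n ih] c; first by split => //; exact: cst_continuous.
by apply: (@CkS n _ (fun=> 0)); exact: ih.
Qed.

Lemma Ck_id n : Ck n (fun x => x).
Proof.
case: n => [|n]; first by split => // x; exact: cvg_id.
by apply: (@CkS n _ (fun=> 1)); exact: Ck_cst.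
Qed.

Lemma CkD n f g : Ck n f -> Ck n g -> Ck n (fun x => f x + g x).
Proof.
elim: n f g => [|n ih] f g cf cg.
  by split => //; apply: contD; exact: (@Ck_cont 0).
refine (@CkS n _ (fun x => derive1 f x + derive1 g x) _ _).
  by move=> x; apply: derD; exact: (@Ck_der n).
by apply: ih; [case: cf => _ []|case: cg => _ []].
Qed.

Lemma CkM n f g : Ck n f -> Ck n g -> Ck n (fun x => f x * g x).
Proof.
elim: n f g => [|n ih] f g cf cg.
  by split => //; apply: contM; exact: (@Ck_cont 0).
refine (@CkS n _ (fun x => derive1 f x * g x + f x * derive1 g x) _ _).
  by move=> x; apply: derM; exact: (@Ck_der n).
by apply: CkD; apply: ih; try exact: CkW; [case: cf => _ []|case: cg => _ []].
Qed.

Lemma CkZ n c f : Ck n f -> Ck n (fun x => c * f x).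
Proof. by move=> cf; apply: CkM => //; exact: Ck_cst. Qed.

Lemma CkV n f : (forall x, f x != 0) -> Ck n f -> Ck n (fun x => (f x)^-1).
Proof.
move=> f0; elim: n f f0 => [|n ih] f f0 cf.
  by split => // x; apply: cvgV; [exact: f0|exact: (Ck_cont cf)].
refine (@CkS n _ (fun x => - 1 * derive1 f x * ((f x)^-1 * (f x)^-1)) _ _).
  move=> x; have d := Ck_der x cf.
  have := is_deriveV (f0 x) d; move/is_derive_eq; apply.
  by rewrite /GRing.scale/=; field; exact: f0.
have ch := ih _ f0 (CkW cf).
by apply: CkM; [apply: CkZ; case: cf => _ []|exact: CkM].
Qed.

Lemma Ck_affine n f a b : Ck n f -> Ck n (fun x => f (a * x + b)).
Proof.
have d x : is_derive x 1 (fun x => a * x + b) a.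
  by apply: (is_derive_eq (derD (derZ a (der_id x)) (der_cst b x))); rewrite mulr1 addr0.
elim: n f => [|n ih] f cf.
  by split => //; apply: (cont_comp (der_continuous d)); exact: (Ck_cont cf).
refine (@CkS n _ (fun x => a * derive1 f (a * x + b)) _ _).
  move=> x; have := @is_derive1_comp R f (fun x => a * x + b) x _ _ (Ck_der (a * x + b) cf) (d x).
  by move/is_derive_eq; apply; rewrite mulrC.
by apply: CkZ; apply: ih; case: cf => _ [].
Qed.

Lemma derX n f x a : is_derive x 1 f a ->
  is_derive x 1 (fun y => f y ^+ n) (n%:R * f x ^+ n.-1 * a).
Proof.
move=> df; elim: n => [|n ih].
  by rewrite !mul0r; under eq_fun do rewrite expr0; exact: der_cst.
under eq_fun do rewrite exprS.
apply: (is_derive_eq (derM df ih)); case: n {ih} => [|n] /=.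
  by rewrite expr0; ring.
by rewrite -[n.+2%:R]natr1 exprS; ring.
Qed.

(** [flat 0] is the classical flat function; the powers of [1 / x] make the family closed under
    differentiation. *)
Definition flat (j : nat) x : R := if 0 < x then x ^- j * expR (- x^-1) else 0.

(** With [p = j + 2], [e^(1 / x)] is the [p]-th power of [e^(1 / (p x)) >= 1 / (p x)]. A quadratic
    bound is what makes the derivative at [0] vanish. *)
Lemma flat_le j x : `|flat j x| <= (j.+2%:R ^+ j.+2) * x ^+ 2.
Proof.
rewrite /flat; case: ifPn => x0; last first.
  by rewrite normr0 mulr_ge0// ?sqr_ge0// exprn_ge0.
rewrite ger0_norm; last by rewrite mulr_ge0 ?expR_ge0// invr_ge0 exprn_ge0// ltW.
pose p : R := j.+2%:R.
have p0 : 0 < p by rewrite ltr0n.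
have e1 : (x^-1 / p) ^+ j.+2 <= expR (x^-1).
  have -> : expR (x^-1) = expR (x^-1 / p) ^+ j.+2.
    by rewrite -expRM_natl; congr expR; field; rewrite !gt_eqF.
  have h0 : 0 <= x^-1 / p by rewrite divr_ge0 ?invr_ge0 ?ltW.
  apply: lerXn2r; rewrite ?nnegrE ?expR_ge0//.
  by apply: le_trans (expR_ge1Dx _); rewrite lerDr.
rewrite expRN -/p.
have xp : 0 < (x^-1 / p) ^+ j.+2 by rewrite exprn_gt0// divr_gt0 ?invr_gt0.
apply: (@le_trans _ _ (x ^- j * ((x^-1 / p) ^+ j.+2)^-1)).
  apply: ler_wpM2l; first by rewrite invr_ge0 exprn_ge0// ltW.
  by rewrite lef_pV2 ?posrE// expR_gt0.
rewrite exprMn !exprVn invfM !invrK mulrA mulrC.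
have -> : x ^- j * x ^+ j.+2 = x ^+ 2.
  by rewrite -addn2 exprD mulrA mulVf ?mul1r// expf_neq0// gt_eqF.
by [].
Qed.

Lemma der_flat j x : is_derive x 1 (flat j) (flat j.+2 x - j%:R * flat j.+1 x).
Proof.
have [x0|x0|->] := ltgtP x 0.
- have <- : (0 : R) = flat j.+2 x - j%:R * flat j.+1 x.
    by rewrite /flat ltNge (ltW x0)/= mulr0 subr0.
  apply: near_der (der_cst 0 x); near=> y.
  have y0 : y < 0 by near: y; exact: lt_nbhsl.
  by rewrite /flat ltNge (ltW y0).
- have d1 : is_derive x 1 (fun y : R => y^-1) (- x ^- 2).
    have := is_deriveV (lt0r_neq0 x0) (der_id x); move/is_derive_eq; apply.
    by rewrite /GRing.scale/= mulr1.
  have d2 : is_derive x 1 (fun y : R => y ^- j) (- j%:R * x ^- j.+1).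
    have -> : (fun y : R => y ^- j) = (fun y => (y^-1) ^+ j).
      by apply/funext => y; rewrite exprVn.
    apply: (is_derive_eq (derX j d1)); rewrite -!exprVn.
    by case: j => [|j]; rewrite /= ?mul0r ?oppr0 ?mul0r// !exprS; ring.
  have d3 := @is_derive1_comp R expR (fun y => - y^-1) x _ _ (is_derive_expR (- x^-1)) (derN d1).
  apply: near_der (is_derive_eq (derM d2 d3) _).
    near=> y; have y0 : 0 < y by near: y; exact: lt_nbhsr.
    by rewrite /flat y0.
  by rewrite /flat x0 /= -!exprVn !exprS expr0; ring.
- have -> : flat j.+2 0 - j%:R * flat j.+1 0 = 0 by rewrite /flat ltxx mulr0 subr0.
  have f0 : flat j 0 = 0 by rewrite /flat ltxx.
  have h : h^-1 *: (flat j (h *: 1 + 0) - flat j 0) @[h --> 0^'] --> (0 : R).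
    apply/cvgrPdist_le => e e0.
    pose p : R := j.+2%:R ^+ j.+2.
    have p0 : 0 < p by rewrite exprn_gt0.
    near=> h.
    have h0 : h != 0 by near: h; exact: nbhs_dnbhs_neq.
    rewrite sub0r normrN f0 subr0 /GRing.scale/= mulr1 addr0 normrM.
    apply: (@le_trans _ _ (`|h^-1| * (p * h ^+ 2))).
      by apply: ler_wpM2l => //; exact: flat_le.
    rewrite normfV -[h ^+ 2]real_normK ?num_real// expr2 mulrCA mulrA.
    have -> : p / `|h| * (`|h| * `|h|) = `|h| * p by field; rewrite normr_eq0.
    rewrite -ler_pdivlMr//.
    by near: h; apply: dnbhs0_le; rewrite divr_gt0.
  split; first by apply/cvg_ex; exists 0.
  exact: (cvg_lim _ h).
Unshelve. all: by end_near. Qed.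

Lemma smooth_flat j : smooth (flat j).
Proof.
move=> n; elim: n j => [|n ih] j.
  by split => //; exact: (der_continuous (der_flat j)).
apply: (CkS (der_flat j)); apply: CkD => //.
under eq_fun do rewrite -mulNr.
exact: CkZ.
Qed.

(* Equal to [0] for [x <= 0] and to [x] for [x >= 1]; its second derivative
   [bump] therefore has integral [1]. *)
Definition ramp x : R := x * (flat 0 x / (flat 0 x + flat 0 (1 - x))).

Lemma flat0_ge0 x : 0 <= flat 0 x.
Proof. by rewrite /flat; case: ifP => // _; rewrite expr0 invr1 mul1r expR_ge0. Qed.

Lemma flat0_gt0 x : 0 < x -> 0 < flat 0 x.
Proof. by move=> x0; rewrite /flat x0 expr0 invr1 mul1r expR_gt0. Qed.

Lemma smooth_ramp : smooth ramp.
Proof.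
move=> n; apply: CkM; first exact: Ck_id.
have f1 : Ck n (fun x => flat 0 (1 - x)).
  have := @Ck_affine n (flat 0) (-1) 1 (@smooth_flat 0 n).
  by under eq_fun do rewrite mulN1r addrC.
apply: CkM; first exact: smooth_flat.
apply: CkV; last by apply: CkD => //; exact: smooth_flat.
(* At least one of [x] and [1 - x] is positive, so the denominator never vanishes. *)
move=> x; rewrite gt_eqF//; have [x0|x0] := ltP 0 x.
  by rewrite ltr_wpDr ?flat0_ge0// flat0_gt0.
by rewrite ltr_wpDl ?flat0_ge0// flat0_gt0//; lra.
Qed.

Lemma ramp_le0 x : x <= 0 -> ramp x = 0.
Proof. by move=> x0; rewrite /ramp {1}/flat ltNge x0/= mul0r mulr0. Qed.

Lemma ramp_ge1 x : 1 <= x -> ramp x = x.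
Proof.
move=> x1; rewrite /ramp.
have -> : flat 0 (1 - x) = 0 by rewrite /flat subr_gt0 ltNge x1.
by rewrite addr0 divff ?mulr1// gt_eqF// flat0_gt0//; lra.
Qed.

Definition step := derive1 ramp.
Definition bump := derive1 step.

Lemma smooth_derive1 f : smooth f -> smooth (derive1 f).
Proof. by move=> sf n; have [_ []] := sf n.+1. Qed.

Lemma smooth_step : smooth step.
Proof. exact: smooth_derive1 smooth_ramp. Qed.

Lemma smooth_bump : smooth bump.
Proof. exact: smooth_derive1 smooth_step. Qed.

Lemma der_ramp x : is_derive x 1 ramp (step x).
Proof. exact: Ck_der (@smooth_ramp 1%N). Qed.

Lemma der_step x : is_derive x 1 step (bump x).
Proof. exact: Ck_der (@smooth_step 1%N). Qed.

Lemma cont_bump : continuous bump.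
Proof. exact: Ck_cont (@smooth_bump 0%N). Qed.

Lemma cont_step : continuous step.
Proof. exact: Ck_cont (@smooth_step 0%N). Qed.

Lemma closed_eq_left f c a : continuous f -> (forall x, x < a -> f x = c) -> f a = c.
Proof.
move=> cf fc; apply/eqP; rewrite -subr_eq0 -normr_le0; apply/ler_addgt0Pr => e e0.
have /cvgrPdist_le /(_ e e0) h := cvg_at_left_filter (cf a).
near a^'- => x.
have xa : x < a by near: x; exact: nbhs_left_lt.
by rewrite add0r -(fc x xa); near: x.
Unshelve. all: by end_near. Qed.

Lemma closed_eq_right f c a : continuous f -> (forall x, a < x -> f x = c) -> f a = c.
Proof.
move=> cf fc; rewrite -(opprK a).
apply: (@closed_eq_left (fun x => f (- x))); first exact: cont_comp cont_opp cf.
by move=> x xa; apply: fc; rewrite ltrNr.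
Qed.

Lemma near_cst_der f a c x : (\near x, f x = c) -> is_derive x 1 f a -> a = 0.
Proof.
move=> fc df.
have := @near_der R f (fun=> c) x a fc df => /der_derive1 <-.
exact: (der_derive1 (der_cst c x)).
Qed.

Lemma step_le0 x : x <= 0 -> step x = 0.
Proof.
have lt0 y : y < 0 -> step y = 0.
  move=> y0; apply: (@near_cst_der ramp _ 0 y _ (der_ramp y)); near=> z.
  by apply: ramp_le0; apply/ltW; near: z; exact: lt_nbhsl.
rewrite le_eqVlt => /predU1P[->|]; last exact: lt0.
by apply: closed_eq_left lt0; exact: cont_step.
Unshelve. all: by end_near. Qed.

Lemma step_ge1 x : 1 <= x -> step x = 1.
Proof.
have gt1 y : 1 < y -> step y = 1.
  move=> y1; apply/eqP; rewrite -subr_eq0; apply/eqP.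
  apply: (@near_cst_der (fun z => ramp z - z) _ 0 y); last first.
    exact: derB (der_ramp y) (der_id y).
  near=> z; rewrite ramp_ge1 ?subrr//; apply/ltW; near: z; exact: lt_nbhsr.
rewrite le_eqVlt => /predU1P[<-|]; last exact: gt1.
by apply: closed_eq_right gt1; exact: cont_step.
Unshelve. all: by end_near. Qed.

Lemma bump_le0 x : x <= 0 -> bump x = 0.
Proof.
have lt0 y : y < 0 -> bump y = 0.
  move=> y0; apply: (@near_cst_der step _ 0 y _ (der_step y)); near=> z.
  by apply: step_le0; apply/ltW; near: z; exact: lt_nbhsl.
rewrite le_eqVlt => /predU1P[->|]; last exact: lt0.
by apply: closed_eq_left lt0; exact: cont_bump.
Unshelve. all: by end_near. Qed.

Lemma bump_ge1 x : 1 <= x -> bump x = 0.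
Proof.
have gt1 y : 1 < y -> bump y = 0.
  move=> y1; apply: (@near_cst_der step _ 1 y _ (der_step y)); near=> z.
  by apply: step_ge1; apply/ltW; near: z; exact: lt_nbhsr.
rewrite le_eqVlt => /predU1P[<-|]; last exact: gt1.
by apply: closed_eq_right gt1; exact: cont_bump.
Unshelve. all: by end_near. Qed.

Lemma der_scaled f f' e c x : (forall y, is_derive y 1 f (f' y)) ->
  is_derive x 1 (fun y => f ((y - c) / e)) (f' ((x - c) / e) / e).
Proof.
move=> df.
have d : is_derive x 1 (fun y => (y - c) / e) (e^-1).
  apply: (is_derive_eq (derM (derB (der_id x) (der_cst c x)) (der_cst e^-1 x))).
  by rewrite subr0 mul1r mulr0 addr0.
exact: (@is_derive1_comp R f (fun y => (y - c) / e) x _ _ (df ((x - c) / e)) d).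
Qed.

Lemma smooth_scaled f e c : smooth f -> smooth (fun y => f ((y - c) / e)).
Proof.
move=> sf n; have := @Ck_affine n f e^-1 (- c / e) (sf n).
by congr Ck; apply/funext => y; congr f; ring.
Qed.

(** The scaled bump has mass [1] on [[c, c + e]] but changes sign, so a bound [A] of [|bump|] stands
    where a positive kernel would give [1]. The support lies to the right of [c], which suits the
    half-line. *)
Lemma bump_approx : exists2 A, 0 <= A & forall h c e d L, continuous h -> 0 <= c -> 0 < e ->
  c + e <= L -> (forall y, c <= y <= c + e -> `|h y - h c| <= d) ->
  `|prim (fun y => bump ((y - c) / e) / e * h y) L - h c| <= A * d.
Proof.
have [A0 hA0] := @cont_bounded_seg R bump 0 1 cont_bump.
exists (Num.max A0 0); first by rewrite le_max lexx orbT.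
set A := Num.max _ _.
have hA y : `|bump y| <= A.
  have [y0|y0] := leP y 0; first by rewrite bump_le0// normr0 le_max lexx orbT.
  have [y1|y1] := leP 1 y; first by rewrite bump_ge1// normr0 le_max lexx orbT.
  by rewrite le_max hA0// !ltW.
move=> h c e d L ch c0 e0 ceL hd.
have ce : c <= c + e by rewrite lerDl ltW.
have cL : c <= L by exact: le_trans ceL.
have L0 : 0 <= L by exact: le_trans cL.
have cb : continuous (fun y => bump ((y - c) / e) / e).
  exact: (Ck_cont (n := 0%N) (CkM (@smooth_scaled bump e c smooth_bump 0%N) (Ck_cst 0 e^-1))).
have ds x : is_derive x 1 (fun y => step ((y - c) / e)) (bump ((x - c) / e) / e).
  exact: der_scaled der_step.
have mass : prim (fun y => bump ((y - c) / e) / e) L = 1.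
  rewrite (prim_der cb ds) step_ge1; last by rewrite ler_pdivlMr//; lra.
  rewrite step_le0 ?subr0//.
  by rewrite sub0r mulNr oppr_le0 divr_ge0// ltW.
pose F y := bump ((y - c) / e) / e * (h y - h c).
have cF : continuous F.
  by apply: contM => //; apply: contB => //; exact: cst_continuous.
have -> : prim (fun y => bump ((y - c) / e) / e * h y) L - h c = prim F L.
  rewrite -[X in _ - X]mulr1 -mass -primZ// -primB; last 2 first.
  - exact: contM.
  - exact: contZ.
  by congr prim; apply/funext => y; rewrite /F; ring.
have z a b : a <= b -> (forall y, a <= y <= b -> F y = 0) -> prim F b = prim F a.
  move=> ab F0; apply/eqP; rewrite -subr_eq0 -normr_le0.
  have := @lip_der R (prim F) F 0 a b ab; rewrite mul0r; apply.
    by move=> y _; exact: der_prim.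
  by move=> y /F0 ->; rewrite normr0.
rewrite (z (c + e) L ceL); last first.
  move=> y /andP[y1 _]; rewrite /F bump_ge1 ?mul0r//.
  by rewrite ler_pdivlMr//; lra.
rewrite -[prim F (c + e)]subr0 -[X in _ - X](prim0 F) -(z 0 c c0); last first.
  move=> y /andP[_ y1]; rewrite /F bump_le0 ?mul0r//.
  by rewrite ler_pdivrMr// mul0r subr_le0.
have := @lip_der R (prim F) F (A / e * d) c (c + e) ce.
have -> : A / e * d * (c + e - c) = A * d by field; rewrite gt_eqF.
apply; first by move=> y _; exact: der_prim.
move=> y yce; rewrite /F normrM; apply: ler_pM => //; last exact: hd.
rewrite normrM normfV (gtr0_norm e0); apply: ler_wpM2r => //.
by rewrite invr_ge0 ltW.
Qed.

End smooth.

(** * Curves in [C_b] and in [L^1] *)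

Section curves.
Context {R : realType}.
Notation mu := (@lebesgue_measure R).
Implicit Types (h : R -> R) (v : R -> R -> R) (a b c e t s x y C L T : R).

Definition pos x : R := Num.max x 0.

Lemma pos_ge0 x : 0 <= pos x.
Proof. by rewrite le_max lexx orbT. Qed.

Lemma pos_id x : 0 <= x -> pos x = x.
Proof. by move=> x0; exact: max_l. Qed.

Lemma pos_lip x y : `|pos x - pos y| <= `|x - y|.
Proof.
rewrite /pos; have [x0|x0] := leP x 0; have [y0|y0] := leP y 0.
- by rewrite subrr normr0.
- rewrite sub0r normrN distrC [leRHS]ger0_norm; last lra.
  by rewrite ger0_norm; lra.
- rewrite subr0 [leRHS]ger0_norm; last lra.
  by rewrite ger0_norm; lra.
- by [].
Qed.

Lemma cont_pos : continuous pos.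
Proof. exact: cont_max0. Qed.

Lemma near_hlP t (P : R -> Prop) : 0 <= t ->
  (\forall s \near within (@halfline R) (nbhs t), P s) ->
  exists2 d, 0 < d & forall s, 0 <= s -> `|s - t| < d -> P s.
Proof.
move=> t0; rewrite near_withinE => /nbhs_ballP[d /= d0 hd]; exists d => // s s0 st.
by apply: hd; [rewrite /ball/= distrC|exact/halflineE].
Qed.

Lemma cont_within_pos h : {within @halfline R, continuous h} ->
  continuous (fun x => h (pos x)).
Proof.
move=> /continuous_within_itvcyP[ch ch0] x; apply/cvgrPdist_le => e e0.
have [x0|x0|x0] := ltgtP x 0.
- near=> y; have y0 : y < 0 by near: y; exact: lt_nbhsl.
  by rewrite /pos !max_r ?subrr ?normr0 ?ltW.
- have /cvgrPdist_le /(_ e e0) hx : {for x, continuous h}.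
    by apply: ch; rewrite in_itv/= x0.
  near=> y; have y0 : 0 < y by near: y; exact: lt_nbhsr.
  by rewrite !pos_id ?(ltW x0) ?(ltW y0)//; near: y.
- move/cvgrPdist_le : ch0 => /(_ e e0) /nbhs_ballP[d /= d0 hd].
  rewrite x0 pos_id//; near=> y; have [y0|y0] := leP y 0.
    by rewrite /pos max_r// subrr normr0 ltW.
  rewrite (pos_id (ltW y0)); apply: hd => //.
  by near: y; apply/nbhs_ballP; exists d.
Unshelve. all: by end_near. Qed.

Lemma C_Cb_unif v t e : C_Cb v -> 0 <= t -> 0 < e -> exists2 d, 0 < d &
  forall s x, 0 <= s -> `|s - t| < d -> 0 <= x -> `|v x s - v x t| <= e.
Proof.
move=> [_ vu] t0 e0.
have := vu t t0 [set h | forall y, halfline y -> ball (v y t) e (h y)].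
have nb : nbhs ((v ^~ t) : {uniform` @halfline R -> R})
    [set h | forall y, halfline y -> ball (v y t) e (h y)].
  apply/uniform_nbhs; exists [set xy | ball xy.1 e xy.2]; split => //.
  exact: (entourage_ball _ (PosNum e0)).
move=> /(_ nb) /(near_hlP t0)[d d0 hd]; exists d => // s x s0 st x0.
have /= := hd s s0 st x; rewrite /ball/= distrC => /(_ _)/ltW; apply.
exact/halflineE.
Qed.

Lemma C_Cb_bdd v t : C_Cb v -> 0 <= t -> exists C, forall x, 0 <= x -> `|v x t| <= C.
Proof.
move=> [vb _] t0; have [_ [C [_ hC]] _] := vb t t0.
by exists (C + 1) => x x0; apply: (hC (C + 1)); [rewrite ltrDl|exact/halflineE].
Qed.

(** Compactness of [[0, T]] through the supremum [z] of the times up to which one bound holds: a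
    neighbourhood of [z] carries the bound past [z], unless it already reaches [T]. The predicate
    [B] is abstract so as to cover both sup norms and [L^1] norms. *)
Lemma locally_bounded T (B : R -> R -> Prop) : 0 <= T ->
  (forall t C C', B t C -> C <= C' -> B t C') ->
  (forall t, 0 <= t <= T -> exists C, exists2 d, 0 < d & forall s, 0 <= s <= T ->
     `|s - t| < d -> B s C) ->
  exists C, forall t, 0 <= t <= T -> B t C.
Proof.
move=> T0 Bmono Bloc.
pose good x := exists C, forall s, 0 <= s <= T -> s <= x -> B s C.
pose S := [set x | 0 <= x <= T /\ good x].
have S0 : S 0.
  split; first by rewrite lexx.
  have [C [d d0 hd]] := Bloc 0 (ltac:(by rewrite lexx)).
  exists C => s /andP[s0 sT] s0'; have -> : s = 0 by lra.
  by apply: hd; rewrite ?lexx ?subrr ?normr0.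
have supS : has_sup S.
  by split; [exists 0|exists T => x [/andP[]]].
pose z := sup S.
have z0 : 0 <= z by apply: sup_upper_bound.
have zT : z <= T by apply: ge_sup => [|x [/andP[]//]]; exists 0.
have [C [d d0 hd]] := Bloc z (ltac:(by rewrite z0 zT)).
have [x [xS [C1 hC1]] zx] := sup_adherent d0 supS.
have gz : forall s, 0 <= s <= T -> s < z + d -> B s (Num.max C C1).
  move=> s sT sz; have [sx|xs] := leP s x.
    by apply: Bmono (hC1 s sT sx) _; rewrite le_max lexx orbT.
  apply: (@Bmono _ C); last by rewrite le_max lexx.
  by apply: hd => //; rewrite ltr_norml; move: zx sz xs; rewrite -/z; lra.
have [zdT|Tzd] := ltP T (z + d).
  by exists (Num.max C C1) => t /[dup] /andP[_ tT] /gz; apply; exact: le_lt_trans zdT.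
have : S (z + d / 2).
  split; first by apply/andP; split; lra.
  by exists (Num.max C C1) => s sT sz; apply: gz => //; lra.
move=> /(sup_upper_bound supS); rewrite -/z; lra.
Qed.

Lemma C_Cb_bdd_loc v T : C_Cb v -> 0 <= T -> exists C, forall t x, 0 <= t <= T ->
  0 <= x -> `|v x t| <= C.
Proof.
move=> vC T0.
have [||C hC] := @locally_bounded T (fun t C => forall x, 0 <= x -> `|v x t| <= C) T0.
- by move=> t C C' h CC' x /h; move/le_trans; apply.
- move=> t /andP[t0 _]; have [C hC] := C_Cb_bdd vC t0.
  have [d d0 hd] := C_Cb_unif vC t0 ltr01.
  exists (C + 1), d => // s /andP[s0 _] st x x0.
  have := hd s x s0 st x0; have := hC x x0.
  have := ler_distD (v x t) (v x s) 0; rewrite !subr0; lra.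
by exists C => t x tT x0; exact: hC.
Qed.

(** Constant continuation to negative [x] and [t] turns continuity within half-lines into continuity
    on [R]. Time becomes the first argument. *)
Definition extend v t x : R := v (pos x) (pos t).

Lemma nice_extend v : C_Cb v -> nice (extend v).
Proof.
move=> vC; split.
- move=> t; apply: (@cont_within_pos (v ^~ (pos t))).
  by have [vb _] := vC; have [] := vb (pos t) (pos_ge0 t).
- move=> x t; apply/cvgrPdist_le => e e0.
  have [d d0 hd] := C_Cb_unif vC (pos_ge0 t) e0.
  near=> s; rewrite /extend distrC; apply: hd => //; try exact: pos_ge0.
  apply: le_lt_trans (pos_lip _ _) _; rewrite distrC.
  by near: s; apply/nbhs_ballP; exists d.
- move=> T; have [C hC] := C_Cb_bdd_loc vC (normr_ge0 T).
  exists C => t x tT; apply: hC; last exact: pos_ge0.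
  rewrite pos_ge0/=; apply: le_trans (ler_norm T); rewrite /pos ge_max.
  by rewrite (le_trans (ler_norm t) tT) (le_trans (normr_ge0 t) tT).
Unshelve. all: by end_near. Qed.

Lemma C_L1_unif v t e : C_L1 v -> 0 <= t -> 0 < e -> exists2 d, 0 < d &
  forall s, 0 <= s -> `|s - t| < d -> l1 (fun x => v x s - v x t) <= e.
Proof.
move=> [_ vu] t0 e0.
have /fine_cvg /cvgrPdist_le /(_ e e0) := vu t t0.
move=> /(near_hlP t0)[d d0 hd]; exists d => // s s0 st.
have := hd s s0 st; rewrite sub0r normrN; apply: le_trans; exact: ler_norm.
Qed.

Lemma l1_triangle (f g : R -> R) : L1 f -> L1 g -> l1 g <= l1 f + l1 (fun x => g x - f x).
Proof.
move=> fi gi; have fgi := L1B gi fi.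
rewrite /l1 -RintegralD; [|exact: measurable_hl|exact: L1_norm..].
apply: le_Rintegral.
- exact: measurable_hl.
- exact: L1_norm.
- rewrite (_ : EFin \o _ = (fun x => `|f x|%:E + `|g x - f x|%:E)%E).
    by apply: integrableD; [exact: measurable_hl|exact: L1_norm|exact: (L1_norm fgi)].
  by apply/funext => x; rewrite /= EFinD.
- by move=> x _; have := ler_distD (f x) (g x) 0; rewrite !subr0; lra.
Qed.

Lemma C_L1_bdd_loc v T : C_L1 v -> 0 <= T -> exists C, forall t, 0 <= t <= T ->
  l1 (v ^~ t) <= C.
Proof.
move=> vC T0; have [vL _] := vC.
apply: (@locally_bounded T (fun t C => l1 (v ^~ t) <= C) T0).
- by move=> t C C' h; exact: le_trans.
- move=> t /andP[t0 _]; have [d d0 hd] := C_L1_unif vC t0 ltr01.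
  exists (l1 (v ^~ t) + 1), d => // s /andP[s0 _] st.
  apply: le_trans (l1_triangle (vL t t0) (vL s s0)) _.
  by rewrite lerD2l; exact: hd.
Qed.

Definition pL1_extend v t x : R := pL1 (v ^~ (pos t)) x.

Lemma nice_pL1_extend v : C_L1 v -> nice (pL1_extend v).
Proof.
move=> vC; have [vL _] := vC; split.
- by move=> t; apply: cont_pL1; apply: vL; exact: pos_ge0.
- move=> x t; apply/cvgrPdist_le => e e0.
  have [d d0 hd] := C_L1_unif vC (pos_ge0 t) e0.
  near=> s; rewrite /pL1_extend distrC -pL1B; [|exact/vL/pos_ge0..].
  apply: le_trans (pL1_le _ _) _; first by apply: L1B; exact/vL/pos_ge0.
  apply: hd; first exact: pos_ge0.
  apply: le_lt_trans (pos_lip _ _) _; rewrite distrC.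
  by near: s; apply/nbhs_ballP; exists d.
- move=> T; have [C hC] := C_L1_bdd_loc vC (normr_ge0 T).
  exists C => t x tT; apply: le_trans (pL1_le _ _) _; first exact/vL/pos_ge0.
  apply: hC; rewrite pos_ge0/=; apply: le_trans (ler_norm T); rewrite /pos ge_max.
  by rewrite (le_trans (ler_norm t) tT) (le_trans (normr_ge0 t) tT).
Unshelve. all: by end_near. Qed.

End curves.

(** * From the weak form to an integrated equation *)

Section tests.
Context {R : realType}.
Notation mu := (@lebesgue_measure R).
Implicit Types (X Th h : R -> R) (a b c e t s x y C L T : R).

Lemma d_x_tensor X Th : (forall x, derivable X x 1) ->
  d_x (fun x t => X x * Th t) = (fun x t => derive1 X x * Th t).
Proof.
move=> dX; apply/funext => x; apply/funext => t; rewrite /d_x.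
apply: der_derive1.
have d : is_derive x 1 X (derive1 X x) by rewrite derive1E; exact: DeriveDef.
by apply: (is_derive_eq (derM d (der_cst (Th t) x))); rewrite mulr0 addr0.
Qed.

Lemma d_t_tensor X Th : (forall t, derivable Th t 1) ->
  d_t (fun x t => X x * Th t) = (fun x t => X x * derive1 Th t).
Proof.
move=> dT; apply/funext => x; apply/funext => t; rewrite /d_t.
apply: der_derive1; apply: derZ; rewrite derive1E; exact: DeriveDef.
Qed.

Lemma Ck2_tensor n X Th : Ck n X -> Ck n Th -> Ck2 n (fun x t => X x * Th t).
Proof.
elim: n X Th => [|n ih] X Th cX cT.
  split => // p; apply: cvgM.
    apply: (@continuous_comp _ _ _ (fun p : R * R => p.1) X); first exact: cvg_fst.
    exact: (Ck_cont cX).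
  apply: (@continuous_comp _ _ _ (fun p : R * R => p.2) Th); first exact: cvg_snd.
  exact: (Ck_cont cT).
have [_ [dX cX']] := cX; have [_ [dT cT']] := cT.
split.
  move=> p; apply: cvgM.
    apply: (@continuous_comp _ _ _ (fun p : R * R => p.1) X); first exact: cvg_fst.
    exact: (Ck_cont cX).
  apply: (@continuous_comp _ _ _ (fun p : R * R => p.2) Th); first exact: cvg_snd.
  exact: (Ck_cont cT).
split.
- move=> x t; have := derM (Ck_der x cX) (der_cst (Th t) x).
  by case.
- move=> x t; have := derZ (X x) (Ck_der t cT).
  by case.
- by rewrite d_x_tensor//; apply: ih => //; exact: CkW.
- by rewrite d_t_tensor//; apply: ih => //; exact: CkW.
Qed.

Lemma closed_seg2 a L c T :
  closed [set p : R * R | (a <= p.1 <= L) /\ (c <= p.2 <= T)].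
Proof.
have -> : [set p : R * R | (a <= p.1 <= L) /\ (c <= p.2 <= T)] =
  (fst @^-1` `[a, L]) `&` (snd @^-1` `[c, T]).
  by apply/seteqP; split => p /=; rewrite !in_itv.
apply: closedI; apply: preimage_closed.
- by move=> p _; exact: cvg_fst.
- exact: itv_closed.
- by move=> p _; exact: cvg_snd.
- exact: itv_closed.
Qed.

Lemma test_tensor X Th a L c T : smooth X -> smooth Th -> 0 < a -> 0 < c ->
  (forall x, X x != 0 -> a <= x <= L) -> (forall t, Th t != 0 -> c <= t <= T) ->
  test_function (fun x t => X x * Th t).
Proof.
move=> sX sT a0 c0 hX hT.
have sub : support2 (fun x t => X x * Th t) `<=`
    [set p : R * R | (a <= p.1 <= L) /\ (c <= p.2 <= T)].
  have cS := (closure_id _).1 (@closed_seg2 a L c T).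
  rewrite /support2 [X in _ `<=` X]cS.
  apply: closure_subset => p /=; rewrite mulf_eq0 negb_or => /andP[h1 h2].
  by split; [exact: hX|exact: hT].
split.
- by move=> n; apply: Ck2_tensor.
- apply: (@subclosed_compact _ _ (`[a, L] `*` `[c, T])).
  + exact: closed_closure.
  + by apply: compact_setX; exact: segment_compact.
  + by move=> p /sub[h1 h2]; split => /=; rewrite in_itv.
- move=> p /sub[/andP[h1 _] /andP[h2 _]].
  by split; [exact: lt_le_trans h1|exact: lt_le_trans h2].
Qed.

Lemma hl_support h L : (forall x, L < x -> h x = 0) ->
  \int[mu]_(x in @halfline R) h x = \int[mu]_(x in `[0, L]) h x.
Proof.
move=> hL; rewrite Rintegral_mkcond [RHS]Rintegral_mkcond.
congr (Rintegral _ _ _); apply/funext => x; rewrite !patchE.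
case: ifPn => [|xn]; rewrite ?inE.
  move=> /halflineE x0; case: ifPn => // xn; apply: hL.
  by rewrite ltNge; apply: contra xn => xL; rewrite inE/= in_itv/= x0.
rewrite ifF//; apply: contraNF xn; rewrite !inE/= in_itv/= => /andP[x0 _].
exact/halflineE.
Qed.

Variables (alpha gamma : R) (f u : R -> R -> R).
Hypothesis uC : C_Cb u.
Hypothesis fC : C_L1 f.
Hypothesis uf : pde_weak alpha gamma f u.

Let ub := extend u.
Let mm t x : R := alpha * ub t x - pL1_extend f t x.

Let nub : nice ub. Proof. exact: nice_extend. Qed.
Let nN : nice (pL1_extend f). Proof. exact: nice_pL1_extend. Qed.

Lemma nice_source : nice mm.
Proof.
apply: niceB; last exact: nN.
split.
- by move=> t; apply: contZ; exact: (nice_x nub).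
- by move=> y; apply: contZ; exact: (nice_t nub).
- move=> T; have [C hC] := nice_b nub T; exists (`|alpha| * C) => t y tT.
  by rewrite normrM; apply: ler_wpM2l => //; exact: hC.
Qed.

(** For a product test function, the term in [f] is integrated by parts in [x]. Only the primitive
    of [f] then occurs, and it combines with [alpha u] into the single source [mm], tested with
    [X']. *)
Lemma weak_tensor X Th a L c T : smooth X -> smooth Th -> 0 < a -> 0 < c ->
  0 <= L -> 0 <= T ->
  (forall x, X x != 0 -> a <= x <= L) -> (forall t, Th t != 0 -> c <= t <= T) ->
  X L = 0 -> Th T = 0 ->
  prim (fun t => derive1 Th t * prim (fun x => ub t x * (gamma * derive1 (derive1 X) x - X x)) L
    - Th t * prim (fun x => mm t x * derive1 X x) L) T = 0.
Proof.
move=> sX sT a0 c0 L0 T0 hX hT XL ThT.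
have := uf (test_tensor sX sT a0 c0 hX hT).
have sX1 := smooth_derive1 sX; have sX2 := smooth_derive1 sX1; have sT1 := smooth_derive1 sT.
have dX x : derivable X x 1 by have [_ []] := sX 1%N.
have dX1 x : derivable (derive1 X) x 1 by have [_ []] := sX1 1%N.
have dT t : derivable Th t 1 by have [_ []] := sT 1%N.
have cX := Ck_cont (sX 0%N); have cX1 := Ck_cont (sX1 0%N); have cX2 := Ck_cont (sX2 0%N).
have cT := Ck_cont (sT 0%N); have cT1 := Ck_cont (sT1 0%N).
rewrite (d_t_tensor X dT) (d_x_tensor Th dX) (d_x_tensor Th dX1) (d_t_tensor _ dT).
have zero_der (h : R -> R) l : smooth h -> (forall x, l < x -> h x = 0) ->
    forall x, l < x -> derive1 h x = 0.
  move=> sh h0 x lx; apply: (@near_cst_der R h _ 0 x _ (Ck_der x (sh 1%N))).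
  by near=> y; apply: h0; near: y; exact: lt_nbhsr.
have X0 x : L < x -> X x = 0.
  by move=> Lx; apply/eqP/negPn/negP => /hX /andP[_]; rewrite leNgt Lx.
have Th0 t : T < t -> Th t = 0.
  by move=> Tt; apply/eqP/negPn/negP => /hT /andP[_]; rewrite leNgt Tt.
have X10 := zero_der _ _ sX X0; have X20 := zero_der _ _ sX1 X10.
have Th10 := zero_der _ _ sT Th0.
have cub t := @nice_x _ _ nub t.
pose A t := prim (fun x => ub t x * (gamma * derive1 (derive1 X) x - X x)) L.
pose Bu t := prim (fun x => ub t x * derive1 X x) L.
pose Bf t := prim (fun x => pL1_extend f t x * derive1 X x) L.
have E1 t : 0 <= t -> \int[mu]_(x in @halfline R) (u x t *
   (- (X x * derive1 Th t) - alpha * (derive1 X x * Th t) +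
    gamma * (derive1 (derive1 X) x * derive1 Th t))) =
   derive1 Th t * A t - alpha * (Th t * Bu t).
  move=> t0; rewrite (hl_support (L := L)); last first.
    by move=> x Lx; rewrite X0// X10// X20//; ring.
  have c1 : continuous (fun x => ub t x * (gamma * derive1 (derive1 X) x - X x)).
    by apply: contM => //; apply: contB => //; exact: contZ.
  have c2 : continuous (fun x => ub t x * derive1 X x) by exact: contM.
  have c3 := contZ (c := Th t) c2.
  rewrite /A /Bu -(primZ _ _ c1) -(primZ _ _ c2) -(primZ _ _ c3).
  rewrite -primB; [|exact: contZ|exact: contZ].
  rewrite prim_ge0//; apply: eq_Rintegral => x; rewrite inE/= in_itv/= => /andP[x0 _].
  by rewrite /ub /extend !pos_id//; ring.
have E2 t : 0 <= t -> \int[mu]_(x in @halfline R) (f x t * (X x * Th t)) = - (Th t * Bf t).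
  move=> t0; rewrite (hl_support (L := L)); last first.
    by move=> x Lx; rewrite X0//; ring.
  have ft : L1 (f ^~ (pos t)) by have [fL _] := fC; exact/fL/pos_ge0.
  have dX' x : is_derive x 1 X (derive1 X x) by exact: Ck_der (sX 1%N).
  have := pL1_by_parts L0 ft dX' cX1; rewrite XL mul0r sub0r pos_id// => h.
  have -> : \int[mu]_(x in `[0, L]) (f x t * (X x * Th t)) =
      Th t * \int[mu]_(x in `[0, L]) (f x t * X x).
    rewrite -RintegralZl//; last by rewrite pos_id// in ft; exact: L1_mul_seg.
    by apply: eq_Rintegral => x _; ring.
  rewrite h mulrN /Bf; congr (- (_ * _)); congr prim; apply/funext => x.
  by rewrite /pL1_extend pos_id// mulrC.
have -> : \int[mu]_(t in @halfline R) \int[mu]_(x in @halfline R) (u x t *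
   (- (X x * derive1 Th t) - alpha * (derive1 X x * Th t) +
    gamma * (derive1 (derive1 X) x * derive1 Th t))) =
   \int[mu]_(t in @halfline R) (derive1 Th t * A t - alpha * (Th t * Bu t)).
  by apply: eq_Rintegral => t; rewrite inE => /halflineE /E1.
have -> : \int[mu]_(t in @halfline R) \int[mu]_(x in @halfline R) (f x t * (X x * Th t)) =
   \int[mu]_(t in @halfline R) (- (Th t * Bf t)).
  by apply: eq_Rintegral => t; rewrite inE => /halflineE /E2.
have cpp (m : R -> R -> R) (h : R -> R) : nice m -> continuous h ->
    continuous (fun t => prim (fun x => m t x * h x) L).
  move=> nm ch t; have [C hC] := nice_loc t nm; have [C1 hC1] := @cont_bounded_seg R h 0 L ch.
  apply: (@cont_prim_param R (fun t x => m t x * h x) (C * C1)) => //.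
  - by move=> s; apply: contM => //; exact: (nice_x nm).
  - by move=> y _; apply: contM; [exact: (nice_t nm)|exact: cst_continuous].
  - by move=> s y st yL; rewrite normrM; apply: ler_pM => //; [exact: hC|exact: hC1].
have cA : continuous A by apply: cpp => //; apply: contB => //; exact: contZ.
have cBu : continuous Bu by exact: cpp.
have cBf : continuous Bf by exact: cpp.
have c1 : continuous (fun t => derive1 Th t * A t - alpha * (Th t * Bu t)).
  by apply: contB; [exact: contM|apply: contZ; exact: contM].
have c2 : continuous (fun t => - (Th t * Bf t)) by apply: contN; exact: contM.
rewrite (hl_support (L := T)); last by move=> t Tt; rewrite Th0// Th10//; ring.
rewrite (hl_support (L := T)); last by move=> t Tt; rewrite Th0// mul0r oppr0.
rewrite -!prim_ge0// => /eqP; rewrite -subr_eq0 -primB// => /eqP <-.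
congr prim; apply/funext => t.
have -> : prim (fun x => mm t x * derive1 X x) L = alpha * Bu t - Bf t.
  have c3 : continuous (fun x => ub t x * derive1 X x) by exact: contM.
  have c4 : continuous (fun x => pL1_extend f t x * derive1 X x).
    by apply: contM => //; exact: (nice_x nN).
  rewrite /Bu /Bf -(primZ _ _ c3) -primB//; last exact: contZ.
  by congr prim; apply/funext => x; rewrite /mm; ring.
by rewrite -/(A t); ring.
Unshelve. all: by end_near. Qed.

End tests.

(** * Elimination of the test functions *)

Section weak_integration.
Context {R : realType}.
Notation mu := (@lebesgue_measure R).
Implicit Types (X Th h : R -> R) (a b c e t s x y C L T : R).

Lemma cont_t_prim_mul (m : R -> R -> R) h L : 0 <= L -> nice m -> continuous h ->
  continuous (fun t => prim (fun x => m t x * h x) L).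
Proof.
move=> L0 nm ch t; have [C hC] := nice_loc t nm; have [C1 hC1] := @cont_bounded_seg R h 0 L ch.
apply: (@cont_prim_param R (fun t x => m t x * h x) (C * C1)) => //.
- by move=> s; apply: contM => //; exact: (nice_x nm).
- by move=> y _; apply: contM; [exact: (nice_t nm)|exact: cst_continuous].
- by move=> s y st yL; rewrite normrM; apply: ler_pM => //; [exact: hC|exact: hC1].
Qed.

(** A Fubini identity: both sides have the same derivative in [b] and vanish at [b = 0]. *)
Lemma prim_tprim (m : R -> R -> R) b x : 0 <= x -> nice m ->
  prim (fun t => prim (m t) x) b = prim (tprim m b) x.
Proof.
move=> x0 nm; have nM := nice_tprim nm.
have c1 : continuous (fun t => prim (m t) x).
  have := cont_t_prim_mul x0 nm (@cst_continuous R 1).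
  by under eq_fun do under eq_fun do rewrite mulr1.
have d2 t : is_derive t 1 (fun t => prim (tprim m t) x) (prim (m t) x).
  have [C hC] := nice_loc t nm.
  apply: (@der_prim_param R (tprim m) m C t x x0).
  - exact: (nice_x nM).
  - by move=> s y _; exact: der_tprim.
  - by move=> s y st _; exact: hC.
rewrite (prim_der c1 d2) [X in _ - X](_ : _ = 0) ?subr0//.
rewrite (@prim_ext R _ (fun=> 0 * 1) x x0); last by move=> y _; rewrite /tprim prim0 mul0r.
by rewrite primZ ?mul0r//; exact: cst_continuous.
Qed.

Lemma cont_modulus h c d : continuous h -> 0 < d ->
  exists2 e, 0 < e & forall y, c <= y <= c + e -> `|h y - h c| <= d.
Proof.
move=> ch d0; have /cvgrPdist_le /(_ d d0) /nbhs_ballP[r /= r0 hr] := ch c.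
exists (r / 2); first by rewrite divr_gt0.
move=> y /andP[cy yc]; rewrite distrC; apply: hr; rewrite /ball/= distrC.
by rewrite ger0_norm; lra.
Qed.

Lemma seg_widen c e e' y : e <= e' -> c <= y <= c + e -> c <= y <= c + e'.
Proof. by move=> ee /andP[-> yc]; apply: le_trans yc _; rewrite lerD2l. Qed.

Lemma comb_norm (P1 P2 P3 v1 v2 v3 l m E : R) :
  `|P1 - v1| <= E -> `|P2 - v2| <= E -> `|P3 - v3| <= E ->
  `|P1 - l * P2 - m * P3 - (v1 - l * v2 - m * v3)| <= (1 + `|l| + `|m|) * E.
Proof.
move=> q1 q2 q3.
have -> : P1 - l * P2 - m * P3 - (v1 - l * v2 - m * v3) =
  (P1 - v1) - l * (P2 - v2) - m * (P3 - v3) by ring.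
rewrite !mulrDl mul1r.
apply: le_trans (ler_normB _ _) _; apply: lerD; last by rewrite normrM; apply: ler_wpM2l.
apply: le_trans (ler_normB _ _) _; apply: lerD => //.
by rewrite normrM; apply: ler_wpM2l.
Qed.

(** The hypothesis says that [A' = - B] in the sense of distributions at positive times. So
    [H = A + prim B] is constant there, and by continuity up to time [0]. *)
Lemma time_step (A B : R -> R) : continuous A -> continuous B ->
  (forall Th c T, smooth Th -> 0 < c -> 0 <= T -> (forall t, Th t != 0 -> c <= t <= T) ->
    Th T = 0 -> prim (fun t => derive1 Th t * A t - Th t * B t) T = 0) ->
  forall b, 0 <= b -> A b - A 0 = - prim B b.
Proof.
move=> cA cB AB.
pose H t := A t + prim B t.
have cpB := continuous_prim cB.
have cH : continuous H by exact: contD.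
have [K K0 hK] := @bump_approx R.
have Hab a b : 0 < a -> a <= b -> H b = H a.
  move=> a0 ab; apply/eqP; rewrite -subr_eq0 -normr_le0; apply/ler_addgt0Pr => d d0.
  rewrite add0r.
  have K1 : 0 < 2 * K + 1 by lra.
  have dK : 0 < d / (2 * K + 1) by rewrite divr_gt0.
  have [e1 e10 h1] := cont_modulus a cH dK.
  have [e2 e20 h2] := cont_modulus b cH dK.
  pose e := Num.min 1 (Num.min e1 e2).
  have e0 : 0 < e by rewrite !lt_min ltr01 e10.
  have e_1 : e <= 1 by rewrite ge_min lexx.
  have e_e1 : e <= e1 by rewrite !ge_min lexx orbT.
  have e_e2 : e <= e2 by rewrite !ge_min lexx !orbT.
  pose T := b + 1.
  have T0 : 0 <= T by rewrite /T; lra.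
  have aeT : a + e <= T by rewrite /T; lra.
  have beT : b + e <= T by rewrite /T; lra.
  (* A smoothed indicator of [[a, b]]: its derivative is a bump just after [a] minus a bump just
     after [b], and these sample [H a] and [H b]. *)
  pose Th t := step ((t - a) / e) + -1 * step ((t - b) / e).
  have sTh : smooth Th.
    move=> n; apply: CkD; first exact: (smooth_scaled _ _ smooth_step).
    by apply: CkZ; exact: (smooth_scaled _ _ smooth_step).
  have dTh t : is_derive t 1 Th (bump ((t - a) / e) / e + -1 * (bump ((t - b) / e) / e)).
    apply: derD; first exact: (der_scaled e a t der_step).
    by apply: derZ; exact: (der_scaled e b t der_step).
  have step_lt c t : t <= c -> step ((t - c) / e) = 0.
    by move=> tc; apply: step_le0; rewrite ler_pdivrMr// mul0r subr_le0.
  have step_gt c t : c + e <= t -> step ((t - c) / e) = 1.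
    by move=> ct; apply: step_ge1; rewrite ler_pdivlMr//; lra.
  have hTh t : Th t != 0 -> a <= t <= T.
    move=> Tht; apply/andP; split; rewrite leNgt; apply: contra Tht => ht; rewrite /Th.
      by rewrite !step_lt ?mulr0 ?addr0//; lra.
    rewrite !step_gt; [by rewrite mulr1 subrr|..].
      exact: le_trans beT (ltW ht).
    exact: le_trans aeT (ltW ht).
  have ThT : Th T = 0 by rewrite /Th !step_gt ?mulr1 ?subrr.
  have := AB Th a T sTh a0 T0 hTh ThT.
  have cT := Ck_cont (sTh 0%N); have cT1 := Ck_cont (smooth_derive1 sTh 0%N).
  have cTB := contM cT cB.
  have cTH := contM cT1 cH.
  have Th0 : Th 0 = 0 by rewrite /Th !step_lt ?mulr0 ?addr0//; lra.
  (* By parts, [- Th B] becomes [Th' prim B], as [Th] vanishes at [0] and at [T]. *)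
  have -> : prim (fun t => derive1 Th t * A t - Th t * B t) T = prim (fun t => derive1 Th t * H t) T.
    have dTB t : is_derive t 1 (fun t => Th t * prim B t)
        (derive1 Th t * prim B t + Th t * B t).
      exact: derM (Ck_der t (sTh 1%N)) (der_prim t cB).
    have c1 : continuous (fun t => derive1 Th t * prim B t) by exact: contM.
    have c2 : continuous (fun t => derive1 Th t * A t) by exact: contM.
    have := prim_der (contD c1 cTB) dTB T; rewrite ThT Th0 !mul0r subrr primD// => h.
    have -> : (fun t => derive1 Th t * H t) = (fun t => derive1 Th t * A t + derive1 Th t * prim B t).
      by apply/funext => t; rewrite /H mulrDr.
    by move/eqP: h; rewrite addr_eq0 (primB T c2 cTB) (primD T c2 c1) => /eqP ->.
  have -> : prim (fun t => derive1 Th t * H t) T =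
      prim (fun t => bump ((t - a) / e) / e * H t) T - prim (fun t => bump ((t - b) / e) / e * H t) T.
    have cb c : continuous (fun t => bump ((t - c) / e) / e * H t).
      apply: contM => //; apply: contM; last exact: cst_continuous.
      exact: (Ck_cont (@smooth_scaled R bump e c smooth_bump 0%N)).
    rewrite -primB//; congr prim; apply/funext => t.
    have -> : derive1 Th t = bump ((t - a) / e) / e + -1 * (bump ((t - b) / e) / e).
      exact: der_derive1.
    move: (bump _) (bump _) (H t) => b1 b2 Ht; ring.
  move=> HH.
  have q1 := hK H a e (d / (2 * K + 1)) T cH (ltW a0) e0 aeT
    (fun y hy => h1 y (seg_widen e_e1 hy)).
  have q2 := hK H b e (d / (2 * K + 1)) T cH (le_trans (ltW a0) ab) e0 beT
    (fun y hy => h2 y (seg_widen e_e2 hy)).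
  have Kd : 2 * (K * (d / (2 * K + 1))) <= d.
    have -> : 2 * (K * (d / (2 * K + 1))) = d * (2 * K / (2 * K + 1)) by field; rewrite gt_eqF.
    by apply: ler_piMr; [exact: ltW|rewrite ler_pdivrMr// mul1r lerDl].
  apply: le_trans Kd; move/eqP: HH; rewrite subr_eq0 => /eqP HH.
  rewrite HH in q1; apply: le_trans (ler_distD _ _ _) _.
  by rewrite mulr2n mulrDl mul1r; apply: lerD q1; rewrite distrC.
move=> b b0; have [->|bn0] := eqVneq b 0; first by rewrite prim0 subrr oppr0.
have bp : 0 < b by rewrite lt_neqAle eq_sym bn0.
have : H b = H 0.
  apply/esym; rewrite -[H 0]addr0 -[X in _ = X]add0r.
  (* The minimum keeps the argument in [[0, b]] for nonnegative [t], so that this continuous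
     function equals [H b] at every positive [t]. *)
  have := @closed_eq_right R (fun t => H (Num.min t b)) (H b) 0.
  rewrite min_l// => h; rewrite addr0 add0r; apply: h.
    apply: cont_comp cH.
    by move=> t; apply: continuous_min; [exact: cvg_id|exact: cvg_cst].
  move=> t t0; apply/esym; apply: Hab; last by rewrite ge_min lexx orbT.
  by rewrite lt_min t0.
by rewrite /H prim0; lra.
Qed.

Variables (alpha gamma : R) (f u : R -> R -> R).
Hypothesis uC : C_Cb u.
Hypothesis fC : C_L1 f.
Hypothesis uf : pde_weak alpha gamma f u.

Let ub := extend u.
(* The differential equation reads [u_t - gamma u_xxt = - (source)_x]. *)
Definition source t x : R := alpha * extend u t x - pL1_extend f t x.

Let nub : nice ub. Proof. exact: nice_extend. Qed.
Let nmm : nice source. Proof. exact: nice_source. Qed.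
Let cub t : continuous (ub t). Proof. exact: (nice_x nub). Qed.
Let cmm t : continuous (source t). Proof. exact: (nice_x nmm). Qed.

(** The second primitive of [gamma u_xx - u], up to an affine function of [x]; it makes sense for
    continuous [u]. *)
Let kk t x := gamma * ub t x - prim (prim (ub t)) x.

Let ckk t : continuous (kk t).
Proof. by apply: contB; [exact: contZ|do 2 apply: continuous_prim]. Qed.

(** Integrations by parts in [x] put every term against [X'']. The boundary terms vanish at [0] by
    the choice of the primitives and at [L] by the conditions on [X]; [time_step] removes the
    cut-off in time. *)
Lemma weak_space X a L b : smooth X -> 0 < a -> 0 <= L -> 0 <= b ->
  (forall x, X x != 0 -> a <= x <= L) -> X L = 0 -> derive1 X L = 0 ->
  prim (fun x => (kk b x - kk 0 x) * derive1 (derive1 X) x) L =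
  prim (fun t => prim (fun x => prim (source t) x * derive1 (derive1 X) x) L) b.
Proof.
move=> sX a0 L0 b0 hX XL X1L.
have sX1 := smooth_derive1 sX; have sX2 := smooth_derive1 sX1.
have cX := Ck_cont (sX 0%N); have cX1 := Ck_cont (sX1 0%N); have cX2 := Ck_cont (sX2 0%N).
have dX x := Ck_der x (sX 1%N); have dX1 x := Ck_der x (sX1 1%N).
pose A t := prim (fun x => ub t x * (gamma * derive1 (derive1 X) x - X x)) L.
pose B t := prim (fun x => source t x * derive1 X x) L.
have cA : continuous A by apply: cont_t_prim_mul => //; apply: contB => //; exact: contZ.
have cB : continuous B by exact: cont_t_prim_mul.
have AB : A b - A 0 = - prim B b.
  apply: (time_step cA cB _ b0) => Th c T sT c0 T0 hT ThT.
  exact: (weak_tensor uC fC uf sX sT a0 c0 L0 T0 hX hT XL ThT).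
have AE t : A t = prim (fun x => kk t x * derive1 (derive1 X) x) L.
  have cp := continuous_prim (@cub t); have cpp := continuous_prim cp.
  have d x : is_derive x 1 (fun x => prim (ub t) x * X x - prim (prim (ub t)) x * derive1 X x)
      (ub t x * X x - prim (prim (ub t)) x * derive1 (derive1 X) x).
    apply: (is_derive_eq (derB (derM (der_prim x (@cub t)) (dX x))
      (derM (der_prim x cp) (dX1 x)))); ring.
  have c1 : continuous (fun x => ub t x * X x) by exact: contM.
  have c2 : continuous (fun x => prim (prim (ub t)) x * derive1 (derive1 X) x) by exact: contM.
  have := prim_der (contB c1 c2) d L.
  rewrite XL X1L !mulr0 !prim0 !mul0r !subr0 primB// => h.
  have c3 : continuous (fun x => gamma * (ub t x * derive1 (derive1 X) x)).
    by apply: contZ; exact: contM.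
  transitivity (prim (fun x => gamma * (ub t x * derive1 (derive1 X) x)) L -
    prim (fun x => ub t x * X x) L).
    by rewrite -primB//; congr prim; apply/funext => x; ring.
  transitivity (prim (fun x => gamma * (ub t x * derive1 (derive1 X) x)) L -
    prim (fun x => prim (prim (ub t)) x * derive1 (derive1 X) x) L); first by lra.
  by rewrite -primB//; congr prim; apply/funext => x; rewrite /kk; ring.
have BE t : B t = - prim (fun x => prim (source t) x * derive1 (derive1 X) x) L.
  have cp := continuous_prim (@cmm t).
  have d x : is_derive x 1 (fun x => prim (source t) x * derive1 X x)
      (source t x * derive1 X x + prim (source t) x * derive1 (derive1 X) x).
    exact: derM (der_prim x (@cmm t)) (dX1 x).
  have c1 : continuous (fun x => source t x * derive1 X x) by exact: contM.
  have c2 : continuous (fun x => prim (source t) x * derive1 (derive1 X) x) by exact: contM.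
  have := prim_der (contD c1 c2) d L.
  by rewrite X1L prim0 mulr0 mul0r subr0 primD// => /eqP; rewrite addr_eq0 => /eqP.
clearbody A B.
have -> : (fun t => prim (fun x => prim (source t) x * derive1 (derive1 X) x) L) = (fun t => - B t).
  by apply/funext => t; rewrite BE opprK.
rewrite (primN b cB) -AB !AE -primB; [|exact: contM|exact: contM].
by congr prim; apply/funext => x; rewrite mulrBl.
Qed.

(* The combination of bumps at [x0], [1] and [2] with vanishing moments of order
   [0] and [1] is the second derivative of a compactly supported function. *)
Lemma weak_affine b x0 : 0 <= b -> 0 < x0 ->
  let g x := kk b x - kk 0 x - prim (tprim source b) x in
  g x0 = (2 - x0) * g 1 + (x0 - 1) * g 2.
Proof.
move=> b0 x00 g.
have nM := nice_tprim nmm.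
(* The weights of affine interpolation at [x0] from the nodes [1] and [2]: [lam + mu = 1] and
   [lam + 2 mu = x0]. *)
pose lam := 2 - x0; pose mu := x0 - 1.
have [K K0 hK] := @bump_approx R.
have [C hC] := nice_b nmm b.
have C0 : 0 <= C by apply: le_trans (hC 0 0 _); rewrite ?normr0.
pose h x := kk b x - kk 0 x.
have ch : continuous h by exact: contB.
apply/eqP; rewrite -subr_eq0 -normr_le0; apply/ler_addgt0Pr => d' d'0; rewrite add0r.
pose W := K * (1 + `|lam| + `|mu|) * (1 + b) + 1.
have W0 : 0 < W.
  by rewrite ltr_wpDl// mulr_ge0// ?mulr_ge0// !addr_ge0.
pose d := d' / W.
have d0 : 0 < d by rewrite divr_gt0.
have [e1 e10 h1] := cont_modulus x0 ch d0.
have [e2 e20 h2] := cont_modulus 1 ch d0.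
have [e3 e30 h3] := cont_modulus 2 ch d0.
(* The bound [d / (C + 1)] limits the variation of [prim (source t)] over a length [e] to [d], for
   all times in [[0, b]] at once; [e1], [e2], [e3] do this for [h] at the three points. *)
pose e := Num.min (Num.min 1 (d / (C + 1))) (Num.min e1 (Num.min e2 e3)).
have C1 : 0 < C + 1 by lra.
have e0 : 0 < e by rewrite !lt_min ltr01 e10 e20 e30 divr_gt0.
have [e_1 e_d e_e1 e_e2 e_e3] : [/\ e <= 1, e <= d / (C + 1), e <= e1, e <= e2 & e <= e3].
  by split; rewrite !ge_min lexx ?orbT.
pose L := Num.max x0 2 + 1.
have Lx0 : x0 + 1 <= L by rewrite lerD2r le_max lexx.
have L2 : 2 + 1 <= L by rewrite lerD2r le_max lexx orbT.
have L1' : x0 + e <= L by lra.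
have L2' : 1 + e <= L by lra.
have L3' : 2 + e <= L by lra.
have L0 : 0 <= L by lra.
pose a := Num.min x0 1.
have a0 : 0 < a by rewrite lt_min x00 ltr01.
have ax0 : a <= x0 by rewrite ge_min lexx.
have a1 : a <= 1 by rewrite ge_min lexx orbT.
pose comb (p : R -> R -> R) x := p x0 x + (- lam * p 1 x + - mu * p 2 x).
(* For every [e], the scaled ramp equals [x - c] exactly once [x >= c + e]. Beyond [L] the
   combination is therefore [(x - x0) - lam (x - 1) - mu (x - 2) = 0], and [X] has compact
   support. *)
pose X := comb (fun c x => e * ramp ((x - c) / e)).
pose X1 := comb (fun c x => step ((x - c) / e)).
pose X2 := comb (fun c x => bump ((x - c) / e) / e).
have sX : smooth X.
  have s c n : Ck n (fun x => e * ramp ((x - c) / e)).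
    by apply: CkZ; exact: (smooth_scaled _ _ smooth_ramp).
  by move=> n; apply: CkD => //; apply: CkD; exact: CkZ.
have dX x : is_derive x 1 X (X1 x).
  have dc c : is_derive x 1 (fun x => e * ramp ((x - c) / e)) (step ((x - c) / e)).
    apply: (is_derive_eq (derZ e (der_scaled e c x der_ramp))).
    by field; rewrite gt_eqF.
  by apply: derD => //; apply: derD; exact: derZ.
have dX1 x : is_derive x 1 X1 (X2 x).
  have dc c := der_scaled e c x (@der_step R).
  by apply: derD => //; apply: derD; exact: derZ.
have EX1 : derive1 X = X1 by apply/funext => x; exact: der_derive1.
have EX2 : derive1 (derive1 X) = X2 by rewrite EX1; apply/funext => x; exact: der_derive1.
have lt0 c x : x <= c -> (x - c) / e <= 0.
  by move=> xc; rewrite ler_pdivrMr// mul0r subr_le0.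
have gt1 c x : c + e <= x -> 1 <= (x - c) / e.
  by move=> cx; rewrite ler_pdivlMr//; lra.
have Xlt x : x < a -> X x = 0.
  move=> xa; have xa' := ltW xa.
  by rewrite /X /comb !ramp_le0 ?mulr0 ?addr0//; apply: lt0; apply: le_trans xa' _ => //;
    apply: le_trans a1 _; rewrite ler1n.
have Xgt x : L <= x -> X x = 0.
  move=> Lx; rewrite /X /comb !ramp_ge1; [|apply: gt1; exact: le_trans Lx..].
  by rewrite /lam /mu; field; rewrite gt_eqF.
have hX x : X x != 0 -> a <= x <= L.
  move=> Xx; apply/andP; split; rewrite leNgt; apply: contra Xx => hx.
    by rewrite Xlt.
  by rewrite Xgt// ltW.
have X1L : derive1 X L = 0.
  rewrite EX1 /X1 /comb !step_ge1; [|exact: gt1..].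
  by rewrite /lam /mu; ring.
have := weak_space sX a0 L0 b0 hX (Xgt L (lexx _)) X1L.
rewrite EX2 -/(h _).
have approx (p : R -> R) D : continuous p ->
    (forall y, x0 <= y <= x0 + e -> `|p y - p x0| <= D) ->
    (forall y, 1 <= y <= 1 + e -> `|p y - p 1| <= D) ->
    (forall y, 2 <= y <= 2 + e -> `|p y - p 2| <= D) ->
    `|prim (fun x => p x * X2 x) L - (p x0 - lam * p 1 - mu * p 2)| <=
      K * (1 + `|lam| + `|mu|) * D.
  move=> cp p1 p2 p3.
  have q1 := hK p x0 e D L cp (ltW x00) e0 L1' p1.
  have q2 := hK p 1 e D L cp ler01 e0 L2' p2.
  have q3 := hK p 2 e D L cp (ler0n _ _) e0 L3' p3.
  have cb c : continuous (fun t => bump ((t - c) / e) / e * p t).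
    apply: contM => //; apply: contM; last exact: cst_continuous.
    exact: (Ck_cont (@smooth_scaled R bump e c smooth_bump 0%N)).
  have -> : prim (fun x => p x * X2 x) L =
    prim (fun t => bump ((t - x0) / e) / e * p t) L -
    lam * prim (fun t => bump ((t - 1) / e) / e * p t) L -
    mu * prim (fun t => bump ((t - 2) / e) / e * p t) L.
    rewrite -(primZ lam _ (cb 1)) -(primZ mu _ (cb 2)).
    rewrite -primB//; last exact: contZ.
    rewrite -primB//; [|by apply: contB => //; exact: contZ|exact: contZ].
    have comb_mul (b1 b2 b3 r l m i : R) : r * (b1 * i + (- l * (b2 * i) + - m * (b3 * i))) =
      b1 * i * r - l * (b2 * i * r) - m * (b3 * i * r) by ring.
    by congr prim; apply/funext => x; exact: comb_mul.
  apply: le_trans (comb_norm lam mu q1 q2 q3) _.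
  by rewrite mulrCA mulrA.
have qh := approx h d ch
  (fun y hy => h1 y (seg_widen e_e1 hy))
  (fun y hy => h2 y (seg_widen e_e2 hy))
  (fun y hy => h3 y (seg_widen e_e3 hy)).
have ql t : 0 <= t <= b -> `|prim (fun x => prim (source t) x * X2 x) L -
   (prim (source t) x0 - lam * prim (source t) 1 - mu * prim (source t) 2)| <=
    K * (1 + `|lam| + `|mu|) * d.
  move=> /andP[t0 tb].
  have lip c y : c <= y <= c + e -> `|prim (source t) y - prim (source t) c| <= d.
    move=> /andP[cy yc].
    have := @lip_der R (prim (source t)) (source t) C c y cy.
    move=> H; apply: le_trans (H _ _) _.
    - by move=> z _; exact: der_prim.
    - by move=> z _; apply: hC; rewrite ger0_norm.
    - apply: (@le_trans _ _ ((C + 1) * (d / (C + 1)))).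
        apply: ler_pM => //; [by rewrite subr_ge0|by rewrite lerDl|].
        by apply: le_trans e_d; rewrite lerBlDl.
      by rewrite mulrC divfK// gt_eqF.
  by apply: approx; [exact: continuous_prim|exact: lip..].
have cp c : 0 <= c -> continuous (fun t => prim (source t) c).
  move=> c0; have := cont_t_prim_mul c0 nmm (@cst_continuous R 1).
  by under eq_fun do under eq_fun do rewrite mulr1.
pose F t := prim (fun x => prim (source t) x * X2 x) L.
pose G t := prim (source t) x0 - lam * prim (source t) 1 - mu * prim (source t) 2.
have cG : continuous G.
  apply: contB; first apply: contB.
  - by apply: cp; exact: ltW.
  - by apply: contZ; exact: cp.
  - by apply: contZ; exact: cp.
have cX1 : continuous X1 by rewrite -EX1; exact: Ck_cont (smooth_derive1 sX 0%N).
have cX2 : continuous X2 by rewrite -EX2; exact: Ck_cont (smooth_derive1 (smooth_derive1 sX) 0%N).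
(* The primitive of the source may be unbounded in [x], hence not [nice]. An integration by parts
   expresses [F] through the source itself. *)
have cF : continuous F.
  have -> : F = (fun t => - prim (fun x => source t x * X1 x) L).
    apply/funext => t; have cps := continuous_prim (@cmm t).
    have d2 x : is_derive x 1 (fun x => prim (source t) x * X1 x)
        (source t x * X1 x + prim (source t) x * X2 x).
      exact: derM (der_prim x (@cmm t)) (dX1 x).
    have c1 : continuous (fun x => source t x * X1 x) by exact: contM.
    have c2 : continuous (fun x => prim (source t) x * X2 x) by exact: contM.
    have := prim_der (contD c1 c2) d2 L.
    rewrite -EX1 X1L EX1 prim0 mulr0 mul0r subr0 primD// => /eqP.
    by rewrite addrC addr_eq0 => /eqP.
  by apply: contN; exact: cont_t_prim_mul.
have qF : `|prim F b - prim G b| <= K * (1 + `|lam| + `|mu|) * d * b.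
  rewrite -primB//.
  have := @lip_der R (prim (fun t => F t - G t)) (fun t => F t - G t)
    (K * (1 + `|lam| + `|mu|) * d) 0 b b0.
  rewrite prim0 !subr0; apply.
    by move=> t _; apply: der_prim; exact: contB.
  by move=> t tb; exact: ql.
have EG : prim G b = prim (tprim source b) x0 - lam * prim (tprim source b) 1 -
    mu * prim (tprim source b) 2.
  have c1 := cp x0 (ltW x00); have c2 := cp 1 ler01; have c3 := cp 2 (ler0n _ _).
  have z2 := contZ (c := lam) c2; have z3 := contZ (c := mu) c3.
  rewrite /G (primB b (contB c1 z2) z3) (primB b c1 z2) (primZ lam b c2) (primZ mu b c3).
  have comb_eq (r1 r2 r3 s1 s2 s3 : R) : r1 = s1 -> r2 = s2 -> r3 = s3 ->
    r1 - lam * r2 - mu * r3 = s1 - lam * s2 - mu * s3 by move=> -> -> ->.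
  exact: comb_eq (prim_tprim b (ltW x00) nmm) (prim_tprim b ler01 nmm)
    (prim_tprim b (ler0n _ 2) nmm).
move=> HE.
have -> : g x0 - ((2 - x0) * g 1 + (x0 - 1) * g 2) =
  (h x0 - lam * h 1 - mu * h 2) - prim G b.
  have comb_g (r1 r2 r3 s1 s2 s3 l m : R) : r1 - s1 - (l * (r2 - s2) + m * (r3 - s3)) =
    r1 - l * r2 - m * r3 - (s1 - l * s2 - m * s3) by ring.
  by rewrite EG; exact: comb_g.
have dW : K * (1 + `|lam| + `|mu|) * d + K * (1 + `|lam| + `|mu|) * d * b <= d'.
  have -> : K * (1 + `|lam| + `|mu|) * d + K * (1 + `|lam| + `|mu|) * d * b = d' * ((W - 1) / W).
    by rewrite /d /W; field; rewrite gt_eqF.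
  by apply: ler_piMr; [exact: ltW|rewrite ler_pdivrMr// mul1r gerBl].
apply: le_trans dW.
have HE' : prim (fun x => h x * X2 x) L = prim F b := HE.
rewrite HE' distrC in qh.
exact: le_trans (ler_distD (prim F b) _ _) (lerD qh qF).
Qed.

Lemma weak_integrated b : 0 <= b -> exists p q, forall x, 0 <= x ->
  gamma * (ub b x - ub 0 x) =
  p + q * x + prim (prim (fun y => ub b y - ub 0 y)) x + prim (tprim source b) x.
Proof.
move=> b0; pose g x := kk b x - kk 0 x - prim (tprim source b) x.
have nM := nice_tprim nmm.
have cg : continuous g.
  by apply: contB; [exact: contB|apply: continuous_prim; exact: (nice_x nM)].
(* Intercept and slope of the affine function through the values of [g] at [1] and [2]. The point
   [x = 0], which [weak_affine] leaves out, follows by continuity. *)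
exists (2 * g 1 - g 2), (g 2 - g 1) => x x0.
have gE : g x = (2 - x) * g 1 + (x - 1) * g 2.
  have [xE|xn0] := eqVneq x 0; last first.
    by apply: weak_affine => //; rewrite lt_neqAle eq_sym xn0.
  rewrite xE; apply/eqP; rewrite -subr_eq0; apply/eqP.
  apply: (@closed_eq_right R (fun x => g x - ((2 - x) * g 1 + (x - 1) * g 2))).
    apply: contB => //; apply: contD; apply: contM; try exact: cst_continuous.
      by apply: contB; [exact: cst_continuous|move=> ?; exact: cvg_id].
    by apply: contB; [move=> ?; exact: cvg_id|exact: cst_continuous].
  by move=> y y0; rewrite /g weak_affine// subrr.
have c t := continuous_prim (@cub t).
have -> : prim (prim (fun y => ub b y - ub 0 y)) x = prim (prim (ub b)) x - prim (prim (ub 0)) x.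
  rewrite -primB//; congr prim; apply/funext => y.
  by rewrite primB.
have affine_solve (ga A B P1 P2 Z g1 g2 y : R) :
    ga * A - P1 - (ga * B - P2) - Z = (2 - y) * g1 + (y - 1) * g2 ->
    ga * (A - B) = 2 * g1 - g2 + (g2 - g1) * y + (P1 - P2) + Z.
  move=> h.
  have -> : ga * (A - B) = (ga * A - P1 - (ga * B - P2) - Z) + (P1 - P2) + Z by ring.
  by rewrite h; ring.
exact: affine_solve gE.
Qed.

End weak_integration.

(** * Representation of the solution *)

Section representation.
Context {R : realType}.
Notation mu := (@lebesgue_measure R).
Implicit Types (h : R -> R) (a b c e t s x y C L T : R).

Lemma der0_eq h : (forall x, 0 <= x -> is_derive x 1 h 0) ->
  forall x, 0 <= x -> h x = h 0.
Proof.
move=> dh x x0; apply/eqP; rewrite -subr_eq0 -normr_le0.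
have := @lip_der R h (fun=> 0) 0 0 x x0; rewrite mul0r; apply.
  by move=> y /andP[y0 _]; exact: dh.
by move=> y _; rewrite normr0.
Qed.

(* The equation is a linear system for [Phi] and its primitive; boundedness
   excludes the mode [e^(k x)]. *)
Lemma kernel_unique k (Phi M : R -> R) p q : 0 < k -> continuous Phi -> continuous M ->
  bdd Phi -> bdd M ->
  (forall x, 0 <= x ->
     (k ^+ 2)^-1 * Phi x = p + q * x + prim (prim Phi) x + prim M x) ->
  forall x, 0 <= x -> Phi x = Phi 0 * expR (- k * x) + Kk k M x.
Proof.
move=> k0 cP cM [CP hCP] [CM hCM] eqn.
have kn0 : k != 0 by rewrite gt_eqF.
have cpP := continuous_prim cP.
(* [Phi] is only continuous and solves the equation on the half-line; the right-hand side extends it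
   to a function differentiable on [R]. *)
pose Ph x := k ^+ 2 * (p + q * x + prim (prim Phi) x + prim M x).
have PhE x : 0 <= x -> Ph x = Phi x.
  by move=> x0; rewrite /Ph -eqn// mulrA divff ?mul1r// expf_neq0.
pose om x := q + prim Phi x - Rk k M x + Phi 0 / k * expR (- k * x).
pose de x := Ph x - Phi 0 * expR (- k * x) - Kk k M x.
have dde x : is_derive x 1 de (k ^+ 2 * om x).
  have d1 := derD (der_cst p x) (derZ q (der_id x)).
  have d2 := derD (derD d1 (der_prim x cpP)) (der_prim x cM).
  have d3 := derB (derZ (k ^+ 2) d2) (derZ (Phi 0) (der_exp (- k) x)).
  apply: (is_derive_eq (derB d3 (der_Kk k x cM))).
  by rewrite /om; field.
have dom x : 0 <= x -> is_derive x 1 om (de x).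
  move=> x0.
  have d1 := derB (derD (der_cst q x) (der_prim x cP)) (der_Rk k x cM).
  apply: (is_derive_eq (derD d1 (derZ (Phi 0 / k) (der_exp (- k) x)))).
  by rewrite /de PhE//; field.
(* The system [de' = k^2 om], [om' = de] is diagonalised into a growing mode [y] and a decaying mode
   [z]. *)
pose y x := de x + k * om x; pose z x := de x - k * om x.
have dy x : 0 <= x -> is_derive x 1 y (k * y x).
  move=> x0; apply: (is_derive_eq (derD (dde x) (derZ k (dom x x0)))).
  by rewrite /y; ring.
have dz x : 0 <= x -> is_derive x 1 z (- k * z x).
  move=> x0; apply: (is_derive_eq (derB (dde x) (derZ k (dom x x0)))).
  by rewrite /z; ring.
have yE x : 0 <= x -> expR (- k * x) * y x = y 0.
  move=> x0; rewrite (@der0_eq (fun x => expR (- k * x) * y x) _ x x0).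
    by rewrite mulr0 expR0 mul1r.
  by move=> t t0; apply: (is_derive_eq (derM (der_exp (- k) t) (dy t t0))); ring.
have zE x : 0 <= x -> expR (k * x) * z x = z 0.
  move=> x0; rewrite (@der0_eq (fun x => expR (k * x) * z x) _ x x0).
    by rewrite mulr0 expR0 mul1r.
  by move=> t t0; apply: (is_derive_eq (derM (der_exp k t) (dz t t0))); ring.
have zE' x : 0 <= x -> z x = expR (- k * x) * z 0.
  by move=> x0; rewrite -(zE x x0) mulrA mulNr expNK mul1r.
have e1 x : 0 <= x -> expR (- k * x) <= 1.
  by move=> x0; rewrite mulNr expR_le1 oppr_le0 mulr_ge0// ltW.
pose D := CP + CP + 3 / 2 * k * CM.
have deD x : 0 <= x -> `|de x| <= D.
  move=> x0; rewrite /de PhE//.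
  have [h1 _] := kernel_le k0 cM hCM x0.
  apply: le_trans (ler_normB _ _) _; apply: lerD => //.
  apply: le_trans (ler_normB _ _) _; apply: lerD; first exact: hCP.
  rewrite normrM (ger0_norm (expR_ge0 _)).
  apply: le_trans (_ : `|Phi 0| <= CP); last exact: hCP.
  by apply: ler_piMr => //; exact: e1.
have D0 : 0 <= D by apply: le_trans (deD 0 (lexx 0)).
(* [e^(-k x) y] is constant while [y = 2 de - z] is bounded, so the constant is zero. *)
have y0 : y 0 = 0.
  apply/eqP; rewrite -normr_le0; apply/ler_addgt0Pr => e e0; rewrite add0r.
  have E0 : 0 <= 2 * D + `|z 0| by rewrite addr_ge0// mulr_ge0.
  have [x x0 hx] := exp_small E0 e0.
  have xk : 0 <= x / k by rewrite divr_ge0// ltW.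
  rewrite -(yE (x / k) xk) normrM ger0_norm ?expR_ge0//.
  have -> : - k * (x / k) = - x by field.
  apply: le_trans hx; apply: ler_wpM2l; first exact: expR_ge0.
  have -> : y (x / k) = 2 * de (x / k) - z (x / k) by rewrite /y /z; ring.
  apply: le_trans (ler_normB _ _) _; apply: lerD.
    by rewrite normrM ger0_norm// ler_pM2l// deD.
  rewrite zE'// normrM ger0_norm ?expR_ge0//.
  by apply: ler_piMl => //; exact: e1.
have de0 : de 0 = 0.
  by rewrite /de PhE// mulr0 expR0 mulr1 Kk0 subrr subr0.
have z0 : z 0 = 0.
  have -> : z 0 = 2 * de 0 - y 0 by rewrite /y /z; ring.
  by rewrite de0 y0 mulr0 subr0.
move=> x x0.
have yx : y x = 0.
  have := yE x x0; rewrite y0 => /eqP; rewrite mulf_eq0 gt_eqF ?expR_gt0//=.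
  by move/eqP.
have zx : z x = 0 by rewrite zE'// z0 mulr0.
have : de x = 0.
  have : de x + de x = y x + z x by rewrite /y /z; ring.
  by rewrite yx zx addr0 => /eqP; rewrite -mulr2n mulrn_eq0/= => /eqP.
by rewrite /de PhE// => /eqP; rewrite subr_eq0 => /eqP <-; ring.
Qed.

Lemma hl_derivable_der h x : 0 < x -> hl_derivable h x ->
  is_derive x 1 h (hl_derive h x).
Proof.
move=> x0 dh.
have {}dh : hl_quotient h x y @[y --> within (@halfline R) x^'] --> hl_derive h x.
  exact: dh.
have H : l^-1 *: (h (l *: 1 + x) - h x) @[l --> 0^'] --> hl_derive h x.
  apply/cvgrPdist_le => e e0; move/cvgrPdist_le : dh => /(_ e e0).
  rewrite near_withinE => /nbhs_ballP[d /= d0 hd].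
  near=> l.
  have l0 : l != 0 by near: l; exact: nbhs_dnbhs_neq.
  have ld : `|l| < d by near: l; exact: dnbhs0_lt.
  have lx : `|l| < x by near: l; exact: dnbhs0_lt.
  have := hd (l *: 1 + x).
  rewrite /hl_quotient /GRing.scale/= mulr1 addrK mulrC; apply.
  - by rewrite /ball/= opprD addrCA subrr addr0 normrN.
  - by rewrite -subr_eq0 addrK.
  - by apply/halflineE; move: lx; rewrite ltr_norml; lra.
split; first by apply/cvg_ex; exists (hl_derive h x).
exact: (cvg_lim _ H).
Unshelve. all: by end_near. Qed.

(** The derivative at [0] is one-sided, so the difference [D] is first shown constant at positive
    arguments; continuity then reaches [0]. *)
Lemma pL1_hl_derive h x : Cb 1 h -> 0 <= x -> pL1 (hl_derive h) x = h x - h 0.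
Proof.
move=> [ch _ [dh [ch' _ _]]] x0.
have c0 := cont_within_pos ch; have c1 := cont_within_pos ch'.
pose h' y := hl_derive h (pos y).
have -> : pL1 (hl_derive h) x = prim h' x.
  rewrite (prim_ge0 _ x0) /pL1; apply: eq_Rintegral => y.
  by rewrite inE/= in_itv/= => /andP[y0 _]; rewrite /h' pos_id.
pose D y := prim h' (pos y) - h (pos y).
have cD : continuous D.
  apply: contB => //; apply: (cont_comp cont_pos); exact: continuous_prim.
have Dx y : 0 < y -> D (Num.min y x) = D x.
  move=> y0; have [yx|xy] := leP y x; last by [].
  apply/esym/eqP; rewrite -subr_eq0 -normr_le0.
  have := @lip_der R (fun y => prim h' y - h y) (fun=> 0) 0 y x yx.
  rewrite mul0r /D !pos_id ?(ltW y0)//; apply; last by move=> z _; rewrite normr0.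
  move=> z /andP[yz _]; have z0 := lt_le_trans y0 yz.
  apply: (is_derive_eq (derB (der_prim z c1) (hl_derivable_der z0 (dh z (ltW z0))))).
  by rewrite pos_id ?subrr// ltW.
have : D (Num.min 0 x) = D x.
  apply: (@closed_eq_right R (fun y => D (Num.min y x))) => //.
  apply: cont_comp cD.
  by move=> t; apply: continuous_min; [exact: cvg_id|exact: cvg_cst].
rewrite min_l// /D !pos_id// prim0 sub0r; lra.
Qed.

End representation.

(** * The increment over one period *)

Section assembly.
Context {R : realType}.
Notation mu := (@lebesgue_measure R).
Implicit Types (a b e t s x y C L : R).

Lemma pL1Z c (h : R -> R) x : L1 h -> pL1 (fun y => c * h y) x = c * pL1 h x.
Proof. by move=> hi; rewrite /pL1 RintegralZl//; exact: L1_seg. Qed.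

Lemma ae_pL1 (h1 h2 : R -> R) x : L1 h1 -> L1 h2 ->
  {ae mu, forall y, 0 <= y -> h1 y = h2 y} -> pL1 h1 x = pL1 h2 x.
Proof.
move=> h1i h2i hae; rewrite /pL1 /Rintegral; congr fine.
apply: ae_eq_integral => //.
- by have /integrableP[] := L1_seg x h1i.
- by have /integrableP[] := L1_seg x h2i.
- case: hae => N [mN N0 sN]; exists N; split => // y /= hy; apply: sN => /= hy0; apply: hy.
  by rewrite in_itv/= => /andP[y0 _]; rewrite hy0.
Qed.

Lemma der_shift (M : R -> R) (m T t : R) :
  is_derive (t + T) 1 M m -> is_derive t 1 (fun s => M (s + T)) m.
Proof.
move=> dM; have d := derD (der_id t) (der_cst T t).
have := @is_derive1_comp R M (fun s => s + T) t m (1 + 0) dM d.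
by rewrite addr0 mulr1.
Qed.

Variables (alpha gamma k : R) (f u : R -> R -> R).
Hypothesis k0 : 0 < k.
Variable u0 : R -> R.
Hypothesis u_init : forall x, 0 <= x -> u x 0 = u0 x.
Hypothesis kg : (k ^+ 2)^-1 = gamma.
Hypothesis uC : C_Cb u.
Hypothesis fC : C_L1 f.
Hypothesis uf : pde_weak alpha gamma f u.

Let m := source alpha f u.
Let M := tprim m.
Let nm : nice m. Proof. exact: nice_source. Qed.
Let nM : nice M. Proof. exact: nice_tprim. Qed.
Let dM t y : is_derive t 1 (M ^~ y) (m t y). Proof. exact: der_tprim. Qed.

Lemma solutionE t x : 0 <= t -> 0 <= x ->
  u x t = u x 0 + (u 0 t - u 0 0) * expR (- k * x) + sol k M t x.
Proof.
move=> t0 x0; have nu := nice_extend uC.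
have [p [q hpq]] := weak_integrated uC fC uf t0.
pose Phi y := extend u t y - extend u 0 y.
have PhiE y : 0 <= y -> Phi y = u y t - u y 0.
  by move=> y0; rewrite /Phi /extend !pos_id.
have cP : continuous Phi by apply: contB; exact: (nice_x nu).
have bP : bdd Phi.
  have [C1 h1] := nice_bdd t nu; have [C2 h2] := nice_bdd 0 nu.
  exists (C1 + C2) => y y0; apply: le_trans (ler_normB _ _) _.
  by apply: lerD; [exact: h1|exact: h2].
have cM : continuous (M t) by exact: (nice_x nM).
have : Phi x = Phi 0 * expR (- k * x) + Kk k (M t) x.
  apply: (@kernel_unique R k Phi (M t) p q k0 cP cM bP (nice_bdd t nM)) => // y y0.
  by rewrite kg; exact: hpq.
rewrite !PhiE//; rewrite -/(sol k M t x).
move: (expR _) (sol _ _ _ _) => E S; lra.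
Qed.

(** Writing [u0] as a constant plus the primitive of [u0'] gives the source the shape treated by
    [forced_energy_bdd], up to the constant [alpha * u 0 0], which is zero for compatible boundary
    data. *)
Lemma sourceE t x : Cb 1 u0 -> L1 (hl_derive u0) -> 0 <= t -> 0 <= x ->
  source alpha f u t x = alpha * sol k M t x +
    alpha * (u 0 t - u 0 0) * expR (- k * x) +
    pL1 (fun y => alpha * hl_derive u0 y - f y t) x + alpha * u 0 0.
Proof.
move=> u1 du t0 x0; have [fL _] := fC.
rewrite pL1B; [|exact: L1Z|exact: fL].
rewrite pL1Z// (pL1_hl_derive u1 x0) -!u_init// /source /extend /pL1_extend !pos_id//.
rewrite (solutionE t0 x0); move: (expR _) (sol _ _ _ _) (pL1 _ _) => E S P; ring.
Qed.

Hypothesis alpha0 : alpha != 0.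

Lemma increment_vanishes T x : 0 < T -> Cb 1 u0 -> L1 (hl_derive u0) ->
  u 0 0 = 0 ->
  (forall t, 0 <= t -> u 0 (t + T) = u 0 t) ->
  (forall t, 0 <= t -> {ae mu, forall y, 0 <= y -> f y (t + T) = f y t}) ->
  0 <= x -> vanishes (fun t => u x (t + T) - u x t).
Proof.
move=> T0 u1 du u00 uT fT x0; have [fL _] := fC.
have tT0 t : 0 <= t -> 0 <= t + T by move=> ?; rewrite addr_ge0// ltW.
have M0 y : M 0 y = 0 by rewrite /M /tprim prim0.
pose Fs (t : R) y := alpha * hl_derive u0 y - f y t.
have FsL t : 0 <= t -> L1 (Fs t) by move=> t0; apply: L1B; [exact: L1Z|exact: fL].
have [B hB] : exists B, forall L, 0 <= L -> energy k M T L <= B.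
  have [C1 h1] := C_L1_bdd_loc fC (ltW T0).
  have [C2 h2] := C_Cb_bdd_loc uC (ltW T0).
  pose a := fun y => alpha * hl_derive u0 y.
  have aL : L1 a := L1Z alpha du.
  (* One constant for both the [L^1] norms of [Fs t] and the boundary coefficient
     [alpha * u 0 t]. *)
  pose D := l1 a + `|C1| + `|alpha| * `|C2| + l1 a.
  have la : 0 <= l1 a := l1_ge0 a.
  have c2 : 0 <= `|alpha| * `|C2| by apply: mulr_ge0.
  have E t y : 0 <= t <= T -> 0 <= y -> m t y = alpha * sol k M t y +
      alpha * u 0 t * expR (- k * y) + pL1 (Fs t) y.
    by move=> /andP[t0 _] y0; rewrite /m (sourceE u1 du t0 y0) u00 subr0 mulr0 addr0.
  apply: (@forced_energy_bdd R k alpha k0 M m nM nm dM M0 T D _ Fs (ltW T0) _ _ _ E).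
  - by move=> t /andP[t0 _]; exact: FsL.
  - move=> t tT; have [t0 _] := andP tT.
    have := l1_triangle aL (FsL t t0).
    have -> : l1 (fun y => Fs t y - a y) = l1 (f ^~ t).
      rewrite /l1; congr (Rintegral _ _ _); apply/funext => y.
      by rewrite /Fs /a addrAC subrr sub0r normrN.
    have := h1 t tT; have := ler_norm C1; rewrite /D; lra.
  - move=> t tT; rewrite normrM.
    have : `|alpha| * `|u 0 t| <= `|alpha| * `|C2|.
      by apply: ler_wpM2l => //; apply: le_trans (ler_norm C2); apply: h2.
    have := normr_ge0 C1; rewrite /D; lra.
(* At [t = 0] this difference is [M T], because [M 0 = 0]: the energy of [K[M]] after one period is
   the initial energy of the increment. *)
pose Mw t y := M (t + T) y - M t y.
pose mw t y := m (t + T) y - m t y.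
have nMw : nice Mw by apply: niceB => //; exact: nice_shift.
have nmw : nice mw by apply: niceB => //; exact: nice_shift.
have dMw t y : is_derive t 1 (Mw ^~ y) (mw t y).
  exact: derB (der_shift (dM (t + T) y)) (dM t y).
have solw t y : sol k Mw t y = sol k M (t + T) y - sol k M t y.
  rewrite /sol /Mw (kernelB k0)//; [exact: (nice_x nM)|exact: (nice_x nM)|
    exact: nice_bdd|exact: nice_bdd].
have wE t y : 0 <= t -> 0 <= y -> u y (t + T) - u y t = sol k Mw t y.
  move=> t0 y0; rewrite solw (solutionE (tT0 t t0) y0) (solutionE t0 y0) uT//.
  by move: (expR _) (sol _ _ _ _) (sol _ _ _ _) => E S S'; ring.
have mwE t y : 0 <= t -> 0 <= y -> mw t y = alpha * sol k Mw t y.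
  (* Periodicity cancels the primitives of [f], equality almost everywhere being enough for them,
     and the source of the increment becomes [alpha w]. *)
  move=> t0 y0; rewrite -wE// /mw /m /source /extend /pL1_extend !pos_id//; last exact: tT0.
  rewrite (ae_pL1 y (fL _ (tT0 t t0)) (fL t t0) (fT t t0)).
  by move: (pL1 _ _) => P; ring.
have EB L : 0 <= L -> energy k Mw 0 L <= B.
  move=> L0; apply: le_trans (hB L L0).
  have E0 : Mw 0 = M T by apply/funext => y; rewrite /Mw add0r M0 subr0.
  by rewrite /energy /sol /sol_x E0.
have V := sol_vanishes k0 alpha0 nMw nmw dMw mwE EB x0.
move=> e e0; have [S hS] := V e e0; exists (Num.max S 0) => t.
by rewrite ge_max => /andP[St t0]; rewrite wE//; exact: hS.
Qed.

End assembly.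

Theorem theorem3p1 (R : realType) (alpha gamma T0 : R)
    (u0 g : R -> R) (f u : R -> R -> R)
    (hgamma : 0 < gamma) (halpha : alpha != 0) (hT0 : 0 < T0)
    (hu0 : Cb 2 u0) (hu0' : L1 (hl_derive u0))
    (hg : {within @halfline R, continuous g}) (hg0 : g 0 = 0)
    (hf : C_L1 f)
    (hgT : forall t : R, 0 <= t -> g (t + T0) = g t)
    (hfT : forall t : R, 0 <= t ->
       {ae @lebesgue_measure R, forall x : R, 0 <= x -> f x (t + T0) = f x t})
    (hu : is_solution alpha gamma f u0 g u) :
  forall x : R, 0 < x -> (u x (t + T0) - u x t) @[t --> +oo] --> (0 : R).
Proof.
have [uC uf hu1 hug] := hu; move=> x x0.
pose k := (Num.sqrt gamma)^-1.
have k0 : 0 < k by rewrite invr_gt0 sqrtr_gt0.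
have kg : (k ^+ 2)^-1 = gamma by rewrite exprVn invrK sqr_sqrtr// ltW.
have u01 : Cb 1 u0.
  by case: hu0 => c b [d [c' b' _]].
have u0t t : 0 <= t -> u 0 t = g t := hug t.
apply/vanishes_cvg.
apply: (increment_vanishes k0 hu1 kg uC hf uf halpha hT0 u01 hu0') => //.
- by rewrite u0t.
- by move=> t t0; rewrite !u0t ?hgT// addr_ge0// ltW.
- exact: ltW.
Qed.
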